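(* There exists a universal constant $C>0$ such that for every $n\ge 1$ and every isotropic log-concave function $f$ on $\mathbb{R}^n$, $$\int_0^\infty \mathcal{H}^{n-1}\big(\partial\{x\in\mathbb{R}^n:\ f(x)\ge t\}\big)\,dt\le Cn.$$
   Context: A function $f:\mathbb{R}^n\to[0,\infty)$ is log-concave if $f=e^{-\psi}$ with $\psi:\mathbb{R}^n\to(-\infty,\infty]$ convex. It is isotropic if $\int f(x)\,dx=1$, $\int x f(x)\,dx=0$ and $\int x\otimes x\,f(x)\,dx=I_n$. $\mathcal{H}^{n-1}$ is the $(n-1)$-dimensional Hausdorff measure and $\partial$ denotes topological boundary. *)

(* Defs.v *)
From HB Require Import structures.
From mathcomp Require Import all_boot all_order all_algebra.
From mathcomp Require Import all_classical all_reals all_analysis.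

Set Implicit Arguments.
Unset Strict Implicit.
Unset Printing Implicit Defensive.
Import Order.TTheory GRing.Theory Num.Theory.
Import numFieldNormedType.Exports.
Local Open Scope classical_set_scope.
Local Open Scope ring_scope.

(* R^n is 'rV[R]_n, with its canonical product topology (whose norm is the sup
   norm, hence the Euclidean norm [enorm] below) and the sigma-algebra generated
   by the coordinates, i.e. the Borel one. *)
Section measurable_rV.
Context {R : realType} {n : nat}.

Definition rV_coord (i : 'I_n) (x : 'rV[R]_n) : R := x ord0 i.

Let rV_set0 : g_sigma_preimage rV_coord set0.
Proof. exact: sigma_algebra0. Qed.

Let rV_setC A : g_sigma_preimage rV_coord A -> g_sigma_preimage rV_coord (~` A).
Proof. exact: sigma_algebraC. Qed.

Let rV_bigcup (F : _^nat) : (forall i, g_sigma_preimage rV_coord (F i)) ->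
  g_sigma_preimage rV_coord (\bigcup_i (F i)).
Proof. exact: sigma_algebra_bigcup. Qed.

HB.instance Definition _ := @isMeasurable.Build default_measure_display
  'rV[R]_n (g_sigma_preimage rV_coord) rV_set0 rV_setC rV_bigcup.

End measurable_rV.

Section measurable_fun_rV.
Context {R : realType}.

Lemma measurable_rV_coord n (i : 'I_n) :
  measurable_fun [set: 'rV[R]_n] (rV_coord i).
Proof.
move=> _ Y mY; rewrite setTI; apply: sub_sigma_algebra => /=.
rewrite -bigcup_seq/=; exists i => /=; first by rewrite mem_index_enum.
by exists Y => //; rewrite setTI.
Qed.

Lemma measurable_fun_rVP d (T : measurableType d) n (f : T -> 'rV[R]_n) :
  measurable_fun [set: T] f <->
  forall i, measurable_fun [set: T] (rV_coord i \o f).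
Proof.
split=> [mf i|mf].
  by apply: measurableT_comp => //; exact: measurable_rV_coord.
have H : g_sigma_preimage (fun i => rV_coord i \o f) `<=` measurable.
  apply: smallest_sub; first exact: sigma_algebra_measurable.
  rewrite -bigcup_seq/= => A [i _ [B mB <-]].
  exact: mf.
rewrite g_sigma_preimage_comp in H.
by move=> _ A mA; apply: H; exists A.
Qed.

Lemma measurable_fun_rV_cons n :
  measurable_fun [set: R * 'rV[R]_n]
    (fun p => row_mx p.1%:M p.2 : 'rV[R]_(1 + n)).
Proof.
apply/measurable_fun_rVP => i; case: (split_ordP i) => j ->.
  rewrite (_ : _ \o _ = fst); first exact: measurable_fst.
  by apply/funext => p /=; rewrite /rV_coord row_mxEl !mxE (ord1 j) mulr1n.
rewrite (_ : _ \o _ = rV_coord j \o snd).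
  by apply: measurableT_comp; [exact: measurable_rV_coord|exact: measurable_snd].
by apply/funext => p /=; rewrite /rV_coord row_mxEr.
Qed.

Lemma measurable_fun_rV_uncons n :
  measurable_fun [set: 'rV[R]_(1 + n)]
    (fun x => (rV_coord (lshift n ord0) x, rsubmx x) : R * 'rV[R]_n).
Proof.
apply: measurable_fun_pair; first exact: measurable_rV_coord.
apply/measurable_fun_rVP => i.
rewrite (_ : _ \o _ = rV_coord (rshift 1 i)); first exact: measurable_rV_coord.
by apply/funext => x; rewrite /rV_coord/= mxE.
Qed.

End measurable_fun_rV.

(* Lebesgue measure on R^n, as the iterated product: Dirac mass on the
   one-point space R^0, then slicing along the first coordinate. *)
Fixpoint lebesgue_rV {R : realType} (n : nat) : set 'rV[R]_n -> \bar R :=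
  match n with
  | 0 => \d_(0 : 'rV[R]_0)
  | m.+1 => fun A => (\int[@lebesgue_measure R]_x
      lebesgue_rV [set v : 'rV[R]_m | A (row_mx x%:M v : 'rV[R]_(1 + m))])%E
  end.

Section sigma_finite_product.
Context d1 d2 (T1 : measurableType d1) (T2 : measurableType d2) (R : realType).
Variable m1 : {sigma_finite_measure set T1 -> \bar R}.
Variable m2 : {sigma_finite_measure set T2 -> \bar R}.

Lemma sigma_finite_product_measure1 : sigma_finite setT (m1 \x m2)%E.
Proof.
have /sigma_finiteP[F [TF ndF Foo]] := sigma_finiteT m1.
have /sigma_finiteP[G [TG ndG Goo]] := sigma_finiteT m2.
exists (fun n => F n `*` G n).
  rewrite -setXTT TF TG predeqE => -[x y]; split.
    move=> [/= [n _ Fnx] [k _ Gky]]; exists (maxn n k) => //; split.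
    - by move: x Fnx; exact/subsetPset/ndF/leq_maxl.
    - by move: y Gky; exact/subsetPset/ndG/leq_maxr.
  by move=> [n _ []/= ? ?]; split; exists n.
move=> k; have [? ?] := Foo k; have [? ?] := Goo k.
split; first exact: measurableX.
by rewrite product_measure1E// lte_mul_pinfty// ge0_fin_numE.
Qed.

End sigma_finite_product.

Lemma sigma_finite_measure_exists d (T : measurableType d) (R : realType)
    (mu : set T -> \bar R) :
  mu set0 = 0%E -> (forall A, 0 <= mu A)%E -> semi_sigma_additive mu ->
  sigma_finite setT mu ->
  exists nu : {sigma_finite_measure set T -> \bar R}, mu = nu.
Proof.
move=> mu0 mu_ge0 mu_add mu_sf.
pose m : {measure set T -> \bar R} :=
  HB.pack mu (isMeasure.Build _ _ _ mu mu0 mu_ge0 mu_add).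
pose nu : {sigma_finite_measure set T -> \bar R} :=
  HB.pack (Measure.sort m) (Measure_isSigmaFinite.Build _ _ _ m mu_sf).
by exists nu.
Qed.

Section lebesgue_rV_measure.
Context {R : realType}.

Lemma lebesgue_rVS n (A : set 'rV[R]_n.+1)
    (m : {sigma_finite_measure set 'rV[R]_n -> \bar R}) :
  @lebesgue_rV R n = m ->
  lebesgue_rV A = pushforward (@lebesgue_measure R \x m)%E
    (fun p => row_mx p.1%:M p.2 : 'rV[R]_(1 + n)) A.
Proof.
move=> nm; rewrite /pushforward /product_measure1 /=.
apply: eq_integral => x _ /=; rewrite nm; congr (m _).
by rewrite /xsection; apply/seteqP; split => v /=; rewrite inE.
Qed.

Lemma lebesgue_rV_sigma_finite_measure n :
  exists m : {sigma_finite_measure set 'rV[R]_n -> \bar R}, lebesgue_rV (n:=n) = m.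
Proof.
elim: n => [|n [m nm]].
  by exists (\d_(0 : 'rV[R]_0)).
pose f (p : R * 'rV[R]_n) := row_mx p.1%:M p.2 : 'rV[R]_n.+1.
have mf : measurable_fun setT f := @measurable_fun_rV_cons R n.
pose g (x : 'rV[R]_n.+1) :=
  (@rV_coord R n.+1 (@lshift 1 n ord0) x, @rsubmx R 1 1 n x) : R * 'rV[R]_n.
have mg : measurable_fun setT g := @measurable_fun_rV_uncons R n.
have fK : cancel f g.
  move=> [x v]; rewrite /g /f /=; congr pair; last by rewrite row_mxKr.
  by rewrite /rV_coord (@row_mxEl R 1 1 n) mxE eqxx mulr1n.
pose mu := pushforward (@lebesgue_measure R \x m)%E f.
pose mu0 := measure_function_pushforward__canonical__measure_function_Measure
  (@lebesgue_measure R \x m)%E mf.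
have sf : sigma_finite setT mu.
  have [F UF Foo] := sigma_finite_product_measure1 (@lebesgue_measure R) m.
  exists (fun k => g @^-1` F k).
    by rewrite -preimage_bigcup -UF preimage_setT.
  move=> k; have [mF Fk] := Foo k; split.
    by rewrite -[X in measurable X]setTI; exact: mg.
  rewrite /mu /pushforward -comp_preimage.
  by rewrite (_ : g \o f = id)//; apply/funext => p /=; rewrite fK.
have [nu munu] := sigma_finite_measure_exists (measure0 mu0) (measure_ge0 mu0)
  (@measure_semi_sigma_additive _ _ _ mu0) sf.
exists nu; rewrite -munu.
by apply/funext => A; rewrite (lebesgue_rVS _ nm).
Qed.

Let lebesgue_rV0 n : lebesgue_rV (set0 : set 'rV[R]_n) = 0%E.
Proof.
by have [m ->] := lebesgue_rV_sigma_finite_measure n; rewrite measure0.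
Qed.

Let lebesgue_rV_ge0 n (A : set 'rV[R]_n) : (0 <= lebesgue_rV A)%E.
Proof.
by have [m ->] := lebesgue_rV_sigma_finite_measure n; rewrite measure_ge0.
Qed.

Let lebesgue_rV_semi_sigma_additive n :
  semi_sigma_additive (@lebesgue_rV R n).
Proof.
have [m ->] := lebesgue_rV_sigma_finite_measure n.
exact: measure_semi_sigma_additive.
Qed.

HB.instance Definition _ n := isMeasure.Build _ _ _ (@lebesgue_rV R n)
  (lebesgue_rV0 n) (@lebesgue_rV_ge0 n) (@lebesgue_rV_semi_sigma_additive n).

Let lebesgue_rV_sigma_finite n : sigma_finite setT (@lebesgue_rV R n).
Proof.
have [m ->] := lebesgue_rV_sigma_finite_measure n; exact: sigma_finiteT.
Qed.

HB.instance Definition _ n := Measure_isSigmaFinite.Build _ _ _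
  (@lebesgue_rV R n) (@lebesgue_rV_sigma_finite n).

End lebesgue_rV_measure.

Section hausdorff_measure.
Context {R : realType}.

Definition enorm n (x : 'rV[R]_n) : R := Num.sqrt (\sum_(i < n) x ord0 i ^+ 2).

Definition ediam n (A : set 'rV[R]_n) : \bar R :=
  ereal_sup [set (enorm (p.1 - p.2))%:E | p in A `*` A].

Local Open Scope ereal_scope.

(* The weight omega_s (diam A / 2)^s, omega_s being the volume of the Euclidean
   unit ball of R^s. With it hausdorff s is the s-dimensional surface measure
   (and Lebesgue measure for s = n); without omega_s / 2^s it would be off by a
   factor growing superexponentially in s. The separate clause for set0 matters for s = 0, where
   (diam A / 2)^0 = 1. *)
Definition hausdorff_weight (s : nat) n (A : set 'rV[R]_n) : \bar R :=
  if A == set0 then 0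
  else lebesgue_rV [set x : 'rV[R]_s | (enorm x <= 1)%R]
       * ((2^-1)%R%:E * ediam A) ^+ s.

Definition hausdorff_delta (s : nat) (delta : R) n (A : set 'rV[R]_n) : \bar R :=
  ereal_inf [set \sum_(0 <= k <oo) hausdorff_weight s (U k) |
    U in [set U : (set 'rV[R]_n)^nat |
      A `<=` \bigcup_k U k /\ forall k, ediam (U k) <= delta%:E]].

Definition hausdorff (s : nat) n (A : set 'rV[R]_n) : \bar R :=
  ereal_sup [set hausdorff_delta s delta A | delta in [set d : R | (0 < d)%R]].

End hausdorff_measure.

Definition boundary (T : topologicalType) (A : set T) : set T :=
  closure A `\` A°.

Section log_concave.
Context {R : realType} {n : nat}.

Definition convex_ereal (psi : 'rV[R]_n -> \bar R) : Prop :=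
  forall (x y : 'rV[R]_n) (t : R), 0 <= t <= 1 ->
    (psi (t *: x + (1 - t) *: y)%R <= t%:E * psi x + (1 - t)%R%:E * psi y)%E.

Definition log_concave (f : 'rV[R]_n -> R) : Prop :=
  exists psi : 'rV[R]_n -> \bar R,
    [/\ forall x, psi x != -oo%E, convex_ereal psi &
        forall x, (f x)%:E = expeR (- psi x)%E].

(* The vector and matrix equalities are stated entrywise. A log-concave f need
   not be Borel; it is however Lebesgue measurable, and since \int is the
   supremum over the Borel simple functions below the positive (negative) part,
   it then agrees with the integral for the completed measure. Integrability in
   the last two clauses is automatic, as \int is -oo in the case +oo - +oo. *)
Definition isotropic (f : 'rV[R]_n -> R) : Prop :=
  [/\ (\int[@lebesgue_rV R n]_x (f x)%:E = 1)%E,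
      forall i, (\int[@lebesgue_rV R n]_x (x ord0 i * f x)%R%:E = 0)%E &
      forall i j, (\int[@lebesgue_rV R n]_x (x ord0 i * x ord0 j * f x)%R%:E =
                   ((1%:M : 'M[R]_n) i j)%:E)%E].

End log_concave.

(* Main.v *)
Require Import Defs.
From mathcomp Require Import all_boot all_order all_algebra.
From mathcomp Require Import all_classical all_reals all_analysis.
From mathcomp Require Import measurable_realfun ring lra.
Import Order.TTheory GRing.Theory Num.Theory.
Import numFieldNormedType.Exports.
Local Open Scope classical_set_scope.
Local Open Scope ring_scope.
Set Implicit Arguments.
Unset Strict Implicit.
Unset Printing Implicit Defensive.

(** Write K_t for the superlevel set of f at height t. A uniform Euclidean ball
    inside the convex sets K_t would make the theorem a consequence of the
    elementary inequality perimeter <= volume of a neighbourhood / radius, of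
    the layer cake formula and of the normalisation of f. No such ball exists
    for large t, but a ball at the barycentre is inside all of them at the price
    of an exponential factor in t, and such a factor can be afforded.

    [isotropic_ball]: if |b| < r, then f (b) >= q ^ (2n) f (p) for all p, where q
    and r are numerical constants. Indeed the set where f is smaller carries
    little mass, because contracting it by the factor 2 towards p multiplies f by
    q ^ (-n) and volume by 2 ^ (-n) only ([mass_of_small_values]). Its complement
    is convex; if it missed a point near the barycentre, a half space with
    boundary near the barycentre would have little mass. A linear functional
    with mean 0 and variance 1 would then have a small mean absolute value,
    against the reverse Hoelder inequality [mean_abs_dotv_gt]. The latter is
    deduced from the Prekopa-Leindler inequality [prekopa_leindler_midpoint].

    [level_set_shrunk]: if x is in K_t and |b| < r, the combination of x and b
    with weights 1 - 1 / (2n) and 1 / (2n) is in K_(ct) for a constant c, since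
    the weight 1 / (2n) turns q ^ (2n) into q. Hence K_t, shrunk by 1 - 1 / (2n),
    has a neighbourhood of radius of order 1 / n that is contained in K_(ct).
    Undoing the shrinking multiplies the perimeter by at most 2.

    [fcover_boundary]: if the neighbourhood of radius 2 rho of a convex body K is
    contained in E, the measure of its boundary in dimension n - 1 is at most
    |E| / rho. To see this, take a polytope around K, at distance at most rho.
    The outward prisms of height rho over its facets are disjoint and contained
    in E, so that its facets have total area at most |E| / rho, and the metric
    projection onto K, which does not increase distances, maps them onto the
    boundary of K. The area of a facet is Lebesgue measure in its hyperplane;
    it bounds the Hausdorff measure, with the constant 1, through an exhaustion
    by small balls ([fcover_lebesgue]).

    Together, the boundary of K_t has measure at most C n |K_(ct)|, and the
    integral of |K_(ct)| over t is 1 / c by [layer_cake].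

    Two facts of measure theory enter. First, f is replaced by [lsc_part], which
    vanishes outside the interior of the support and is lower semicontinuous;
    the two functions differ on a null set as the boundary of a convex set is
    null ([convex_boundary_null]). Secondly, dilations and reflections act on
    Lebesgue measure as they should, by the uniqueness of translation invariant
    measures ([haar_uniqueness]). *)

(** * Lebesgue measure on row vectors *)

Section cons_vector.
Context {R : realType} {n : nat}.

Definition consv (x : R) (v : 'rV[R]_n) : 'rV[R]_n.+1 :=
  row_mx x%:M v : 'rV[R]_(1 + n).

Definition tailv (w : 'rV[R]_n.+1) : 'rV[R]_n := \row_i w ord0 (lift ord0 i).

Lemma consv0 x v : consv x v ord0 ord0 = x.
Proof.
rewrite /consv [X in _ _ _ X = _](_ : _ = lshift n (ord0 : 'I_1)); last exact/val_inj.
by rewrite (@row_mxEl R 1 1 n) mxE eqxx mulr1n.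
Qed.

Lemma consvS x v i : consv x v ord0 (lift ord0 i) = v ord0 i.
Proof.
by rewrite /consv (_ : lift ord0 i = rshift 1 i) ?(@row_mxEr R 1 1 n)//; exact/val_inj.
Qed.

Lemma consvK (w : 'rV[R]_n.+1) : consv (w ord0 ord0) (tailv w) = w.
Proof.
apply/rowP => i; case: (unliftP ord0 i) => [j ->|->].
  by rewrite consvS mxE.
by rewrite consv0.
Qed.

Lemma tailvK x v : tailv (consv x v) = v.
Proof. by apply/rowP => i; rewrite mxE consvS. Qed.

Lemma consvD x y v w : consv x v + consv y w = consv (x + y) (v + w).
Proof.
apply/rowP => i; case: (unliftP ord0 i) => [j ->|->].
  by rewrite mxE !consvS mxE.
by rewrite mxE !consv0.
Qed.

Lemma consvZ a x v : a *: consv x v = consv (a * x) (a *: v).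
Proof.
apply/rowP => i; case: (unliftP ord0 i) => [j ->|->].
  by rewrite mxE !consvS mxE.
by rewrite mxE !consv0.
Qed.

Lemma measurable_consv :
  measurable_fun [set: R * 'rV[R]_n] (fun p => consv p.1 p.2).
Proof. exact: measurable_fun_rV_cons. Qed.

Lemma measurable_consv1 x : measurable_fun [set: 'rV[R]_n] (consv x).
Proof. exact: (measurableT_comp measurable_consv (measurable_pair1 x)). Qed.

End cons_vector.

Section lebesgue_slices.
Context {R : realType} {n : nat}.
Local Open Scope ereal_scope.

(** Tonelli for the first coordinate, through which statements about integrals
    are proved by induction on the dimension. *)
Lemma integral_rVS (f : 'rV[R]_n.+1 -> \bar R) :
  measurable_fun [set: 'rV[R]_n.+1] f -> (forall x, 0 <= f x) ->
  \int[@lebesgue_rV R n.+1]_w f w =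
  \int[@lebesgue_measure R]_x \int[@lebesgue_rV R n]_v f (consv x v).
Proof.
move=> mf f0.
pose P := measure_function_pushforward__canonical__measure_function_Measure
  (@lebesgue_measure R \x @lebesgue_rV R n)%E (@measurable_consv R n).
rewrite (@eq_measure_integral _ _ _ _ P); last first.
  move=> A mA _.
  exact: (@lebesgue_rVS R n A (@lebesgue_rV R n)).
rewrite [LHS]ge0_integral_pushforward//; last exact: measurable_consv.
by rewrite preimage_setT fubini_tonelli1//=; exact: measurableT_comp measurable_consv.
Qed.

Lemma measurable_integral_slice (f : 'rV[R]_n.+1 -> \bar R) :
  measurable_fun [set: 'rV[R]_n.+1] f -> (forall x, 0 <= f x) ->
  measurable_fun setT (fun x : R => \int[@lebesgue_rV R n]_v f (consv x v)).
Proof.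
move=> mf f0.
apply: (measurable_fun_fubini_tonelli_F (m2 := @lebesgue_rV R n)
  (fun p : R * 'rV[R]_n => f (consv p.1 p.2))) => //.
exact: measurableT_comp measurable_consv.
Qed.

Lemma lebesgue_rVSE (A : set 'rV[R]_n.+1) :
  lebesgue_rV A =
  \int[@lebesgue_measure R]_x lebesgue_rV [set v : 'rV[R]_n | A (consv x v)].
Proof. by []. Qed.

Lemma measurable_slice (A : set 'rV[R]_n.+1) x : measurable A ->
  measurable [set v : 'rV[R]_n | A (consv x v)].
Proof.
by move=> mA; rewrite -[X in measurable X]setTI; exact: measurable_consv1.
Qed.

Lemma measurable_lebesgue_slice (A : set 'rV[R]_n.+1) : measurable A ->
  measurable_fun setT
    (fun x : R => lebesgue_rV [set v : 'rV[R]_n | A (consv x v)]).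
Proof.
move=> mA.
have mI : measurable_fun setT (fun x => (\1_A x : R)%:E).
  by apply/measurable_EFinP; exact: measurable_indic.
rewrite [X in measurable_fun _ X](_ : _ =
    fun x => \int[@lebesgue_rV R n]_v (\1_A (consv x v) : R)%:E).
  by apply: (measurable_integral_slice mI) => x; rewrite lee_fin.
apply/funext => x; rewrite -[A in LHS]setIT.
by rewrite -(integral_indic _ measurableT (measurable_slice x mA)).
Qed.

End lebesgue_slices.

Section lebesgue1_translation.
Context {R : realType}.
Local Open Scope ereal_scope.

Lemma lebesgue_measure_shift (c : R) (A : set R) : measurable A ->
  lebesgue_measure ((fun x : R => (x + c)%R) @^-1` A) = lebesgue_measure A.
Proof.
move=> mA.
have ms : measurable_fun setT (fun x : measurableTypeR R => (x + c)%R : measurableTypeR R).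
  exact: measurable_funD.
pose P := measure_function_pushforward__canonical__measure_function_Measure
  (@lebesgue_measure R) ms.
apply/esym/(@lebesgue_measure_unique _ P) => // _ [[a b]] _ <-.
rewrite /P/= /pushforward.
have -> : (fun x : R => (x + c)%R) @^-1` `]a, b]%classic = `](a - c)%R, (b - c)%R]%classic.
  by apply/seteqP; split=> x /=; rewrite !in_itv/= ltrBlDr lerBrDr.
by rewrite !lebesgue_measure_itv/= !lte_fin ltrD2r; case: ifP => // _;
  rewrite -!EFinD; congr EFin; ring.
Qed.

Lemma integral_shift (c : R) (f : R -> \bar R) :
  measurable_fun [set: R] f -> (forall x, 0 <= f x) ->
  \int[@lebesgue_measure R]_x f (x + c)%R = \int[@lebesgue_measure R]_x f x.
Proof.
move=> mf f0.
have ms : measurable_fun setT (fun x : measurableTypeR R => (x + c)%R : measurableTypeR R).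
  exact: measurable_funD.
pose P := measure_function_pushforward__canonical__measure_function_Measure
  (@lebesgue_measure R) ms.
rewrite [RHS](@eq_measure_integral _ _ _ _ P); last first.
  by move=> A mA _; apply/esym/lebesgue_measure_shift.
by rewrite [RHS]ge0_integral_pushforward// preimage_setT.
Qed.

End lebesgue1_translation.


(** * Euclidean geometry of row vectors *)

Section euclid.
Context {R : realType} {n : nat}.
Implicit Types (x y z : 'rV[R]_n) (a : R).

Definition dotv x y : R := \sum_(i < n) x ord0 i * y ord0 i.

Lemma dotvC x y : dotv x y = dotv y x.
Proof. by apply: eq_bigr => i _; rewrite mulrC. Qed.

Lemma dotvDl x y z : dotv (x + y) z = dotv x z + dotv y z.
Proof. by rewrite -big_split; apply: eq_bigr => i _; rewrite mxE mulrDl. Qed.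

Lemma dotvZl a x y : dotv (a *: x) y = a * dotv x y.
Proof. by rewrite /dotv big_distrr/=; apply: eq_bigr => i _; rewrite mxE mulrA. Qed.

Lemma dotvNl x y : dotv (- x) y = - dotv x y.
Proof. by rewrite -scaleN1r dotvZl mulN1r. Qed.

Lemma dotvBl x y z : dotv (x - y) z = dotv x z - dotv y z.
Proof. by rewrite dotvDl dotvNl. Qed.

Lemma dotvDr x y z : dotv z (x + y) = dotv z x + dotv z y.
Proof. by rewrite dotvC dotvDl !(dotvC z). Qed.

Lemma dotvZr a x y : dotv x (a *: y) = a * dotv x y.
Proof. by rewrite dotvC dotvZl dotvC. Qed.

Lemma dotvNr x y : dotv x (- y) = - dotv x y.
Proof. by rewrite dotvC dotvNl dotvC. Qed.

Lemma dotvBr x y z : dotv z (x - y) = dotv z x - dotv z y.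
Proof. by rewrite dotvDr dotvNr. Qed.

Lemma dotv0l x : dotv 0 x = 0.
Proof. by rewrite -(scale0r x) dotvZl mul0r. Qed.

Lemma dotv_ge0 x : 0 <= dotv x x.
Proof. by apply: sumr_ge0 => i _; rewrite -expr2 sqr_ge0. Qed.

Lemma enormE x : enorm x = Num.sqrt (dotv x x).
Proof. by congr Num.sqrt; apply: eq_bigr => i _; rewrite expr2. Qed.

Lemma enorm_ge0 x : 0 <= enorm x.
Proof. exact: sqrtr_ge0. Qed.

Lemma sqr_enorm x : enorm x ^+ 2 = dotv x x.
Proof. by rewrite enormE sqr_sqrtr// dotv_ge0. Qed.

Lemma enorm0 : enorm (0 : 'rV[R]_n) = 0.
Proof. by rewrite enormE dotv0l sqrtr0. Qed.

Lemma enorm_le x a : 0 <= a -> (enorm x <= a) = (dotv x x <= a ^+ 2).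
Proof. by move=> a0; rewrite -sqr_enorm ler_pXn2r ?nnegrE// enorm_ge0. Qed.

Lemma dotv_eq0 x : dotv x x <= 0 -> x = 0.
Proof.
move=> x0; apply/rowP => i; rewrite mxE.
have /psumr_eq0P H : \sum_(i < n) x ord0 i * x ord0 i = 0.
  by apply/le_anti/andP; split=> //; exact: dotv_ge0.
apply/eqP; rewrite -sqrf_eq0 expr2 H// => j _.
by rewrite -expr2 sqr_ge0.
Qed.

Lemma enorm_gt0 x : x != 0 -> 0 < enorm x.
Proof.
move=> x0; rewrite lt_neqAle enorm_ge0 andbT eq_sym; apply: contra_neq x0 => x0.
by apply: dotv_eq0; rewrite -sqr_enorm x0 expr0n.
Qed.

Lemma enormZ a x : enorm (a *: x) = `|a| * enorm x.
Proof.
by rewrite !enormE dotvZl dotvZr mulrA -expr2 sqrtrM ?sqr_ge0// sqrtr_sqr.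
Qed.

Lemma enormN x : enorm (- x) = enorm x.
Proof. by rewrite !enormE dotvNl dotvNr opprK. Qed.

Lemma enormBC x y : enorm (x - y) = enorm (y - x).
Proof. by rewrite -enormN opprB. Qed.

Lemma cauchy_schwarz x y : dotv x y <= enorm x * enorm y.
Proof.
have [->|y0] := eqVneq y 0; first by rewrite dotvC dotv0l enorm0 mulr0.
have ny := enorm_gt0 y0.
have := dotv_ge0 (enorm y *: x - enorm x *: y).
rewrite dotvBl !dotvBr !dotvZl !dotvZr -!sqr_enorm (dotvC y x) => H.
have [->|x0] := eqVneq x 0; first by rewrite dotv0l enorm0 mul0r.
have nx := enorm_gt0 x0.
have {}H : 0 <= (2 * (enorm x * enorm y)) * (enorm x * enorm y - dotv x y).
  by apply: le_trans H _; rewrite le_eqVlt; apply/orP; left; apply/eqP; ring.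
by move: H; rewrite pmulr_rge0 ?subr_ge0// !mulr_gt0.
Qed.

Lemma cauchy_schwarz_norm x y : `|dotv x y| <= enorm x * enorm y.
Proof.
rewrite ler_norml cauchy_schwarz andbT lerNl -dotvNl -(enormN x).
exact: cauchy_schwarz.
Qed.

Lemma enormD x y : enorm (x + y) <= enorm x + enorm y.
Proof.
rewrite enorm_le ?addr_ge0 ?enorm_ge0// dotvDl !dotvDr -!sqr_enorm (dotvC y).
by have := cauchy_schwarz x y; nra.
Qed.

Lemma enorm_dist y x z : enorm (x - z) <= enorm (x - y) + enorm (y - z).
Proof. by rewrite (le_trans _ (enormD _ _))// addrA subrK. Qed.

Lemma coord_le_enorm x i : `|x ord0 i| <= enorm x.
Proof.
rewrite -(ler_pXn2r (n:=2)) ?nnegrE ?enorm_ge0// sqr_enorm /dotv (bigD1 i)//=.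
by rewrite real_normK ?num_real// expr2 lerDl sumr_ge0// => j _; rewrite -expr2 sqr_ge0.
Qed.

Lemma enorm_le_coord x a : 0 <= a -> (forall i, `|x ord0 i| <= a) ->
  enorm x <= Num.sqrt n%:R * a.
Proof.
move=> a0 xa; rewrite enorm_le ?mulr_ge0 ?sqrtr_ge0//.
rewrite exprMn sqr_sqrtr// -[n in n%:R]card_ord -sum1_card natr_sum.
rewrite big_distrl/= ler_sum// => i _; rewrite mul1r -expr2 -real_normK ?num_real//.
by rewrite ler_pXn2r ?nnegrE.
Qed.

(** The topology of row vectors is that of the supremum norm; this gives access
    to it through Euclidean balls. *)
Lemma nbhs_enormP x (A : set 'rV[R]_n) :
  nbhs x A <-> exists2 e, 0 < e & forall y, enorm (y - x) < e -> A y.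
Proof.
split=> [/nbhs_ballP[e /= e0 xA]|[e e0 eA]].
  exists e => // y xy; apply: xA; split=> // i j; rewrite (ord1 i).
  rewrite /ball/= distrC; have := coord_le_enorm (y - x) j.
  by rewrite !mxE => /le_lt_trans; apply.
have s0 : 0 < Num.sqrt n%:R + 1 :> R by rewrite ltr_wpDl// sqrtr_ge0.
apply/nbhs_ballP; exists (e / (Num.sqrt n%:R + 1)) => /=; first by rewrite divr_gt0.
move=> y [_ xy]; apply: eA.
have : enorm (y - x) <= Num.sqrt n%:R * (e / (Num.sqrt n%:R + 1)).
  apply: enorm_le_coord; first by rewrite ltW// divr_gt0.
  by move=> i; have := xy ord0 i; rewrite !mxE distrC => /ltW.
move/le_lt_trans; apply; rewrite mulrCA gtr_pMr// ltr_pdivrMr// mul1r.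
by rewrite ltrDl.
Qed.

Lemma closure_enormP x (A : set 'rV[R]_n) :
  closure A x <-> forall e, 0 < e -> exists2 y, A y & enorm (y - x) < e.
Proof.
split=> [Ax e e0|xA B /nbhs_enormP[e e0 eB]].
  have /Ax[y [Ay ye]] : nbhs x [set y | enorm (y - x) < e].
    by apply/nbhs_enormP; exists e.
  by exists y.
by have [y Ay ye] := xA _ e0; exists y; split => //; exact: eB.
Qed.

Lemma open_enormP (A : set 'rV[R]_n) : open A <->
  forall x, A x -> exists2 e, 0 < e & forall y, enorm (y - x) < e -> A y.
Proof.
rewrite openE; split=> oA x /oA; first by move/nbhs_enormP.
by move=> ?; apply/nbhs_enormP.
Qed.

Lemma open_eball x e : open [set y | enorm (y - x) < e].
Proof.
apply/open_enormP => y /= ye; exists (e - enorm (y - x)); first by rewrite subr_gt0.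
move=> z zy /=; apply: le_lt_trans (enorm_dist y _ _) _.
by rewrite addrC -ltrBrDl.
Qed.

Lemma closed_eball x e : closed [set y | enorm (y - x) <= e].
Proof.
move=> y /closure_enormP cy; rewrite /= leNgt; apply/negP => ye.
have [|z /= ze zy] := cy (enorm (y - x) - e); first by rewrite subr_gt0.
by have := enorm_dist z y x; rewrite (enormBC y z); lra.
Qed.

Lemma bounded_enorm (A : set 'rV[R]_n) M :
  (forall x, A x -> enorm x <= M) -> bounded_set A.
Proof.
move=> AM; exists M; split; first exact: num_real.
move=> r Mr x /AM xM /=; rewrite [leLHS]/Num.norm/= mx_normrE.
apply: bigmax_le => [|[i j] _ /=]; last first.
  by rewrite (ord1 i) (le_trans (coord_le_enorm _ _))// (le_trans xM)// ltW.
exact: le_trans (enorm_ge0 x) (le_trans xM (ltW Mr)).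
Qed.

Lemma compact_enorm (A : set 'rV[R]_n) M :
  closed A -> (forall x, A x -> enorm x <= M) -> compact A.
Proof. by move=> cA /bounded_enorm bA; exact: bounded_closed_compact. Qed.

End euclid.

Section lipschitz.
Context {R : realType} {n : nat}.

Lemma elipschitz_continuous m (g : 'rV[R]_n -> 'rV[R]_m) L :
  (forall x y, enorm (g x - g y) <= L * enorm (x - y)) -> continuous g.
Proof.
move=> gL x A /nbhs_enormP[e e0 eA]; apply/nbhs_enormP.
have L0 : 0 < `|L| + 1 by rewrite ltr_wpDl.
exists (e / (`|L| + 1)); first by rewrite divr_gt0.
move=> y; rewrite ltr_pdivlMr// mulrC => yx; apply: eA.
apply: le_lt_trans (gL _ _) (le_lt_trans _ yx).
by rewrite ler_wpM2r ?enorm_ge0// (le_trans (ler_norm _))// lerDl.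
Qed.

Lemma elipschitz_continuousR (g : 'rV[R]_n -> R) L :
  (forall x y, `|g x - g y| <= L * enorm (x - y)) -> continuous g.
Proof.
move=> gL x A /nbhs_ballP[e /= e0 eA]; apply/nbhs_enormP.
have L0 : 0 < `|L| + 1 by rewrite ltr_wpDl.
exists (e / (`|L| + 1)); first by rewrite divr_gt0.
move=> y; rewrite ltr_pdivlMr// mulrC enormBC => yx; apply: eA.
apply: le_lt_trans (gL _ _) (le_lt_trans _ yx).
by rewrite ler_wpM2r ?enorm_ge0// (le_trans (ler_norm _))// lerDl.
Qed.

Lemma continuous_enormB x : continuous (fun y : 'rV[R]_n => enorm (y - x)).
Proof.
apply: (@elipschitz_continuousR _ 1) => y z; rewrite mul1r ler_norml.
have H1 := enorm_dist z y x; have H2 := enorm_dist y z x.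
by rewrite (enormBC z y) in H2; apply/andP; split; lra.
Qed.

End lipschitz.

(** * Invariance properties of Lebesgue measure *)

Lemma measurable_preim d (X : measurableType d) d' (Y : measurableType d')
    (f : X -> Y) A :
  measurable_fun setT f -> measurable A -> measurable (f @^-1` A).
Proof. by move=> mf mA; rewrite -[X in measurable X]setTI; exact: mf. Qed.

Lemma fubini_sections d1 d2 (T1 : measurableType d1) (T2 : measurableType d2)
    (R : realType) (m1 : {sigma_finite_measure set T1 -> \bar R})
    (m2 : {sigma_finite_measure set T2 -> \bar R}) (S : set (T1 * T2)) :
  measurable S ->
  (\int[m1]_x m2 [set y | S (x, y)] = \int[m2]_y m1 [set x | S (x, y)])%E.
Proof.
move=> mS.
have mI : measurable_fun [set: T1 * T2] (fun p => (\1_S p : R)%:E).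
  by apply/measurable_EFinP; exact: measurable_indic.
have I0 p : (0 <= (\1_S p : R)%:E)%E by rewrite lee_fin.
have /= := @fubini_tonelli _ _ _ _ R m1 m2 _ mI I0.
rewrite (eq_integral (fun x => m2 [set y | S (x, y)])); last first.
  move=> x _; rewrite -[X in _ = m2 X]setIT -integral_indic//.
  exact: (measurable_preim (pair1_measurable x) mS).
move=> ->; apply: eq_integral => y _.
rewrite -[X in _ = m1 X]setIT -integral_indic//.
exact: (measurable_preim (pair2_measurable y) mS).
Qed.

Section borel_rV.
Context {R : realType} {n : nat}.
Local Notation V := 'rV[R]_n.

Lemma measurable_coord (i : 'I_n) :
  measurable_fun [set: V] (fun v : V => v ord0 i).
Proof. exact: measurable_rV_coord. Qed.

Lemma measurable_rat_box (q : 'rV[rat]_n) (r : rat) :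
  measurable [set v : V | forall i, `|v ord0 i - ratr (q ord0 i)| < ratr r].
Proof.
rewrite (_ : [set _ | _] = \bigcap_(i in [set: 'I_n])
    [set v : V | `|v ord0 i - ratr (q ord0 i)| < ratr r]); last first.
  by apply/seteqP; split => v /= vq i; [move=> _|]; exact: vq.
apply: fin_bigcap_measurable; first exact: finite_finset.
move=> i _; rewrite -[X in measurable X]setTI.
have m1 : measurable_fun [set: V] (fun v : V => `|v ord0 i - ratr (q ord0 i)|).
  apply: measurableT_comp => //; apply: measurable_funB => //.
  exact: measurable_coord.
have := measurable_fun_ltr m1 (measurable_cst (ratr r : R)).
by move=> /(_ measurableT [set true]); apply.
Qed.

Lemma open_measurable_rV (U : set V) : open U -> measurable U.
Proof.
move=> oU.
pose B (p : 'rV[rat]_n * rat) :=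
  [set v : V | forall i, `|v ord0 i - ratr (p.1 ord0 i)| < ratr p.2].
pose F p := if `[< B p `<=` U >] then B p else set0.
suff -> : U = \bigcup_p F p.
  apply: countable_bigcupT_measurable => [|p]; [exact: countableP|rewrite /F].
  by case: asboolP => // _; exact: measurable_rat_box.
apply/seteqP; split=> [v Uv|v [p _]]; last first.
  by rewrite /F; case: asboolP => // BU Bv; exact: BU.
have /nbhs_ballP[e /= e0 eU] : nbhs v U by rewrite openE in oU; exact: oU.
have e20 : 0 < e / 2 by rewrite divr_gt0.
have [r /itvP r0e] := rat_in_itvoo e20.
have r0 : 0 < ratr r :> R by rewrite r0e.
have q_ i : exists q : rat, `|v ord0 i - ratr q| < ratr r :> R.
  have vr : v ord0 i - ratr r < v ord0 i + ratr r by lra.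
  have [q /itvP qv] := rat_in_itvoo vr.
  exists q; rewrite ltr_distlC.
  by rewrite !qv.
pose q : 'rV[rat]_n := \row_i projT1 (cid (q_ i)).
have Bv : B (q, r) v by move=> i; rewrite mxE; case: cid.
exists (q, r) => //; rewrite /F; case: asboolP => // -[].
move=> w Bw; apply: eU; split=> // i j; rewrite (ord1 i) /ball/=.
have := Bv j; have := Bw j; rewrite /= (distrC (w _ _)) => w1 v1.
have re : ratr r < e / 2 :> R by rewrite r0e.
apply: le_lt_trans (ler_distD (ratr (q ord0 j)) _ _) _.
lra.
Qed.

Lemma closed_measurable_rV (A : set V) : closed A -> measurable A.
Proof.
by move=> /closed_openC/open_measurable_rV/measurableC; rewrite setCK.
Qed.

Lemma measurable_dotv (u : V) : measurable_fun [set: V] (dotv u).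
Proof.
apply: measurable_sum => i; apply: measurable_funM => //.
exact: measurable_coord.
Qed.

Lemma measurable_addv (c : V) : measurable_fun [set: V] (fun v : V => v + c).
Proof.
apply/measurable_fun_rVP => i.
rewrite (_ : _ \o _ = fun v : V => v ord0 i + c ord0 i).
  by apply: measurable_funD => //; exact: measurable_coord.
by apply/funext => v; rewrite /rV_coord /= mxE.
Qed.

Lemma measurable_scalev (a : R) : measurable_fun [set: V] (fun v : V => a *: v).
Proof.
apply/measurable_fun_rVP => i.
rewrite (_ : _ \o _ = fun v : V => a * v ord0 i).
  by apply: measurable_funM => //; exact: measurable_coord.
by apply/funext => v; rewrite /rV_coord /= mxE.
Qed.

Lemma measurable_addv2 : measurable_fun [set: V * V] (fun p : V * V => p.1 + p.2).
Proof.
apply/measurable_fun_rVP => i.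
rewrite (_ : _ \o _ = fun p : V * V => p.1 ord0 i + p.2 ord0 i).
  apply: measurable_funD.
    exact: (measurableT_comp (measurable_coord i) measurable_fst).
  exact: (measurableT_comp (measurable_coord i) measurable_snd).
by apply/funext => v; rewrite /rV_coord /= mxE.
Qed.

End borel_rV.

Section translation_rV.
Context {R : realType}.

Lemma lebesgue_rV_shift n (c : 'rV[R]_n) (A : set 'rV[R]_n) : measurable A ->
  lebesgue_rV ((fun v => v + c) @^-1` A) = lebesgue_rV A.
Proof.
elim: n c A => [|n IHn] c A mA.
  congr lebesgue_rV; apply/seteqP; split=> v /=; by rewrite (thinmx0 (v + c)) (thinmx0 v).
rewrite !lebesgue_rVSE.
pose g x := lebesgue_rV [set v : 'rV[R]_n | A (consv x v)].
transitivity (\int[@lebesgue_measure R]_x g (x + c ord0 ord0)%R)%E; last first.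
  by apply: integral_shift => //; exact: measurable_lebesgue_slice.
apply: eq_integral => x _; rewrite /g -[RHS](IHn (tailv c)); last exact: measurable_slice.
congr lebesgue_rV; apply/seteqP; split=> v /=;
  by rewrite -consvD consvK.
Qed.

Definition cube n (a : R) : set 'rV[R]_n :=
  [set v | forall i, 0 <= v ord0 i < a].

Lemma measurable_cube n a : measurable (@cube n a).
Proof.
rewrite (_ : @cube n a = \bigcap_(i in [set: 'I_n])
    ((fun v : 'rV[R]_n => v ord0 i) @^-1` `[0, a[%classic)); last first.
  apply/seteqP; split => v /= vq i; [move=> _|]; last first.
    by have /= := vq i I; rewrite in_itv.
  by have := vq i; rewrite /= in_itv.
apply: fin_bigcap_measurable; first exact: finite_finset.
move=> i _; exact: measurable_preim (measurable_coord i) _.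
Qed.

Lemma lebesgue_cube n a : 0 <= a -> lebesgue_rV (@cube n a) = (a ^+ n)%:E.
Proof.
move=> a0; elim: n => [|n IHn].
  by rewrite expr0 /lebesgue_rV diracE mem_set//= => -[].
rewrite lebesgue_rVSE.
transitivity (\int[@lebesgue_measure R]_x (cst (a ^+ n)%:E \_ `[0%R, a[%classic) x)%E.
  apply: eq_integral => x _; rewrite patchE; case: ifPn => [/set_mem|/negP nx].
    rewrite /= in_itv/= => x0a; rewrite -IHn; congr lebesgue_rV.
    apply/seteqP; split=> v /= va i.
      by have := va (lift ord0 i); rewrite consvS.
    by case: (unliftP ord0 i) => [j|] ->; rewrite ?consv0// consvS.
  rewrite (_ : [set _ | _] = set0) ?measure0//; apply/seteqP; split=> v //= va.
  by apply: nx; rewrite mem_set//= in_itv/=; have := va ord0; rewrite consv0.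
rewrite -integral_mkcond integral_cst//= lebesgue_measure_itv/= lte_fin.
case: ltgtP a0 => // [a0 _|<- _]; first by rewrite sube0 -EFinM -exprSr.
by rewrite mule0 expr0n.
Qed.

End translation_rV.

Section haar.
Context {R : realType} {n : nat}.
Local Notation V := 'rV[R]_n.
Local Notation lam := (@lebesgue_rV R n).
Local Open Scope ereal_scope.

Lemma measurable_oppv : measurable_fun [set: V] (-%R : V -> V).
Proof.
by rewrite (_ : -%R = *:%R (-1)%R :> (V -> V)) ?funeqE => [|v];
  [exact: measurable_scalev|rewrite scaleN1r].
Qed.

(** Uniqueness of translation invariant measures, by computing with Tonelli the
    measure of the pairs (x, y) with x in A and x + y in B in two ways. *)
Lemma haar_uniqueness (nu : {sigma_finite_measure set V -> \bar R}) (A B : set V) :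
  (forall (c : V) (C : set V), measurable C -> nu ((fun v => v + c)%R @^-1` C) = nu C) ->
  measurable A -> measurable B ->
  nu B * lam A = nu (-%R @^-1` A) * lam B.
Proof.
move=> nuT mA mB.
pose S1 := [set p : V * V | A p.1 /\ B (p.1 + p.2)%R].
pose S2 := [set p : V * V | A (p.1 - p.2)%R /\ B p.1].
have mS1 : measurable S1.
  apply: measurableI; first exact: measurable_preim measurable_fst mA.
  exact: measurable_preim measurable_addv2 mB.
have mS2 : measurable S2.
  apply: measurableI; last exact: measurable_preim measurable_fst mB.
  have mg : measurable_fun [set: V * V] (fun p : V * V => (p.1, - p.2)%R).
    apply: measurable_fun_pair => //.
    exact: (measurableT_comp measurable_oppv measurable_snd).
  exact: (measurable_preim (measurableT_comp measurable_addv2 mg) mA).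
have mNA : measurable (-%R @^-1` A) by exact: measurable_preim measurable_oppv mA.
have E1 : \int[lam]_x nu [set y | S1 (x, y)] = nu B * lam A.
  rewrite -integral_cst//= [RHS]integral_mkcond; apply: eq_integral => x _.
  rewrite patchE; case: ifPn => [/set_mem Ax|/negP Ax].
    rewrite -(nuT x _ mB); congr (nu _).
    by apply/seteqP; split=> y; rewrite /S1/= addrC => // -[].
  rewrite (_ : [set _ | _] = set0) ?measure0//.
  by apply/seteqP; split=> // y [/= Ax' _]; apply: Ax; rewrite inE.
have E2 : \int[lam]_x nu [set y | S2 (x, y)] = nu (-%R @^-1` A) * lam B.
  rewrite -integral_cst//= [RHS]integral_mkcond; apply: eq_integral => x _.
  rewrite patchE; case: ifPn => [/set_mem Bx|/negP Bx].
    rewrite -(nuT (- x)%R _ mNA); congr (nu _).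
    by apply/seteqP; split=> y; rewrite /S2/= opprD opprK addrC => // -[].
  rewrite (_ : [set _ | _] = set0) ?measure0//.
  by apply/seteqP; split=> // y [/= _ Bx']; apply: Bx; rewrite inE.
rewrite -E1 -E2 !fubini_sections//; apply: eq_integral => y _.
rewrite -[RHS](lebesgue_rV_shift y); last first.
  exact: (measurable_preim (pair2_measurable y) mS2).
by congr (lam _); apply/seteqP; split=> x; rewrite /S1/S2/= addrK.
Qed.

(** The image of Lebesgue measure by an additive bijection is translation
    invariant, so that uniqueness applies to it. *)
Lemma haar_pushforward (T T' : V -> V) (A B : set V) :
  measurable_fun setT T -> measurable_fun setT T' -> cancel T T' ->
  cancel T' T -> (forall v w, T (v + w) = T v + T w)%R ->
  measurable A -> measurable B ->
  lam (T @^-1` B) * lam A = lam (T @^-1` (-%R @^-1` A)) * lam B.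
Proof.
move=> mT mT' TK T'K TD mA mB.
pose mu := measure_function_pushforward__canonical__measure_function_Measure
  lam mT.
have sf : sigma_finite setT mu.
  have [F UF Foo] := sigma_finiteT lam.
  exists (fun k => T' @^-1` F k); first by rewrite -preimage_bigcup -UF preimage_setT.
  move=> k; have [mF Fk] := Foo k; split; first exact: measurable_preim.
  rewrite /mu/= /pushforward -comp_preimage.
  by rewrite (_ : T' \o T = id)//; apply/funext => p /=; rewrite TK.
have [nu munu] := sigma_finite_measure_exists (measure0 mu) (measure_ge0 mu)
  (@measure_semi_sigma_additive _ _ _ mu) sf.
have := @haar_uniqueness nu A B; rewrite -munu; apply => //.
move=> c C mC; rewrite /mu/= /pushforward.
rewrite -[RHS](lebesgue_rV_shift (T' c)); last exact: measurable_preim.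
by congr (lam _); apply/seteqP; split=> v; rewrite /= TD T'K.
Qed.

End haar.

Section linear_images.
Context {R : realType} {n : nat}.
Local Notation V := 'rV[R]_n.
Local Notation lam := (@lebesgue_rV R n).

Let lebesgue_opp_cube1 : lam (-%R @^-1` cube 1) = 1%E.
Proof.
have mC := @measurable_cube R n 1.
have := @haar_pushforward R n id id (-%R @^-1` cube 1) (cube 1)
  (@measurable_id _ _ _) (@measurable_id _ _ _) (fun=> erefl) (fun=> erefl)
  (fun _ _ => erefl) (measurable_preim measurable_oppv mC) mC.
rewrite /= lebesgue_cube// expr1n mul1e => ->.
rewrite mule1; transitivity (lam (cube 1)); last by rewrite lebesgue_cube ?expr1n.
by congr (lam _); apply/seteqP; split=> v; rewrite /= opprK.
Qed.

Lemma lebesgue_scale (a : R) (B : set V) : 0 < a -> measurable B ->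
  lam ((fun v => a^-1 *: v) @^-1` B) = ((a ^+ n)%:E * lam B)%E.
Proof.
move=> a0 mB; have mC := @measurable_cube R n 1.
have aN0 : a != 0 by rewrite gt_eqF.
have := @haar_pushforward R n (fun v => a^-1 *: v) (fun v => a *: v)
  (-%R @^-1` cube 1) B (measurable_scalev _) (measurable_scalev _).
rewrite lebesgue_opp_cube1 mule1 => ->//.
- rewrite -(lebesgue_cube _ (ltW a0)); congr (lam _ * _)%E.
  have ai : 0 < a^-1 by rewrite invr_gt0.
  apply/seteqP; split=> v /= va i; have := va i;
    by rewrite opprK !mxE mulrC ltr_pdivrMr// mul1r pmulr_lge0.
- by move=> v; rewrite scalerA divff// scale1r.
- by move=> v; rewrite scalerA mulVf// scale1r.
- by move=> v w; rewrite scalerDr.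
- exact: measurable_preim measurable_oppv mC.
Qed.

Lemma cube_sub_ball (e : R) : 0 < e ->
  exists2 d, 0 < d & @cube R n d `<=` [set v | enorm v < e].
Proof.
move=> e0; have s0 : 0 < Num.sqrt n%:R + 1 :> R by rewrite ltr_wpDl// sqrtr_ge0.
exists (e / (Num.sqrt n%:R + 1)); first by rewrite divr_gt0.
move=> v /= vd; apply: (@le_lt_trans _ _ (Num.sqrt n%:R * (e / (Num.sqrt n%:R + 1)))).
  apply: enorm_le_coord; first by rewrite divr_ge0// ltW.
  by move=> i; have /andP[? /ltW ?] := vd i; rewrite ger0_norm.
by rewrite mulrCA gtr_pMr// ltr_pdivrMr// mul1r ltrDl.
Qed.

Lemma lebesgue_ball_gt0 (x : V) (e : R) : 0 < e ->
  (0 < lam [set v | (enorm (v - x) < e)%R])%E.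
Proof.
move=> e0; have [d d0 cd] := cube_sub_ball e0.
rewrite (_ : [set _ | _] = (fun v => v + - x) @^-1` [set v | enorm v < e])//.
have mb : measurable [set v : V | enorm v < e].
  apply: open_measurable_rV; rewrite (_ : mkset _ = [set v | enorm (v - 0) < e]).
    exact: open_eball.
  by apply/seteqP; split=> v /=; rewrite subr0.
rewrite lebesgue_rV_shift//.
apply: (@lt_le_trans _ _ (lam (cube d))); last first.
  by apply: le_measure; rewrite ?inE//; exact: measurable_cube.
by rewrite lebesgue_cube ?ltW// lte_fin exprn_gt0.
Qed.

Lemma lebesgue_bounded (A : set V) (M : R) : measurable A ->
  (forall v, A v -> enorm v <= M) -> (lam A < +oo)%E.
Proof.
move=> mA AM; pose c : V := const_mx (`|M|).
have mc : measurable ((fun v : V => v + c) @^-1` cube (2 * `|M| + 1)).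
  exact: measurable_preim (measurable_addv c) (measurable_cube _).
apply: (@le_lt_trans _ _ (lam ((fun v => v + c) @^-1` cube (2 * `|M| + 1)))).
  apply: le_measure; rewrite ?inE// => v Av i; rewrite !mxE.
  have := coord_le_enorm v i; have := AM _ Av; have := ler_norm M.
  by rewrite ler_norml => ? ? /andP[? ?]; apply/andP; split; lra.
rewrite lebesgue_rV_shift; last exact: measurable_cube.
by rewrite lebesgue_cube ?ltry// addr_ge0// mulr_ge0.
Qed.

Lemma measurable_eball (x : V) (e : R) : measurable [set v | enorm (v - x) < e].
Proof. by apply: open_measurable_rV; exact: open_eball. Qed.

(** The unit ball fixes the normalising constant in the uniqueness theorem. *)
Lemma lebesgue_involutive_isometry (T : V -> V) (B : set V) :
  measurable_fun setT T -> involutive T -> (forall v w, T (v + w) = T v + T w) ->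
  (forall v, enorm (T v) = enorm v) -> measurable B ->
  lam (T @^-1` B) = lam B.
Proof.
move=> mT TK TD Tn mB.
have mb := measurable_eball 0 1.
have := haar_pushforward mT mT TK TK TD mb mB.
rewrite (_ : T @^-1` (-%R @^-1` _) = [set v | enorm (v - 0) < 1]); last first.
  by apply/seteqP; split=> v; rewrite /= !subr0 enormN Tn.
have b0 := lebesgue_ball_gt0 0 ltr01.
have boo : (lam [set v | (enorm (v - 0) < 1)%R] < +oo)%E.
  by apply: (@lebesgue_bounded _ 1) => // v /=; rewrite subr0 => /ltW.
rewrite [RHS]muleC => E; have bfin : lam [set v | (enorm (v - 0) < 1)%R] \is a fin_num.
  by rewrite ge0_fin_numE// ltW.
apply/eqP; rewrite eq_le -(lee_pmul2r bfin b0) E lexx /=.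
by rewrite -(lee_pmul2r bfin b0) E lexx.
Qed.

End linear_images.

(** * The Prekopa-Leindler inequality *)

Section layer_cake.
Context d (T : measurableType d) (R : realType).
Variable mu : {sigma_finite_measure set T -> \bar R}.
Local Open Scope ereal_scope.

Lemma measurable_gt_fun (g : T -> R) (t : R) : measurable_fun setT g ->
  measurable [set x | (t < g x)%R].
Proof.
move=> mg; have := measurable_preim mg (@measurable_itv R `]t, +oo[).
by congr measurable; apply/seteqP; split=> x /=; rewrite in_itv/= andbT.
Qed.

(** Tonelli for the region between the graph of g and the horizontal axis. *)
Lemma layer_cake (g : T -> R) : measurable_fun setT g -> (forall x, (0 <= g x)%R) ->
  \int[mu]_x (g x)%:E =
  \int[@lebesgue_measure R]_(t in `]0%R, +oo[) mu [set x | (t < g x)%R].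
Proof.
move=> mg g0.
pose S := [set p : T * measurableTypeR R | (0 < p.2)%R /\ (p.2 < g p.1)%R].
have mS : measurable S.
  apply: measurableI.
    have := measurable_preim (@measurable_snd _ _ T (measurableTypeR R))
      (@measurable_itv R `]0%R, +oo[).
    by congr measurable; apply/seteqP; split=> x /=; rewrite in_itv/= andbT.
  have mg1 := measurableT_comp mg (@measurable_fst _ _ T (measurableTypeR R)).
  have := measurable_fun_ltr (@measurable_snd _ _ T (measurableTypeR R)) mg1.
  by move=> /(_ measurableT [set true]); rewrite setTI; apply.
have := @fubini_sections _ _ _ _ R mu (@lebesgue_measure R) S mS.
rewrite (eq_integral (fun x => (g x)%:E)); last first.
  move=> x _; rewrite /S/= (_ : [set _ | _] = `]0%R, g x[%classic); last first.
    by apply/seteqP; split=> t /=; rewrite in_itv/=; [move=> [-> ->]|move/andP].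
  rewrite lebesgue_measure_itv/= lte_fin; case: ltgtP (g0 x) => // [_ _|<- _//].
  by rewrite sube0.
move=> ->; rewrite [RHS]integral_mkcond; apply: eq_integral => t _.
rewrite patchE; case: ifPn => [/set_mem/=|/negP t0].
  rewrite in_itv/= andbT => t0; congr (mu _).
  by apply/seteqP; split=> x; rewrite /S/=; [case|].
rewrite (_ : [set _ | _] = set0) ?measure0//; apply/seteqP; split=> // x [/= t0' _].
by apply: t0; rewrite inE/= in_itv/= t0'.
Qed.

Lemma measurable_tail (g : T -> R) : measurable_fun setT g ->
  measurable_fun [set: R] (fun t : R => mu [set x | (t < g x)%R]).
Proof.
move=> mg; pose S := [set p : R * T | (p.1 < g p.2)%R].
have mS : measurable S.
  have mg1 := measurableT_comp mg (@measurable_snd _ _ R T).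
  have := measurable_fun_ltr (@measurable_fst _ _ R T) mg1.
  by move=> /(_ measurableT [set true]); rewrite setTI; apply.
have := measurable_fun_xsection mu mS; congr measurable_fun.
apply/funext => t /=; congr (mu _).
by apply/seteqP; split=> x /=; rewrite /xsection/= inE.
Qed.

End layer_cake.

Section brunn_minkowski1.
Context {R : realType}.
Local Notation mu := (@lebesgue_measure R).
Local Open Scope ereal_scope.

(** If a1 is nearly the supremum of A and b1 nearly the infimum of B, then A + b1
    and a1 + B are contained in C and overlap in an interval of length e only. *)
Lemma brunn_minkowski1 (A B C : set R) (M : R) :
  measurable A -> measurable B -> measurable C ->
  A !=set0 -> B !=set0 ->
  (forall a, A a -> (`|a| <= M)%R) -> (forall b, B b -> (`|b| <= M)%R) ->
  (forall a b, A a -> B b -> C (a + b)%R) -> mu A + mu B <= mu C.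
Proof.
move=> mA mB mC A0 B0 AM BM ABC.
have sA : has_sup A by split=> //; exists M => a /AM; rewrite ler_norml => /andP[].
have iB : has_inf B by split=> //; exists (- M)%R => b /BM; rewrite ler_norml => /andP[].
apply/lee_addgt0Pr => e e0.
have [a1 Aa1 a1e] := sup_adherent (divr_gt0 e0 (ltr0Sn R 1)) sA.
have [b1 Bb1 b1e] := inf_adherent (divr_gt0 e0 (ltr0Sn R 1)) iB.
pose X := (fun x : R => x + - b1)%R @^-1` A.
pose Y := (fun x : R => x + - a1)%R @^-1` B.
pose I := `[(a1 + b1 - e / 2)%R, (a1 + b1 + e / 2)%R]%classic.
have mX : measurable X by apply: measurable_preim mA; exact: measurable_funD.
have mY : measurable Y by apply: measurable_preim mB; exact: measurable_funD.
have mI : measurable I by exact: measurable_itv.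
have mXI : measurable (X `\` I) by exact: measurableD.
have muI : mu I = e%:E.
  rewrite lebesgue_measure_itv/= lte_fin ifT; last by lra.
  by rewrite -EFinD; congr EFin; field.
rewrite -(lebesgue_measure_shift (- b1) mA) -(lebesgue_measure_shift (- a1) mB).
rewrite -/X -/Y.
have dXY : (X `\` I) `&` Y = set0.
  apply/seteqP; split=> // z [[/= Az nI] Bz]; apply: nI; rewrite /I/= in_itv/=.
  have /(_ _ Az) := sup_upper_bound sA; have := inf_lbound iB.2 Bz.
  by move=> H1 H2; apply/andP; split; lra.
have muXI : mu X <= mu (X `\` I) + e%:E.
  rewrite -muI -measureU//; last by rewrite setDE -setIA setICl setI0.
  apply: le_measure; rewrite ?inE//; first exact: measurableU.
  by move=> x Xx; have [|] := pselect (I x); [right|left].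
apply: (@le_trans _ _ (mu (X `\` I) + e%:E + mu Y)); first exact: leeD2r.
rewrite addeAC leeD2r// -measureU//; apply: le_measure; rewrite ?inE//.
  exact: measurableU.
move=> z [[/= Az _]|/= Bz]; first by rewrite -(subrK b1 z); exact: ABC.
by rewrite -(subrK a1 z) addrC; exact: ABC.
Qed.

(** As both suprema are 1, the superlevel sets of f and g at a height t < 1 are
    nonempty and their sum lies in that of h: the one-dimensional
    Brunn-Minkowski inequality is integrated over t. *)
Lemma prekopa_leindler1_normalized (f g h : R -> R) (M : R) :
  measurable_fun setT f -> measurable_fun setT g -> measurable_fun setT h ->
  (forall x, 0 <= f x <= 1)%R -> (forall x, 0 <= g x <= 1)%R ->
  (forall x, 0 <= h x)%R ->
  (forall t, t < 1 -> exists x, t < f x)%R ->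
  (forall t, t < 1 -> exists x, t < g x)%R ->
  (forall x, f x != 0 -> `|x| <= M)%R -> (forall x, g x != 0 -> `|x| <= M)%R ->
  (forall x y, f x * g y <= h (x + y) ^+ 2)%R ->
  \int[mu]_x (f x)%:E + \int[mu]_x (g x)%:E <= \int[mu]_x (h x)%:E.
Proof.
move=> mf mg mh f01 g01 h0 f1 g1 fM gM fgh.
have f0 x : (0 <= f x)%R by case/andP: (f01 x).
have g0 x : (0 <= g x)%R by case/andP: (g01 x).
rewrite !layer_cake//.
rewrite -ge0_integralD//; last 2 first.
- by apply: measurable_funTS; exact: measurable_tail.
- by apply: measurable_funTS; exact: measurable_tail.
apply: ge0_le_integral => //.
- by move=> t _; exact: adde_ge0.
- by apply: measurable_funTS; apply: emeasurable_funD; exact: measurable_tail.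
- by apply: measurable_funTS; exact: measurable_tail.
move=> t /=; rewrite in_itv/= andbT => t0.
have [t1|t1] := ltP t 1%R; last first.
  rewrite (_ : [set x | _] = set0) ?measure0 ?add0e; last first.
    apply/seteqP; split=> // x /=; have /andP[_ fx] := f01 x.
    by rewrite ltNge (le_trans fx t1).
  rewrite (_ : [set x | _] = set0) ?measure0//.
  apply/seteqP; split=> // x /=; have /andP[_ gx] := g01 x.
  by rewrite ltNge (le_trans gx t1).
apply: (@brunn_minkowski1 _ _ _ M); rewrite ?inE; try exact: measurable_gt_fun.
- exact: f1.
- exact: g1.
- by move=> a /= ta; apply: fM; rewrite gt_eqF// (lt_trans t0).
- by move=> a /= ta; apply: gM; rewrite gt_eqF// (lt_trans t0).
move=> a b /= ta tb; rewrite -(ltr_pXn2r (n:=2)) ?nnegrE// ?ltW//.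
by apply: lt_le_trans (fgh a b); rewrite expr2 ltr_pM// ltW.
Qed.

Lemma amgm_ereal (a b : \bar R) : 0 <= a -> 0 <= b ->
  4%:E * (a * b) <= (a + b) * (a + b).
Proof.
move: a b => [a| |] [b| |]// a0 b0; last 3 first.
- by rewrite addey// mulyy leey.
- by rewrite addye// mulyy leey.
- by rewrite addye// mulyy leey.
rewrite -EFinD -!EFinM lee_fin.
by have := sqr_ge0 (a - b)%R; rewrite !lee_fin in a0 b0 *; nra.
Qed.

(** f and g are divided by their suprema a and b, h by the geometric mean of a
    and b; the additive inequality then obtained is turned into a product by the
    inequality of the arithmetic and geometric means. As h may take infinite
    values it is truncated at this mean, which f and g do not notice. *)
Lemma prekopa_leindler1_bounded (f g : R -> R) (h : R -> \bar R) (M : R) :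
  measurable_fun setT f -> measurable_fun setT g -> measurable_fun setT h ->
  (forall x, 0 <= f x <= M)%R -> (forall x, 0 <= g x <= M)%R ->
  (forall x, 0 <= h x) ->
  (forall x, f x != 0 -> `|x| <= M)%R -> (forall x, g x != 0 -> `|x| <= M)%R ->
  (forall x y, (f x * g y)%:E <= h (x + y)%R * h (x + y)%R) ->
  4%:E * (\int[mu]_x (f x)%:E * \int[mu]_x (g x)%:E) <=
  (\int[mu]_x h x) * (\int[mu]_x h x).
Proof.
move=> mf mg mh f0M g0M h0 fM gM fgh.
have ih0 : 0 <= \int[mu]_x h x by exact: integral_ge0.
have us_ (u : R -> R) : (forall x, (0 <= u x <= M)%R) -> has_sup (range u).
  move=> u0M.
  by split; [exists (u 0%R), 0%R|exists M => _ [y _ <-]; case/andP: (u0M y)].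
have sup_ub (u : R -> R) x : (forall x, (0 <= u x <= M)%R) -> (u x <= sup (range u))%R.
  by move=> /us_/sup_upper_bound; apply; exists x.
have trivial_case (u : R -> R) : (forall x, (0 <= u x <= M)%R) ->
    sup (range u) = 0%R -> \int[mu]_x (u x)%:E = 0.
  move=> u0M su; apply: integral0_eq => x _; congr EFin; apply/le_anti.
  by have /andP[-> _] := u0M x; rewrite andbT -su sup_ub.
have sup_range (u : R -> R) : (forall x, (0 <= u x <= M)%R) ->
    has_sup (range u) /\ (0 <= sup (range u))%R.
  move=> u0M; split; first exact: us_.
  apply: (@le_trans _ _ (u 0%R)); first by case/andP: (u0M 0%R).
  exact: sup_ub.
have [fs] := sup_range _ f0M; rewrite le_eqVlt => /predU1P[/esym/(trivial_case _ f0M) ->|].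
  by rewrite mul0e mule0 mule_ge0.
have [gs] := sup_range _ g0M; rewrite le_eqVlt => /predU1P[/esym/(trivial_case _ g0M) ->|].
  by rewrite !mule0 mule_ge0.
set a := sup (range f); set b := sup (range g) => b0 a0.
pose s := Num.sqrt (a * b)%R.
have s0 : (0 < s)%R by rewrite sqrtr_gt0 mulr_gt0.
have s2 : (s ^+ 2 = a * b)%R by rewrite sqr_sqrtr// ltW// mulr_gt0.
pose h' x := fine (mine (h x) s%:E).
have h'E x : (h' x)%:E = mine (h x) s%:E.
  rewrite fineK// ge0_fin_numE; last by rewrite le_min h0 lee_fin ltW.
  by rewrite gt_min ltry orbT.
have mh' : measurable_fun setT h'.
  by apply: measurableT_comp => //; apply: measurable_mine => //.
have h'0 x : (0 <= h' x)%R by rewrite -lee_fin h'E le_min h0 lee_fin ltW.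
have nz x : (0 < x)%R -> x != 0%R by move=> x0; rewrite gt_eqF.
have norm_ge (u : R -> R) : (forall x, (0 <= u x <= M)%R) -> has_sup (range u) ->
    (0 < sup (range u))%R ->
    (forall t, t < 1 -> exists x, t < u x / sup (range u))%R.
  move=> u0M us su t t1; have [_ [x _ <-] xt] : exists2 y, range u y &
      (sup (range u) - (1 - t) * sup (range u) < y)%R.
    by apply: sup_adherent => //; rewrite mulr_gt0// subr_gt0.
  by exists x; rewrite ltr_pdivlMr//; lra.
have norm_le (u : R -> R) : (forall x, (0 <= u x <= M)%R) -> has_sup (range u) ->
    (0 < sup (range u))%R -> (forall x, 0 <= u x / sup (range u) <= 1)%R.
  move=> u0M us su x; have /andP[ux0 _] := u0M x.
  by rewrite (divr_ge0 ux0 (ltW su))/= ler_pdivrMr// mul1r sup_ub.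
have H := @prekopa_leindler1_normalized (fun x => f x / a)%R (fun x => g x / b)%R
  (fun x => h' x / s)%R M.
have {}H : \int[mu]_x (f x / a)%:E + \int[mu]_x (g x / b)%:E <=
    \int[mu]_x (h' x / s)%:E.
  apply: H => //; rewrite ?/a ?/b.
  - exact: measurable_funM.
  - exact: measurable_funM.
  - exact: measurable_funM.
  - exact: norm_le.
  - exact: norm_le.
  - by move=> x; rewrite divr_ge0// ltW.
  - exact: norm_ge.
  - exact: norm_ge.
  - by move=> x; rewrite mulf_eq0 negb_or => /andP[+ _]; exact: fM.
  - by move=> x; rewrite mulf_eq0 negb_or => /andP[+ _]; exact: gM.
  move=> x y; rewrite -/a -/b exprMn exprVn s2 invfM mulrACA ler_wpM2r//.
    by rewrite -invfM invr_ge0 ltW// mulr_gt0.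
  rewrite -lee_fin expr2 [leRHS]EFinM h'E /Order.min; case: ifPn => _; first exact: fgh.
  rewrite -EFinM lee_fin -expr2 s2 ler_pM//; first by case/andP: (f0M x).
  - by case/andP: (g0M y).
  - exact: sup_ub.
  - exact: sup_ub.
have scale (u : R -> R) c : measurable_fun setT u -> (forall x, (0 <= u x)%R) ->
    (0 < c)%R -> \int[mu]_x (u x)%:E = c%:E * \int[mu]_x (u x / c)%:E.
  move=> mu_ u0 c0; rewrite -ge0_integralZl_EFin ?ltW//.
  - by apply: eq_integral => x _; rewrite -EFinM mulrC divfK// nz.
  - by move=> x _; rewrite lee_fin divr_ge0// ltW.
  - by apply/measurable_EFinP; exact: measurable_funM.
have f0 x : (0 <= f x)%R by case/andP: (f0M x).
have g0 x : (0 <= g x)%R by case/andP: (g0M x).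
have hh' : \int[mu]_x (h' x)%:E <= \int[mu]_x h x.
  apply: ge0_le_integral => //.
  - by move=> x _; rewrite lee_fin.
  - by apply/measurable_EFinP.
  - by move=> x _; rewrite h'E ge_min lexx.
rewrite (scale f a)// (scale g b)//.
apply: (@le_trans _ _ (\int[mu]_x (h' x)%:E * \int[mu]_x (h' x)%:E)); last first.
  by apply: lee_pmul => //; apply: integral_ge0 => x _; rewrite lee_fin.
rewrite (scale h' s)// !(muleACA _ (\int[mu]__ _)) -!EFinM -expr2 s2.
rewrite [leLHS]muleCA lee_pmul2l//; last by rewrite lte_fin mulr_gt0.
have if0 : 0 <= \int[mu]_x (f x / a)%:E.
  by apply: integral_ge0 => x _; rewrite lee_fin divr_ge0// ltW.
have ig0 : 0 <= \int[mu]_x (g x / b)%:E.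
  by apply: integral_ge0 => x _; rewrite lee_fin divr_ge0// ltW.
apply: (le_trans (amgm_ereal if0 ig0)).
by apply: lee_pmul => //; exact: adde_ge0.
Qed.

End brunn_minkowski1.

Section truncation.
Context {R : realType}.
Local Notation mu := (@lebesgue_measure R).
Local Open Scope ereal_scope.

Definition trunc (F : R -> \bar R) (N : nat) (x : R) : R :=
  if (`|x| <= N%:R)%R then fine (mine (F x) N%:R%:E) else 0%R.

Section trunc_theory.
Variable F : R -> \bar R.
Hypothesis F0 : forall x, 0 <= F x.

Lemma trunc_fin N x : (fine (mine (F x) N%:R%:E))%:E = mine (F x) N%:R%:E.
Proof.
rewrite fineK// ge0_fin_numE; first by rewrite gt_min ltry orbT.
by rewrite le_min F0 lee_fin ler0n.
Qed.

Lemma trunc_bounds N x : (0 <= trunc F N x <= N%:R)%R.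
Proof.
rewrite /trunc; case: ifP => _; last by rewrite lexx ler0n.
by rewrite -!lee_fin trunc_fin le_min F0 ge_min lexx orbT lee_fin ler0n.
Qed.

Lemma trunc_le N x : (trunc F N x)%:E <= F x.
Proof.
by rewrite /trunc; case: ifP => // _; rewrite trunc_fin ge_min lexx.
Qed.

Lemma trunc_support N x : trunc F N x != 0%R -> (`|x| <= N%:R)%R.
Proof. by rewrite /trunc; case: ifP => //; rewrite eqxx. Qed.

Lemma trunc_homo x : {homo (fun N => (trunc F N x)%:E) : n m / (n <= m)%N >-> n <= m}.
Proof.
move=> n m nm; have nm' : (n%:R <= m%:R :> R)%R by rewrite ler_nat.
rewrite /trunc; case: ifP => xn; last first.
  by have /andP[] := trunc_bounds m x.
rewrite (le_trans xn nm') !trunc_fin le_min !ge_min lexx/= lee_fin nm'.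
by rewrite orbT.
Qed.

Lemma measurable_trunc N : measurable_fun setT F -> measurable_fun setT (trunc F N).
Proof.
move=> mF; apply: measurable_fun_ifT => //.
- exact: measurable_fun_ler.
- apply: measurableT_comp => //.
  exact: measurable_mine.
Qed.

Lemma cvg_trunc x : (trunc F N x)%:E @[N --> \oo] --> F x.
Proof.
have [Fx|Fx] := eqVneq (F x) +oo.
  have cN : (N%:R : R)%:E @[N --> \oo] --> +oo by exact/cvgenyP.
  rewrite Fx; apply: cvg_trans cN.
  apply: near_eq_cvg; near=> N; rewrite /trunc ifT; last first.
    by near: N; exact: nbhs_infty_ger.
  by rewrite trunc_fin Fx minye.
apply: cvg_near_cst; near=> N; rewrite /trunc ifT; last first.
  by near: N; exact: nbhs_infty_ger.
rewrite trunc_fin; apply/min_idPl.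
have Ff : F x \is a fin_num by rewrite ge0_fin_numE// ltey.
rewrite -(fineK Ff) lee_fin; near: N; exact: nbhs_infty_ger.
Unshelve. all: by end_near. Qed.

Lemma cvg_integral_trunc : measurable_fun setT F ->
  \int[mu]_x (trunc F N x)%:E @[N --> \oo] --> \int[mu]_x F x.
Proof.
move=> mF.
have := @cvg_monotone_convergence _ _ R mu _ measurableT
  (fun N x => (trunc F N x)%:E).
rewrite [X in _ -> _ -> _ -> _ --> X](_ : _ = \int[mu]_x F x).
  apply=> [N|N x _|x _]; last exact: trunc_homo.
  - by apply/measurable_EFinP; exact: measurable_trunc.
  - by rewrite lee_fin; case/andP: (trunc_bounds N x).
by apply: eq_integral => x _; apply/cvg_lim => //; exact: cvg_trunc.
Qed.

End trunc_theory.

Lemma prekopa_leindler1 (F G H : R -> \bar R) :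
  measurable_fun setT F -> measurable_fun setT G -> measurable_fun setT H ->
  (forall x, 0 <= F x) -> (forall x, 0 <= G x) -> (forall x, 0 <= H x) ->
  (forall x y, F x * G y <= H (x + y)%R * H (x + y)%R) ->
  4%:E * (\int[mu]_x F x * \int[mu]_x G x) <=
  (\int[mu]_x H x) * (\int[mu]_x H x).
Proof.
move=> mF mG mH F0 G0 H0 FGH.
have iF0 : 0 <= \int[mu]_x F x by exact: integral_ge0.
have iG0 : 0 <= \int[mu]_x G x by exact: integral_ge0.
have iH0 : 0 <= \int[mu]_x H x by exact: integral_ge0.
have [->|nF] := eqVneq (\int[mu]_x F x) 0; first by rewrite mul0e mule0 mule_ge0.
have [->|nG] := eqVneq (\int[mu]_x G x) 0; first by rewrite !mule0 mule_ge0.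
have def : (\int[mu]_x F x) *? (\int[mu]_x G x).
  by apply: neq0_mule_def; rewrite mule_neq0.
have cFG := cvgeM def (cvg_integral_trunc F0 mF) (cvg_integral_trunc G0 mG).
have {}cFG : 4%:E * (\int[mu]_x (trunc F N x)%:E * \int[mu]_x (trunc G N x)%:E)
    @[N --> \oo] --> 4%:E * (\int[mu]_x F x * \int[mu]_x G x).
  by apply: cvgeZl => //; exact: cFG.
rewrite -(cvg_lim _ cFG)//; apply: lime_le; first by apply/cvg_ex; eexists; exact: cFG.
near=> N; apply: (@prekopa_leindler1_bounded _ _ _ _ N%:R) => //.
- exact: measurable_trunc.
- exact: measurable_trunc.
- by move=> x; exact: trunc_bounds.
- by move=> x; exact: trunc_bounds.
- by move=> x; exact: trunc_support.
- by move=> x; exact: trunc_support.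
move=> x y; apply: le_trans (FGH x y); rewrite EFinM; apply: lee_pmul.
- by rewrite lee_fin; case/andP: (trunc_bounds F0 N x).
- by rewrite lee_fin; case/andP: (trunc_bounds G0 N y).
- exact: trunc_le.
- exact: trunc_le.
Unshelve. all: by end_near. Qed.

End truncation.

Section prekopa_leindler.
Context {R : realType}.
Local Open Scope ereal_scope.

Lemma integral_rV0 (f : 'rV[R]_0 -> \bar R) : measurable_fun [set: 'rV[R]_0] f ->
  \int[@lebesgue_rV R 0]_x f x = f 0%R.
Proof.
move=> mf; rewrite (@eq_measure_integral _ _ _ _ (\d_(0%R : 'rV[R]_0)))//.
by rewrite integral_dirac//= diracT mul1e.
Qed.

(** Tonelli reduces the inequality to its one-dimensional case, applied to the
    functions obtained by integrating out all coordinates but the first. *)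
Lemma prekopa_leindler n (F G H : 'rV[R]_n -> \bar R) :
  measurable_fun setT F -> measurable_fun setT G -> measurable_fun setT H ->
  (forall x, 0 <= F x) -> (forall x, 0 <= G x) -> (forall x, 0 <= H x) ->
  (forall x y, F x * G y <= H (x + y)%R * H (x + y)%R) ->
  (4 ^+ n)%:E * (\int[@lebesgue_rV R n]_x F x * \int[@lebesgue_rV R n]_x G x) <=
  (\int[@lebesgue_rV R n]_x H x) * (\int[@lebesgue_rV R n]_x H x).
Proof.
elim: n F G H => [|n IHn] F G H mF mG mH F0 G0 H0 FGH.
  rewrite expr0 mul1e !integral_rV0//; have := FGH 0%R 0%R.
  by rewrite addr0.
rewrite !integral_rVS//.
have m4 : (0 <= 4 ^+ n :> R)%R by rewrite exprn_ge0.
have iF0 x : 0 <= \int[@lebesgue_rV R n]_v F (consv x v) by exact: integral_ge0.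
have := @prekopa_leindler1 R
  (fun x => (4 ^+ n)%:E * \int[@lebesgue_rV R n]_v F (consv x v))
  (fun x => \int[@lebesgue_rV R n]_v G (consv x v))
  (fun x => \int[@lebesgue_rV R n]_v H (consv x v)).
rewrite ge0_integralZl//; last exact: measurable_integral_slice.
rewrite exprS EFinM -!muleA; apply.
- by apply: measurable_funeM; exact: measurable_integral_slice.
- exact: measurable_integral_slice.
- exact: measurable_integral_slice.
- by move=> x; apply: mule_ge0.
- by move=> x; exact: integral_ge0.
- by move=> x; exact: integral_ge0.
move=> x y; rewrite -muleA; apply: IHn => //.
- exact: measurableT_comp (measurable_consv1 x).
- exact: measurableT_comp (measurable_consv1 y).
- exact: measurableT_comp (measurable_consv1 (x + y)%R).
by move=> v w; rewrite -consvD.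
Qed.

Lemma integral_affine n (a : R) (p : 'rV[R]_n) (F : 'rV[R]_n -> \bar R) :
  (0 < a)%R -> measurable_fun setT F -> (forall x, 0 <= F x) ->
  \int[@lebesgue_rV R n]_x F (a^-1 *: (x + p))%R =
  (a ^+ n)%:E * \int[@lebesgue_rV R n]_x F x.
Proof.
move=> a0 mF F0; pose phi (x : 'rV[R]_n) := (a^-1 *: (x + p))%R.
have mphi : measurable_fun [set: 'rV[R]_n] phi.
  exact: measurableT_comp (measurable_scalev a^-1) (measurable_addv p).
have := @ge0_integral_pushforward _ _ _ _ R phi mphi (@lebesgue_rV R n) setT F
  measurableT mF (fun y _ => F0 y).
rewrite preimage_setT => <-.
have an0 : (0 <= a ^+ n)%R by rewrite exprn_ge0// ltW.
rewrite -[(a ^+ n)%R]/((NngNum an0)%:num)%R -ge0_integral_mscale//.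
pose P := measure_function_pushforward__canonical__measure_function_Measure
  (@lebesgue_rV R n) mphi.
apply: (@eq_measure_integral _ _ _ _ _ P) => A mA _.
rewrite /P/= /pushforward /mscale/= -lebesgue_scale//.
rewrite -[RHS](lebesgue_rV_shift p)//.
exact: measurable_preim (measurable_scalev _) mA.
Qed.

(** The same with midpoints, the normalisation being absorbed by scaling. *)
Lemma prekopa_leindler_midpoint n (F G H : 'rV[R]_n -> \bar R) :
  measurable_fun setT F -> measurable_fun setT G -> measurable_fun setT H ->
  (forall x, 0 <= F x) -> (forall x, 0 <= G x) -> (forall x, 0 <= H x) ->
  (forall x y, F x * G y <= H (2^-1 *: (x + y))%R * H (2^-1 *: (x + y))%R) ->
  \int[@lebesgue_rV R n]_x F x * \int[@lebesgue_rV R n]_x G x <=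
  (\int[@lebesgue_rV R n]_x H x) * (\int[@lebesgue_rV R n]_x H x).
Proof.
move=> mF mG mH F0 G0 H0 FGH.
have m2 : (0 < 2 ^+ n :> R)%R by rewrite exprn_gt0.
have := @prekopa_leindler n F G (fun z => H (2^-1 *: (z + 0))%R) mF mG.
rewrite integral_affine// muleACA -!EFinM -exprMn.
rewrite (_ : 2 * 2 = 4 :> R)%R; last by rewrite -natrM.
rewrite lee_pmul2l// ?lte_fin ?exprn_gt0//; apply => //.
- exact: measurableT_comp mH (measurableT_comp (measurable_scalev 2^-1) (measurable_addv 0%R)).
- by move=> x y; rewrite addr0; exact: FGH.
Qed.

End prekopa_leindler.

(** * Convex sets and orthants *)

Section convex_sets.
Context {R : realType} {n : nat}.
Local Notation V := 'rV[R]_n.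
Implicit Types (K : set V) (x y z p q : V).

Definition convexv K : Prop := forall x y (t : R), 0 <= t <= 1 ->
  K x -> K y -> K (t *: x + (1 - t) *: y).

(** Neighbourhoods are inconvenient to produce from measure or from values along
    lines; a point of K in each open orthant with apex z is easier to find, and
    for convex K it puts z in the interior of K. *)
Definition meets_orthants K z : Prop := forall s : {ffun 'I_n -> bool},
  exists2 p, K p & forall i, 0 < (-1) ^+ s i * (p ord0 i - z ord0 i).

(** The coordinates are eliminated one at a time: two points of K on both sides
    of z in one coordinate, and on the same side in some others, have a
    combination that agrees with z in the former and keeps the latter signs. *)
Lemma orthants_hull K z : convexv K -> meets_orthants K z -> K z.
Proof.
move=> cK Kz.
suff H k : (k <= n)%N -> forall s : {ffun 'I_n -> bool}, exists2 p, K p &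
    forall i : 'I_n, ((i < n - k)%N -> 0 < (-1) ^+ s i * (p ord0 i - z ord0 i)) /\
                     ((n - k <= i)%N -> p ord0 i = z ord0 i).
  have [p Kp pz] := H n (leqnn n) [ffun=> true].
  suff -> : z = p by [].
  by apply/rowP => i; have [_ ->//] := pz i; rewrite subnn.
elim: k => [_|k IHk kn] s.
  have [p Kp pz] := Kz s; exists p => // i; split=> // ni.
  by move: ni (ltn_ord i); rewrite subn0 ltnNge => ->.
have jn : (n - k.+1 < n)%N by rewrite ltn_subrL /= (leq_ltn_trans _ kn).
pose j := Ordinal jn.
have jk : (n - k.+1).+1 = (n - k)%N by rewrite subnS prednK// subn_gt0.
have [p Kp pz] := IHk (ltnW kn) [ffun i => if i == j then false else s i].
have [q Kq qz] := IHk (ltnW kn) [ffun i => if i == j then true else s i].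
have jnk : (j < n - k)%N by rewrite -jk ltnS.
have pj : z ord0 j < p ord0 j.
  by have [/(_ jnk) + _] := pz j; rewrite ffunE eqxx mul1r subr_gt0.
have qj : q ord0 j < z ord0 j.
  by have [/(_ jnk) + _] := qz j; rewrite ffunE eqxx mulN1r opprB subr_gt0.
have pq : 0 < p ord0 j - q ord0 j by rewrite subr_gt0 (lt_trans qj).
pose t := (z ord0 j - q ord0 j) / (p ord0 j - q ord0 j).
have t0 : 0 <= t by apply: divr_ge0; lra.
have t1 : t <= 1 by rewrite ler_pdivrMr// mul1r; lra.
have tpq : t * (p ord0 j - q ord0 j) = z ord0 j - q ord0 j.
  by rewrite divfK// gt_eqF.
exists (t *: p + (1 - t) *: q) => [|i]; first by apply: cK => //; rewrite t0.
rewrite !mxE; split=> ij.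
  have ik : (i < n - k)%N by rewrite -jk (leq_trans ij).
  have [/(_ ik) pi _] := pz i; have [/(_ ik) qi _] := qz i.
  have ineqj : (i == j) = false by apply/eqP => ij'; rewrite ij' ltnn in ij.
  rewrite !ffunE ineqj in pi qi.
  rewrite [X in 0 < X](_ : _ = t * ((-1) ^+ s i * (p ord0 i - z ord0 i)) +
    (1 - t) * ((-1) ^+ s i * (q ord0 i - z ord0 i))); last by ring.
  have [t_0|t_0] := eqVneq t 0; first by rewrite t_0 mul0r add0r subr0 mul1r.
  have t_1 : 0 < t by rewrite lt0r t_0.
  by apply: ltr_wpDr; [apply: mulr_ge0; [rewrite subr_ge0|exact: ltW]|exact: mulr_gt0].
have [->|ineqj] := eqVneq i j; first by lra.
have ik : (n - k <= i)%N.
  by rewrite -jk ltn_neqAle ij andbT eq_sym; apply: contra ineqj => /eqP ?; apply/eqP/val_inj.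
have [_ ->//] := pz i; have [_ ->//] := qz i; ring.
Qed.

Lemma meets_orthants_near K z : meets_orthants K z ->
  \forall y \near z, meets_orthants K y.
Proof.
move=> Kz.
pose p s := projT1 (cid2 (Kz s)).
have pP s : K (p s) /\ forall i, 0 < (-1) ^+ s i * (p s ord0 i - z ord0 i).
  by rewrite /p; case: cid2.
have : \forall y \near z, forall (s : {ffun 'I_n -> bool}) (i : 'I_n),
    0 < (-1) ^+ s i * (p s ord0 i - (y : V) ord0 i).
  apply: (@filter_forall V _ (fun (s : {ffun 'I_n -> bool}) y =>
    forall i, 0 < (-1) ^+ s i * (p s ord0 i - y ord0 i)) (nbhs z) _) => s.
  apply: (@filter_forall V _ (fun i y =>
    0 < (-1) ^+ s i * (p s ord0 i - y ord0 i)) (nbhs z) _) => i.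
  have [_ /(_ i) H] := pP s.
  apply/nbhs_enormP; exists ((-1) ^+ s i * (p s ord0 i - z ord0 i)) => // y.
  move=> /(le_lt_trans (coord_le_enorm _ i)); rewrite !mxE.
  by case: (s i) H; rewrite ?expr1 ?expr0 ltr_norml => H /andP[? ?]; lra.
by apply: filterS => y Hy s; exists (p s); [exact: (pP s).1|exact: Hy].
Qed.

Lemma orthants_interior K z : convexv K -> meets_orthants K z -> K° z.
Proof.
move=> cK /meets_orthants_near; apply: filterS => y; exact: orthants_hull.
Qed.

(** Points of K close to the vertices of a small cube about z meet all orthants
    at z. *)
Lemma convex_interior_closure K : convexv K -> (closure K)° `<=` K.
Proof.
move=> cK z /nbhs_enormP[e e0 ze]; apply: orthants_hull => // s.
have s0 : 0 < Num.sqrt n%:R + 1 :> R by rewrite ltr_wpDl// sqrtr_ge0.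
pose d := e / (Num.sqrt n%:R + 1).
have d0 : 0 < d by rewrite divr_gt0.
pose u : V := \row_i (d * (-1) ^+ s i).
have zu : closure K (z + u).
  apply: ze; rewrite addrC addKr.
  apply: (@le_lt_trans _ _ (Num.sqrt n%:R * d)).
    apply: enorm_le_coord; first exact: ltW.
    by move=> i; rewrite mxE normrM normrX normrN1 expr1n mulr1 gtr0_norm.
  by rewrite /d mulrCA gtr_pMr// ltr_pdivrMr// mul1r ltrDl.
have /closure_enormP/(_ _ d0)[p Kp pu] := zu.
exists p => // i; have := le_lt_trans (coord_le_enorm _ i) pu; rewrite !mxE ltr_norml.
by case: (s i); rewrite ?expr1 ?expr0 => /andP[? ?]; lra.
Qed.

Lemma convex_boundary_closure K : convexv K ->
  boundary K `<=` boundary (closure K).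
Proof.
move=> cK x [clx nix]; split; first exact: subset_closure.
apply: contra_not nix => /nbhs_interior.
by apply: filterS; exact: convex_interior_closure.
Qed.

(** A point y near the given one is the same combination of a point k of K near x and of
    a point z' near z, which is in K as z is interior. *)
Lemma convex_interior_segment K x z (s : R) : convexv K -> closure K x -> K° z ->
  0 < s <= 1 -> K° ((1 - s) *: x + s *: z).
Proof.
move=> cK clx /nbhs_enormP[e e0 ze] /andP[s0 s1].
have se0 : 0 < s * e / 2 by rewrite divr_gt0// mulr_gt0.
have /closure_enormP/(_ _ se0)[k Kk kx] := clx.
apply/nbhs_enormP; exists (s * e / 2) => // y yw.
pose z' := s^-1 *: (y - (1 - s) *: k).
have -> : y = s *: z' + (1 - s) *: k.
  by rewrite /z' scalerA divff ?gt_eqF// scale1r subrK.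
apply: cK => //; first by rewrite ltW.
apply: ze; rewrite /z'.
have -> : s^-1 *: (y - (1 - s) *: k) - z =
    s^-1 *: ((y - ((1 - s) *: x + s *: z)) - (1 - s) *: (k - x)).
  apply: (@scalerI _ _ s); first by rewrite gt_eqF.
  rewrite scalerBr !scalerA divff ?gt_eqF// !scale1r.
  by apply/rowP => i; rewrite !mxE; ring.
rewrite enormZ gtr0_norm ?invr_gt0// ltr_pdivrMl//.
apply: le_lt_trans (enormD _ _) _; rewrite enormN enormZ ger0_norm ?subr_ge0//.
have : (1 - s) * enorm (k - x) <= enorm (k - x).
  by apply: ler_piMl; [exact: enorm_ge0|lra].
by move: kx yw; lra.
Qed.

Lemma convexv_interior K : convexv K -> convexv K°.
Proof.
move=> cK x y t /andP[t0 t1] Kx Ky.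
have [->|tn1] := eqVneq t 1; first by rewrite scale1r subrr scale0r addr0.
rewrite -{1}(subKr 1 t); apply: convex_interior_segment => //.
  by apply: subset_closure; exact: interior_subset.
by rewrite subr_gt0 lt_neqAle tn1 t1/= lerBlDr lerDl.
Qed.

Lemma convexv_closure K : convexv K -> convexv (closure K).
Proof.
move=> cK x y t t01 /closure_enormP Kx /closure_enormP Ky.
apply/closure_enormP => e e0.
have [p Kp px] := Kx _ e0; have [q Kq qy] := Ky _ e0.
exists (t *: p + (1 - t) *: q); first exact: cK.
rewrite opprD addrACA -!scalerBr; apply: le_lt_trans (enormD _ _) _.
have /andP[t0 t1] := t01; rewrite !enormZ !ger0_norm ?subr_ge0//.
have [->|tn0] := eqVneq t 0; first by rewrite mul0r add0r subr0 mul1r.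
have tp : 0 < t by rewrite lt0r tn0.
have H1 : t * enorm (p - x) < t * e by rewrite ltr_pM2l.
have H2 : (1 - t) * enorm (q - y) <= (1 - t) * e.
  by rewrite ler_wpM2l ?subr_ge0// ltW.
by move: H1 H2; lra.
Qed.

End convex_sets.

(** * Convex sets and Lebesgue measure *)

Section orthants_measure.
Context {R : realType}.

(** By induction on the dimension: uncountably many slices have positive
    measure, so two of them share the rational point given by the induction. *)
Lemma positive_measure_meets_orthants n (A : set 'rV[R]_n) :
  measurable A -> lebesgue_rV A != 0%E ->
  exists q : 'rV[rat]_n, meets_orthants A (map_mx ratr q).
Proof.
elim: n A => [|n IHn] A mA A0.
  have [p Ap] : A !=set0 by apply/set0P; apply: contra_neq A0 => ->; rewrite measure0.
  by exists 0 => s; exists p => // -[].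
pose X := [set x : R | lebesgue_rV [set v : 'rV[R]_n | A (consv x v)] != 0%E].
have q_ x : exists q : 'rV[rat]_n, X x ->
    meets_orthants [set v : 'rV[R]_n | A (consv x v)] (map_mx ratr q).
  have [Xx|nXx] := pselect (X x); last by exists 0.
  by have [q ?] := IHn _ (measurable_slice x mA) Xx; exists q.
pose q x := projT1 (cid (q_ x)).
have qP x : X x -> meets_orthants [set v | A (consv x v)] (map_mx ratr (q x)).
  by rewrite /q; case: cid.
have [x1 [x2 [Xx1 Xx2 x12 qx]]] :
    exists x1 x2, [/\ X x1, X x2, x1 < x2 & q x1 = q x2].
  apply: contrapT => noX; move/eqP : A0; apply.
  rewrite lebesgue_rVSE.
  have mg := measurable_lebesgue_slice mA.
  have cX : countable X.
    apply/countable_injP; exists (fun x => pickle (q x)) => x y /set_mem Xx /set_mem Xy.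
    move/(pcan_inj (@pickleK _)) => qxy; apply: contrapT => /eqP nxy; apply: noX.
    have [xy|yx] := ltP x y; first by exists x, y.
    by exists y, x; split=> //; rewrite lt_neqAle eq_sym nxy.
  have mX : measurable X.
    rewrite (_ : X = (fun x => lebesgue_rV [set v | A (consv x v)]) @^-1` [set~ 0%E])//.
      exact: measurable_preim mg (measurableC (emeasurable_set1 0%E)).
    by apply/seteqP; split=> x /= /eqP.
  rewrite (@ge0_negligible_integral _ (measurableTypeR R) R _ setT X)//; last exact: countable_lebesgue_measure0.
  apply: integral0_eq => x [_]; rewrite /X/= => /negP; rewrite negbK => /eqP; exact.
have [c /itvP c12] := rat_in_itvoo x12.
pose q' : 'rV[rat]_n.+1 := \row_i
  (if unlift ord0 i is Some j then q x1 ord0 j else c).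
exists q' => s.
pose s' := [ffun j : 'I_n => s (lift ord0 j)].
pose x := if s ord0 then x1 else x2.
have qxE : q x = q x1 by rewrite /x; case: ifP.
have Xx : X x by rewrite /x; case: ifP.
have [v Av vs] := qP _ Xx s'.
exists (consv x v) => // i; case: (unliftP ord0 i) => [j ->|->].
  rewrite consvS !mxE liftK; have := vs j.
  by rewrite ffunE !mxE qxE.
rewrite consv0 !mxE unlift_none /x.
case: (s ord0); rewrite ?expr1 ?mulN1r ?expr0 ?mul1r ?opprB subr_gt0;
  by rewrite c12.
Qed.

End orthants_measure.

Section convex_boundary_null.
Context {R : realType} {n : nat}.
Local Notation V := 'rV[R]_n.
Local Notation lam := (@lebesgue_rV R n).

Lemma exprn_1D_le (e : R) : 0 <= e <= 1 -> (1 + e) ^+ n <= 1 + e * 3 ^+ n.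
Proof.
move=> /andP[e0 e1]; elim: n => [|k IHk]; first by rewrite !expr0 mulr1 lerDl.
rewrite !exprS; have k1 : 1 <= 3 ^+ k :> R by rewrite exprn_ege1// ler1n.
apply: (@le_trans _ _ ((1 + e) * (1 + e * 3 ^+ k))).
  by apply: ler_wpM2l => //; rewrite addr_ge0.
have : e * e * 3 ^+ k <= e * 3 ^+ k.
  by rewrite ler_wpM2r ?exprn_ge0// ler_piMr.
have : e * 1 <= e * 3 ^+ k by rewrite ler_wpM2l.
by lra.
Qed.

Lemma lebesgue_homothety (z : V) (a : R) (U : set V) : 0 < a -> measurable U ->
  lam ((fun x => z + a^-1 *: (x - z)) @^-1` U) = ((a ^+ n)%:E * lam U)%E.
Proof.
move=> a0 mU; rewrite -lebesgue_scale// -[RHS](lebesgue_rV_shift (a *: z - z)).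
  congr (lam _); apply/seteqP; split=> x /=; congr (U _);
  by rewrite !scalerDr !scalerN scalerA mulVf ?gt_eqF// scale1r; rewrite addrC;
     rewrite [in RHS]addrCA addrC addrA.
exact: measurable_preim (measurable_scalev _) mU.
Qed.

(** Dilating the interior slightly about one of its points covers the closure,
    and hardly changes the volume. *)
Lemma convex_boundary_null (D : set V) : convexv D -> D° !=set0 ->
  lam (closure D `\` D°) = 0%E.
Proof.
move=> cD [z iz].
have mi : measurable D° by apply: open_measurable_rV; exact: open_interior.
have mc : measurable (closure D) by apply: closed_measurable_rV; exact: closed_closure.
have mN : measurable (closure D `\` D°) by exact: measurableD.
pose B (k : nat) := [set x : V | enorm (x - z) <= k%:R].
have mB k : measurable (B k) by apply: closed_measurable_rV; exact: closed_eball.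
apply/negligibleP => //.
rewrite (_ : _ `\` _ = \bigcup_k ((closure D `\` D°) `&` B k)); last first.
  apply/seteqP; split=> [x Nx|x [k _ []]//].
  by exists (Num.bound (enorm (x - z))) => //; split=> //;
    exact/ltW/archi_boundP/enorm_ge0.
apply: negligible_bigcup => k; apply/negligibleP; first exact: measurableI.
set N := _ `&` _.
have mNk : measurable N by exact: measurableI.
pose U := D° `&` B k; pose C := closure D `&` B k.
have mU : measurable U by exact: measurableI.
have mC : measurable C by exact: measurableI.
have CUN : C = U `|` N.
  rewrite /C /U /N -setIUl setDUK// => x Dx.
  by apply: subset_closure; exact: interior_subset.
have Cfin : (lam C < +oo)%E.
  apply: (@lebesgue_bounded _ _ _ (k%:R + enorm z)) => // x [_ xk].
  by rewrite -(subrK z x) (le_trans (enormD _ _))// lerD2r.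
have lamC : (lam C = lam U + lam N)%E.
  rewrite CUN measureU// /U /N; apply/seteqP; split=> // x [[? _] [[_ ?] _]].
  by [].
have Ufin : (lam U < +oo)%E.
  apply: le_lt_trans Cfin; apply: le_measure; rewrite ?inE// CUN.
  by move=> x; left.
have Nfin : (lam N < +oo)%E.
  apply: le_lt_trans Cfin; apply: le_measure; rewrite ?inE// CUN.
  by move=> x; right.
have [u uE] : exists u, lam U = u%:E.
  by exists (fine (lam U)); rewrite fineK// ge0_fin_numE.
have [v vE] : exists v, lam N = v%:E.
  by exists (fine (lam N)); rewrite fineK// ge0_fin_numE.
have u0 : 0 <= u by rewrite -lee_fin -uE.
have v0 : 0 <= v by rewrite -lee_fin -vE.
have key (e : R) : 0 < e <= 1 -> v <= e * (3 ^+ n * u).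
  move=> /andP[e0 e1]; have e10 : 0 < 1 + e by rewrite addr_gt0.
  have CU : C `<=` (fun x => z + (1 + e)^-1 *: (x - z)) @^-1` U.
    move=> x [Dx Bx]; split=> /=; last first.
      rewrite /B/= addrC addKr enormZ gtr0_norm ?invr_gt0// ler_pdivrMl//.
      by rewrite (le_trans Bx)// ler_peMl// lerDl ltW.
    have -> : z + (1 + e)^-1 *: (x - z) =
        (1 - (1 - (1 + e)^-1)) *: x + (1 - (1 + e)^-1) *: z.
      by apply/rowP => i; rewrite !mxE; ring.
    apply: convex_interior_segment => //.
    by rewrite subr_gt0 invf_lt1// ltrDl e0 lerBlDr lerDl invr_ge0 ltW.
  have : (lam C <= ((1 + e) ^+ n)%:E * lam U)%E.
    rewrite -(lebesgue_homothety z)//; apply: le_measure; rewrite ?inE//.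
    apply: measurable_preim mU.
    have := measurableT_comp (measurable_addv z) (measurableT_comp
      (measurable_scalev (1 + e)^-1) (measurable_addv (- z))).
    by congr (measurable_fun _ _); apply/funext => x /=; rewrite addrC.
  rewrite lamC uE vE -EFinD -EFinM lee_fin => H.
  have : (1 + e) ^+ n * u <= (1 + e * 3 ^+ n) * u.
    by rewrite ler_wpM2r// exprn_1D_le// e1 ltW.
  by lra.
change (lam N = 0%E); rewrite vE; congr EFin; apply/le_anti; rewrite v0 andbT.
apply/ler_addgt0Pr => d d0; rewrite add0r.
pose w := 3 ^+ n * u; have w0 : 0 <= w by rewrite mulr_ge0 ?exprn_ge0.
have w1 : 0 < w + 1 + d by lra.
have /key : 0 < d / (w + 1 + d) <= 1.
  by rewrite divr_gt0// ler_pdivrMr// mul1r; lra.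
move/le_trans; apply; rewrite -/w mulrAC ler_pdivrMr//; nra.
Qed.

End convex_boundary_null.

(** * Log-concave functions *)

Section integral_without_measurability.
Context d (T : measurableType d) (R : realType).
Variable mu : {measure set T -> \bar R}.
Local Open Scope ereal_scope.
Import HBNNSimple.

(** The integral of a nonnegative function is a supremum over the simple
    functions below it, so that it is monotone without measurability; this
    matters as a log-concave function need not be Borel. *)
Lemma ge0_le_integral_any (f g : T -> \bar R) : (forall x, 0 <= f x) ->
  (forall x, f x <= g x) -> \int[mu]_x f x <= \int[mu]_x g x.
Proof.
move=> f0 fg; have g0 x : 0 <= g x by exact: le_trans (fg x).
rewrite !ge0_integralTE//; apply: le_ereal_sup => _ [h /= hf <-].
by exists h => //= x; exact: le_trans (fg x).
Qed.

Lemma ge0_eq_integral_null (f g : T -> \bar R) (N : set T) :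
  measurable N -> mu N = 0 -> (forall x, 0 <= f x) -> (forall x, 0 <= g x) ->
  (forall x, ~ N x -> f x = g x) -> \int[mu]_x f x = \int[mu]_x g x.
Proof.
move=> mN N0; wlog suff le : f g / (forall x, 0 <= f x) -> (forall x, 0 <= g x) ->
    (forall x, ~ N x -> f x = g x) -> \int[mu]_x f x <= \int[mu]_x g x.
  move=> f0 g0 fg; apply/le_anti; rewrite !le// => x /fg.
  by move=> ->.
move=> f0 g0 fg; rewrite [leLHS]ge0_integralTE//; apply: ge_ereal_sup => _ [h /= hf <-].
rewrite -integralT_nnsfun.
have mh : measurable_fun setT (fun x => (h x)%:E) by exact/measurable_EFinP.
have h0 x : 0 <= (h x)%:E by rewrite lee_fin fun_ge0.
rewrite (ge0_negligible_integral mN)// integral_mkcond.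
apply: ge0_le_integral_any => x; rewrite patchE; case: ifPn => //.
by move=> /set_mem[_ nN]; rewrite -fg.
Qed.

Lemma eq_integral_null (f g : T -> \bar R) (N : set T) :
  measurable N -> mu N = 0 ->
  (forall x, ~ N x -> f x = g x) -> \int[mu]_x f x = \int[mu]_x g x.
Proof.
move=> mN N0 fg; rewrite integralE [RHS]integralE.
congr (_ - _); apply: (ge0_eq_integral_null mN N0) => x //; rewrite ?funeposE ?funenegE.
by move=> /fg ->.
by move=> /fg ->.
Qed.

End integral_without_measurability.

Section logconcave.
Context {R : realType} {n : nat}.
Local Notation V := 'rV[R]_n.

(** Log-concavity in terms of real numbers: concavity of ln f on the convex set
    where f is positive. *)
Definition logconc (f : V -> R) : Prop := (forall x, 0 <= f x) /\
  forall x y (t : R), 0 <= t <= 1 -> 0 < f x -> 0 < f y ->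
    0 < f (t *: x + (1 - t) *: y) /\
    t * ln (f x) + (1 - t) * ln (f y) <= ln (f (t *: x + (1 - t) *: y)).

Lemma log_concave_logconc f : log_concave f -> logconc f.
Proof.
move=> [psi [psiN psic fpsi]]; split=> [x|x y t t01 fx fy].
  by rewrite -lee_fin fpsi expeR_ge0.
have real_psi z : 0 < f z -> exists2 r, psi z = r%:E & ln (f z) = - r.
  move=> fz; have := fpsi z; case: (psi z) (psiN z) => [r _ /= [->]|_ /= [fz0]|//].
    by exists r => //; rewrite expRK.
  by rewrite fz0 ltxx in fz.
have [r rx ->] := real_psi _ fx; have [s sy ->] := real_psi _ fy.
have := psic x y t t01; rewrite rx sy -!EFinM -EFinD.
have := fpsi (t *: x + (1 - t) *: y).
case: (psi _) (psiN (t *: x + (1 - t) *: y)) => [q _ /= [->]|_ _|//].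
  by rewrite lee_fin expR_gt0 expRK => H; split=> //; lra.
by rewrite leye_eq.
Qed.

Variable f : V -> R.
Hypothesis fL : logconc f.

Let f0 x : 0 <= f x. Proof. by case: fL. Qed.

Lemma logconc_convex_ge (c : R) : 0 < c -> convexv [set x | c <= f x].
Proof.
move=> c0 x y t t01 /= cx cy; have [_ /(_ x y t t01)] := fL.
move=> /(_ (lt_le_trans c0 cx) (lt_le_trans c0 cy))[fz].
rewrite -ler_ln ?posrE// => H.
have : ln c <= ln (f x) by rewrite ler_ln ?posrE// (lt_le_trans c0).
have : ln c <= ln (f y) by rewrite ler_ln ?posrE// (lt_le_trans c0).
by move/andP: t01 => [t0 t1] ? ?; nra.
Qed.

Lemma logconc_convex_gt (c : R) : 0 <= c -> convexv [set x | c < f x].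
Proof.
move=> c0 x y t t01 /= cx cy; have [_ /(_ x y t t01)] := fL.
move=> /(_ (le_lt_trans c0 cx) (le_lt_trans c0 cy))[fz].
have [->//|cn0] := eqVneq c 0.
have cp : 0 < c by rewrite lt0r cn0.
rewrite -ltr_ln ?posrE// => H.
have : ln c < ln (f x) by rewrite ltr_ln ?posrE// (le_lt_trans c0).
have : ln c < ln (f y) by rewrite ltr_ln ?posrE// (le_lt_trans c0).
move: t01 => /andP[t0 t1] cy' cx'.
have [t_0|tn0] := eqVneq t 0; first by move: H; rewrite t_0; lra.
have tp : 0 < t by rewrite lt0r tn0.
have : 0 < t * (ln (f x) - ln c) by rewrite mulr_gt0// subr_gt0.
have : 0 <= (1 - t) * (ln (f y) - ln c) by rewrite mulr_ge0// subr_ge0// ltW.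
by lra.
Qed.

Lemma logconc_midpoint x y : f x * f y <= f (2^-1 *: (x + y)) ^+ 2.
Proof.
have := f0 x; rewrite le_eqVlt => /predU1P[<-|fx]; first by rewrite mul0r sqr_ge0.
have := f0 y; rewrite le_eqVlt => /predU1P[<-|fy]; first by rewrite mulr0 sqr_ge0.
have h01 : 0 <= (2^-1 : R) <= 1 by apply/andP; split; lra.
have [_ /(_ x y _ h01 fx fy)] := fL.
rewrite (_ : 2^-1 *: x + (1 - 2^-1) *: y = 2^-1 *: (x + y)); last first.
  by rewrite scalerDr; congr (_ + _ *: _); lra.
move=> [fz H]; rewrite -ler_ln ?posrE ?mulr_gt0// ?exprn_gt0//.
by rewrite lnM ?posrE// expr2 lnM ?posrE//; lra.
Qed.

(** On the interior of its support f is lower semicontinuous: it is so along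
    the diagonals, hence a superlevel set meets all orthants at its points. *)
Lemma logconc_lsc (c : R) (x : V) : 0 <= c -> [set x | 0 < f x]° x -> c < f x ->
  [set x | c < f x]° x.
Proof.
move=> c0 /nbhs_enormP[e e0 xe] cx.
apply: orthants_interior => [|s]; first exact: logconc_convex_gt.
have s0 : 0 < Num.sqrt n%:R + 1 :> R by rewrite ltr_wpDl// sqrtr_ge0.
pose d := e / (Num.sqrt n%:R + 1).
have d0 : 0 < d by rewrite divr_gt0.
pose u : V := \row_i (d * (-1) ^+ s i).
have fu : 0 < f (x + u).
  apply: xe; rewrite addrC addKr.
  apply: (@le_lt_trans _ _ (Num.sqrt n%:R * d)).
    apply: enorm_le_coord; first exact: ltW.
    by move=> i; rewrite mxE normrM normrX normrN1 expr1n mulr1 gtr0_norm.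
  by rewrite /d mulrCA gtr_pMr// ltr_pdivrMr// mul1r ltrDl.
have fx : 0 < f x by exact: le_lt_trans cx.
suff [t /andP[t0 t1] ct] : exists2 t, 0 < t <= 1 & c < f (t *: (x + u) + (1 - t) *: x).
  exists (t *: (x + u) + (1 - t) *: x) => // i; rewrite !mxE.
  rewrite [X in _ * X](_ : _ = t * d * (-1) ^+ s i); last by ring.
  by rewrite mulrCA -expr2 -exprM mulnC exprM sqrrN expr1n expr1n mulr1 mulr_gt0.
have [c_0|cn0] := eqVneq c 0.
  by exists 1; rewrite ?ltr01 ?lexx// c_0 subrr scale0r addr0 scale1r.
have cp : 0 < c by rewrite lt0r cn0.
pose E := ln (f x) - ln c; pose L := `|ln (f (x + u)) - ln (f x)| + 1.
have E0 : 0 < E by rewrite subr_gt0 ltr_ln.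
have L0 : 0 < L by rewrite ltr_wpDl.
have EL : 0 < E + L by rewrite addr_gt0.
pose t := E / (E + L).
have t0 : 0 < t by rewrite divr_gt0.
have t1 : t <= 1 by rewrite ler_pdivrMr// mul1r lerDl ltW.
exists t; first by rewrite t0.
have [_ /(_ (x + u) x t)] := fL; rewrite (ltW t0) t1 => /(_ isT fu fx)[fz H].
rewrite -ltr_ln ?posrE//; apply: lt_le_trans H.
have uL : - L < ln (f (x + u)) - ln (f x).
  have := ler_norm (- (ln (f (x + u)) - ln (f x))).
  by rewrite normrN /L; lra.
have tEL : t * (E + L) = E by rewrite divfK// gt_eqF.
have EE : E = ln (f x) - ln c by [].
have tuL : t * (- L) < t * (ln (f (x + u)) - ln (f x)) by rewrite ltr_pM2l.
have tE : 0 < t * E by rewrite mulr_gt0.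
by clearbody E L t; lra.
Qed.

(** The modification of f that vanishes outside the interior of its support
    is a Borel function, which f itself need not be. *)
Definition lsc_part : V -> R :=
  fun x => if `[< [set x | 0 < f x]° x >] then f x else 0.

Lemma lsc_partE x : [set x | 0 < f x]° x -> lsc_part x = f x.
Proof. by move=> ix; rewrite /lsc_part asboolT. Qed.

Lemma lsc_part_gt0 x : 0 < lsc_part x <-> [set x | 0 < f x]° x.
Proof.
split; first by rewrite /lsc_part; case: asboolP => // _; rewrite ltxx.
by move=> ix; rewrite lsc_partE//; exact: (interior_subset ix).
Qed.

Lemma lsc_part_ge0 x : 0 <= lsc_part x.
Proof. by rewrite /lsc_part; case: ifP. Qed.

Lemma lsc_part_logconc : logconc lsc_part.
Proof.
split=> [x|x y t t01 /lsc_part_gt0 ix /lsc_part_gt0 iy]; first exact: lsc_part_ge0.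
have iz := convexv_interior (logconc_convex_gt (lexx 0)) t01 ix iy.
rewrite !lsc_partE//; have [_] := fL; apply => //.
- exact: (interior_subset ix).
- exact: (interior_subset iy).
Qed.

Lemma open_lsc_part (c : R) : 0 <= c -> open [set x | c < lsc_part x].
Proof.
move=> c0; rewrite openE => x /= cx; have ix := (lsc_part_gt0 x).1 (le_lt_trans c0 cx).
rewrite lsc_partE// in cx; have := logconc_lsc c0 ix cx.
move/nbhs_interior : ix; apply: filterS2 => y iy /= cy.
by rewrite lsc_partE.
Qed.

Lemma measurable_lsc_part : measurable_fun setT lsc_part.
Proof.
apply: (measurability _ (RGenOInfty.measurableE R)) => _ [_ [c ->] <-].
rewrite setTI (_ : _ @^-1` _ = [set x | c < lsc_part x]); last first.
  by apply/seteqP; split=> x /=; rewrite in_itv/= andbT.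
have [c0|c0] := leP 0 c; first by apply: open_measurable_rV; exact: open_lsc_part.
rewrite (_ : [set x | _] = setT)//; apply/seteqP; split=> // x _ /=.
by rewrite (lt_le_trans c0)// lsc_part_ge0.
Qed.

End logconcave.

(** * Metric projection onto a closed convex set *)

Section projection.
Context {R : realType} {n : nat}.
Local Notation V := 'rV[R]_n.
Implicit Types (x y z p q : V).
Variable K : set V.
Hypotheses (cK : closed K) (vK : convexv K) (K0 : K !=set0).

(** Moving from p a little towards k would otherwise decrease the distance. *)
Let obtuse_of_nearest x p : K p -> (forall k, K k -> enorm (p - x) <= enorm (k - x)) ->
  forall k, K k -> dotv (x - p) (k - p) <= 0.
Proof.
move=> Kp pmin k Kk; rewrite leNgt; apply/negP => d0.
set d := dotv _ _ in d0; set e := dotv (k - p) (k - p).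
have e0 : 0 <= e by exact: dotv_ge0.
have key (t : R) : 0 <= t <= 1 -> 2 * t * d <= t ^+ 2 * e.
  move=> t01; have := pmin _ (vK t01 Kk Kp).
  rewrite -(ler_pXn2r (n:=2)) ?nnegrE ?enorm_ge0// !sqr_enorm.
  rewrite (_ : t *: k + (1 - t) *: p - x = t *: (k - p) - (x - p)); last first.
    by apply/rowP => i; rewrite !mxE; ring.
  rewrite -(opprB x p) dotvNl dotvNr opprK.
  have -> (v w : V) : dotv (t *: w - v) (t *: w - v) =
      t ^+ 2 * dotv w w - 2 * t * dotv v w + dotv v v.
    by rewrite dotvBl !dotvBr !(dotvZl, dotvZr) (dotvC w v); ring.
  rewrite -/e -/d; lra.
have ed : 0 < d + e by rewrite ltr_pwDl.
pose t := d / (d + e); have t0 : 0 < t by rewrite divr_gt0.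
have /key : 0 <= t <= 1.
  by rewrite (ltW t0)/= ler_pdivrMr// mul1r lerDl.
have te : t * (d + e) = d by rewrite divfK// gt_eqF.
have -> : t ^+ 2 * e = t * (t * (d + e) - t * d) by ring.
rewrite te.
have td : 0 < t * d by rewrite mulr_gt0.
have ttd : 0 < t * (t * d) by rewrite mulr_gt0.
by move: td ttd; lra.
Qed.

Lemma projection_exists x : exists p, K p /\
  forall k, K k -> dotv (x - p) (k - p) <= 0.
Proof.
have [k0 Kk0] := K0.
pose A := K `&` [set y | enorm (y - x) <= enorm (k0 - x)].
have cA : compact A.
  apply: (@compact_enorm _ _ _ (enorm (k0 - x) + enorm x)).
    by apply: closedI => //; exact: closed_eball.
  by move=> y [_ /= yx]; rewrite -(subrK x y) (le_trans (enormD _ _))// lerD2r.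
have A0 : A !=set0 by exists k0; split=> /=.
have cf : {within A, continuous (fun y => enorm (y - x))}.
  by apply: continuous_subspaceT; exact: continuous_enormB.
have [p /set_mem[Kp px] pmin] := EVT_min_rV A0 cA cf.
exists p; split=> //; apply: obtuse_of_nearest => // k Kk.
have [kx|/ltW kx] := leP (enorm (k - x)) (enorm (k0 - x)).
  by apply: pmin; rewrite inE; split.
exact: le_trans px kx.
Qed.

Definition projv x := projT1 (cid (projection_exists x)).

Lemma projv_mem x : K (projv x).
Proof. by rewrite /projv; case: cid => p []. Qed.

Lemma projv_obtuse x k : K k -> dotv (x - projv x) (k - projv x) <= 0.
Proof. by rewrite /projv; case: cid => p [/= _]; apply. Qed.

Lemma projv_unique x p : K p -> (forall k, K k -> dotv (x - p) (k - p) <= 0) ->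
  projv x = p.
Proof.
move=> Kp pP; have H1 := projv_obtuse x Kp; have H2 := pP _ (projv_mem x).
apply/eqP; rewrite -subr_eq0; apply/eqP/dotv_eq0; move: H1 H2.
rewrite !dotvBl !dotvBr (dotvC p (projv x)); lra.
Qed.

Lemma projv_lipschitz x y : enorm (projv x - projv y) <= enorm (x - y).
Proof.
have H1 := projv_obtuse x (projv_mem y); have H2 := projv_obtuse y (projv_mem x).
have H : enorm (projv x - projv y) ^+ 2 <= enorm (x - y) * enorm (projv x - projv y).
  apply: le_trans (cauchy_schwarz _ _).
  move: H1 H2; rewrite sqr_enorm !dotvBl !dotvBr (dotvC (projv y) (projv x)); lra.
have := enorm_ge0 (projv x - projv y); rewrite le_eqVlt => /predU1P[<-|d0].
  exact: enorm_ge0.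
by move: H; rewrite expr2 ler_pM2r.
Qed.

(** The displacement from the nearest point is normal to a separating
    hyperplane through that point. *)
Lemma separation x : ~ K x -> exists u : V, [/\ enorm u = 1,
  dotv u (projv x) < dotv u x & forall k, K k -> dotv u k <= dotv u (projv x)].
Proof.
move=> nKx; have xp : x - projv x != 0.
  by rewrite subr_eq0; apply: contra_notN nKx => /eqP ->; exact: projv_mem.
have e0 := enorm_gt0 xp.
exists ((enorm (x - projv x))^-1 *: (x - projv x)); split=> [||k Kk].
- by rewrite enormZ gtr0_norm ?invr_gt0// mulVf// gt_eqF.
- rewrite !dotvZl ltr_pM2l ?invr_gt0// -subr_gt0 -dotvBr -sqr_enorm.
  by rewrite exprn_gt0.
- rewrite !dotvZl ler_pM2l ?invr_gt0// -subr_le0 -dotvBr.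
  exact: projv_obtuse.
Qed.

End projection.

(** * Isotropic log-concave functions *)

Section isotropic_lsc.
Context {R : realType} {n : nat}.
Local Notation V := 'rV[R]_n.
Local Notation lam := (@lebesgue_rV R n).
Variable f : V -> R.
Import HBNNSimple.
Hypotheses (fL : logconc f) (fI : isotropic f).

(** A Borel set of positive measure inside the support would meet all orthants at
    some point, which would then be interior. *)
Lemma support_interior_nonempty : [set x | 0 < f x]° !=set0.
Proof.
apply: contrapT => iD0; have [f1 _ _] := fI.
have f0 x : (0 <= (f x)%:E)%E by rewrite lee_fin; case: fL.
suff : (\int[lam]_x (f x)%:E <= 0)%E by rewrite f1 leNgt lte01.
rewrite ge0_integralTE//; apply: ge_ereal_sup => _ [h /= hf <-].
rewrite -integralT_nnsfun.
have mh : measurable_fun setT (fun x => (h x)%:E) by exact/measurable_EFinP.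
pose N := [set x | 0 < h x].
have mN : measurable N by exact: measurable_gt_fun.
have N0 : lam N = 0%E.
  apply/eqP; apply: contrapT => /negP/(positive_measure_meets_orthants mN)[q Nq].
  apply: iD0; exists (map_mx ratr q); apply: orthants_interior.
    exact: (logconc_convex_gt fL (lexx 0)).
  move=> s; have [p Np ps] := Nq s; exists p => //=.
  by apply: lt_le_trans Np _; rewrite -lee_fin.
rewrite (ge0_negligible_integral mN)//; last first.
  by move=> x _; rewrite lee_fin fun_ge0.
rewrite integral0_eq// => x [_ /negP]; rewrite -leNgt => hx; congr EFin.
by apply/le_anti; rewrite hx fun_ge0.
Qed.

Let N : set V := closure [set x | 0 < f x] `\` [set x | 0 < f x]°.

Let lsc_part_off_null x : ~ N x -> f x = lsc_part f x.
Proof.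
move=> nN; have [ix|nix] := pselect ([set x | 0 < f x]° x); first by rewrite lsc_partE.
rewrite /lsc_part asboolF//; apply/le_anti; rewrite (proj1 fL) andbT leNgt.
apply/negP => fx; apply: nN; split=> //; exact: subset_closure.
Qed.

(** f and its modification only differ on the boundary of the convex set where f
    is positive. *)
Lemma lsc_part_isotropic : isotropic (lsc_part f).
Proof.
have mN : measurable N.
  apply: measurableD; first exact: closed_measurable_rV (@closed_closure _ _).
  exact: open_measurable_rV (@open_interior _ _).
have N0 : lam N = 0%E.
  apply: convex_boundary_null support_interior_nonempty.
  exact: (logconc_convex_gt fL (lexx 0)).
have [f1 f2 f3] := fI; split=> [|i|i j].
- by rewrite -f1; apply: (eq_integral_null mN N0) => x /lsc_part_off_null ->.
- by rewrite -(f2 i); apply: (eq_integral_null mN N0) => x /lsc_part_off_null ->.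
- by rewrite -(f3 i j); apply: (eq_integral_null mN N0) => x /lsc_part_off_null ->.
Qed.

End isotropic_lsc.

Section moments.
Context {R : realType} {n : nat}.
Local Notation V := 'rV[R]_n.
Local Notation lam := (@lebesgue_rV R n).
Variable g : V -> R.
Hypotheses (mg : measurable_fun setT g) (g0 : forall x, 0 <= g x)
  (gI : isotropic g).

Let mx i : measurable_fun [set: V] (fun x : V => x ord0 i).
Proof. exact: measurable_coord. Qed.

Let int_ge0 (h : V -> R) r : measurable_fun setT h -> (forall x, 0 <= h x) ->
  (\int[lam]_x (h x)%:E = r%:E)%E -> lam.-integrable setT (EFin \o h).
Proof.
move=> mh h0 hr; apply/integrableP; split; first exact/measurable_EFinP.
rewrite (eq_integral (fun x => (h x)%:E)) ?hr ?ltry// => x _ /=.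
by rewrite ger0_norm.
Qed.

Lemma integrable_density : lam.-integrable setT (EFin \o g).
Proof. by case: gI => g1 _ _; exact: (@int_ge0 g 1). Qed.

Let integrable_sqr i : lam.-integrable setT (fun x => (x ord0 i * x ord0 i * g x)%:E).
Proof.
apply: (@int_ge0 (fun x => x ord0 i * x ord0 i * g x) 1).
- by do 2 apply: measurable_funM => //.
- by move=> x; rewrite mulr_ge0// -expr2 sqr_ge0.
- by case: gI => _ _ /(_ i i); rewrite mxE eqxx.
Qed.

Lemma integrable_coord2 i j :
  lam.-integrable setT (fun x => (x ord0 i * x ord0 j * g x)%:E).
Proof.
apply: le_integrable (integrableD measurableT (integrable_sqr i) (integrable_sqr j)) => //.
  by apply/measurable_EFinP; do 2 apply: measurable_funM => //.
move=> x _ /=; rewrite lee_fin -mulrDl !normrM (ger0_norm (g0 x)) ler_wpM2r//.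
rewrite [leRHS]ger0_norm; last by rewrite addr_ge0// -expr2 sqr_ge0.
have := sqr_ge0 (`|x ord0 i| - `|x ord0 j|).
rewrite -!expr2 -(real_normK (num_real (x ord0 i))) -(real_normK (num_real (x ord0 j))).
by have := sqr_ge0 (`|x ord0 i| + `|x ord0 j|); lra.
Qed.

Lemma integrable_coord i : lam.-integrable setT (fun x => (x ord0 i * g x)%:E).
Proof.
apply: le_integrable (integrableD measurableT integrable_density (integrable_sqr i)) => //.
  by apply/measurable_EFinP; apply: measurable_funM.
move=> x _ /=; rewrite lee_fin.
rewrite (_ : g x + _ = (1 + x ord0 i * x ord0 i) * g x); last by ring.
rewrite !normrM (ger0_norm (g0 x)) ler_wpM2r//.
rewrite [leRHS]ger0_norm; last by rewrite addr_ge0// -expr2 sqr_ge0.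
rewrite -expr2 -(real_normK (num_real (x ord0 i))).
by have := sqr_ge0 (`|x ord0 i| - 1); have := normr_ge0 (x ord0 i); nra.
Qed.

Lemma integral_dotv u : (\int[lam]_x (dotv u x * g x)%:E = 0)%E.
Proof.
have [_ g1 _] := gI.
transitivity (\int[lam]_x \sum_(i < n) ((u ord0 i)%:E * (x ord0 i * g x)%:E))%E.
  apply: eq_integral => x _; rewrite sumEFin /dotv big_distrl/=.
  by congr EFin; apply: eq_bigr => i _; rewrite mulrA.
rewrite integral_sum//; last by move=> i; apply: integrableZl => //; exact: integrable_coord.
rewrite big1// => i _; rewrite integralZl//; last exact: integrable_coord.
by rewrite g1 mule0.
Qed.

Lemma integral_dotv2 u : (\int[lam]_x (dotv u x ^+ 2 * g x)%:E = (dotv u u)%:E)%E.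
Proof.
have [_ _ g2] := gI.
have intij i j : lam.-integrable setT
    (fun x => ((u ord0 i * u ord0 j)%:E * (x ord0 i * x ord0 j * g x)%:E))%E.
  by apply: integrableZl => //; exact: integrable_coord2.
transitivity (\int[lam]_x \sum_(i < n) \sum_(j < n)
    ((u ord0 i * u ord0 j)%:E * (x ord0 i * x ord0 j * g x)%:E))%E.
  apply: eq_integral => x _.
  rewrite (eq_bigr (fun i => (\sum_(j < n) u ord0 i * u ord0 j * (x ord0 i * x ord0 j * g x))%:E));
    last by move=> i _; rewrite -sumEFin; apply: eq_bigr => j _.
  rewrite sumEFin; congr EFin; rewrite expr2 /dotv big_distrl/= big_distrl/=.
  apply: eq_bigr => i _; rewrite big_distrr/= big_distrl/=; apply: eq_bigr => j _.
  by ring.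
rewrite integral_sum//; last by move=> i; exact: integrable_sum.
rewrite -sumEFin; apply: eq_bigr => i _; rewrite integral_sum//.
rewrite (bigD1 i)//= big1 => [|j ji]; rewrite integralZl//; try exact: integrable_coord2.
  by rewrite g2 mxE eqxx mule1 adde0.
by rewrite g2 mxE eq_sym (negbTE ji) mule0.
Qed.

Lemma measurable_dotvM u : measurable_fun setT (fun x => dotv u x * g x).
Proof. by apply: measurable_funM => //; exact: measurable_dotv. Qed.

Lemma integrable_dotv u : lam.-integrable setT (fun x => (dotv u x * g x)%:E).
Proof.
have isq : lam.-integrable setT (fun x => (dotv u x ^+ 2 * g x)%:E).
  apply: (@int_ge0 (fun x => dotv u x ^+ 2 * g x) (dotv u u)).
  - by apply: measurable_funM => //; apply: measurable_funX; exact: measurable_dotv.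
  - by move=> x; rewrite mulr_ge0// sqr_ge0.
  - exact: integral_dotv2.
apply: le_integrable (integrableD measurableT integrable_density isq) => //.
  by apply/measurable_EFinP; exact: measurable_dotvM.
move=> x _ /=; rewrite lee_fin.
rewrite (_ : g x + _ = (1 + dotv u x ^+ 2) * g x); last by ring.
rewrite !normrM (ger0_norm (g0 x)) ler_wpM2r//.
rewrite [leRHS]ger0_norm; last by rewrite addr_ge0// sqr_ge0.
rewrite -(real_normK (num_real (dotv u x))).
by have := sqr_ge0 (`|dotv u x| - 1); have := normr_ge0 (dotv u x); nra.
Qed.

End moments.

Section key_ball.
Context {R : realType} {n : nat}.
Local Notation V := 'rV[R]_n.
Local Notation lam := (@lebesgue_rV R n).

(** A reverse Hoelder inequality for linear functionals: Prekopa-Leindler is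
    applied to Y^2 g and to g restricted to the slab |Y| <= 2A, whose mass is at
    least one half by Markov's inequality if A bounds the mean of |Y|. *)
Lemma mean_abs_dotv_gt (g : V -> R) (u : V) :
  measurable_fun setT g -> logconc g -> isotropic g -> dotv u u = 1 ->
  ((6^-1)%R%:E < \int[lam]_x (`|dotv u x| * g x)%:E)%E.
Proof.
move=> mg gL gI u1; have g0 x : 0 <= g x by case: gL.
rewrite ltNge; apply/negP => small.
have mY : measurable_fun setT (dotv u) by exact: measurable_dotv.
have mY' : measurable_fun setT (fun x => `|dotv u x|) by exact: measurableT_comp.
(* The bound A on the mean of |Y| is contradictory as soon as 1 / 2 > (4 A) ^ 2. *)
pose A : R := 6^-1; have A0 : 0 < A by rewrite invr_gt0.
pose S := [set x | `|dotv u x| <= 2 * A].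
have mS : measurable S.
  have := measurable_fun_ler mY' (measurable_cst (2 * A : R)).
  by move=> /(_ measurableT [set true]); rewrite setTI; apply.
pose F x := (dotv u x ^+ 2 * g x)%:E.
pose G x := (g x * \1_S x)%:E.
pose H x := (2 * (`|dotv u x| * g x) + 2 * A * g x)%:E.
have mYg : measurable_fun setT (fun x => `|dotv u x| * g x) by exact: measurable_funM.
have mF : measurable_fun setT F.
  by apply/measurable_EFinP; apply: measurable_funM => //; exact: measurable_funX.
have mG : measurable_fun setT G.
  by apply/measurable_EFinP; apply: measurable_funM => //; exact: measurable_indic.
have mH : measurable_fun setT H.
  by apply/measurable_EFinP; apply: measurable_funD; exact: measurable_funM.
have F0 x : (0 <= F x)%E by rewrite lee_fin mulr_ge0// sqr_ge0.
have G0 x : (0 <= G x)%E by rewrite lee_fin mulr_ge0.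
have Yg0 x : 0 <= `|dotv u x| * g x by rewrite mulr_ge0.
have A20 x : 0 <= 2 * A * g x by rewrite mulr_ge0// mulr_ge0// ltW.
have H0 x : (0 <= H x)%E by rewrite lee_fin addr_ge0// mulr_ge0.
have FGH x y : (F x * G y <= H (2^-1 *: (x + y)) * H (2^-1 *: (x + y)))%E.
  rewrite -!EFinM lee_fin indicE; set m := 2^-1 *: (x + y).
  case: (boolP (y \in S)) => [/set_mem yS|_]; last first.
    by rewrite !mulr0 mulr_ge0// addr_ge0// mulr_ge0.
  rewrite mulr1.
  have Yx : `|dotv u x| <= 2 * `|dotv u m| + 2 * A.
    have -> : dotv u x = 2 * dotv u m - dotv u y.
      by rewrite /m dotvZr dotvDr; field.
    by rewrite (le_trans (ler_normB _ _))// lerD// normrM ger0_norm.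
  rewrite [leRHS](_ : _ = (2 * `|dotv u m| + 2 * A) ^+ 2 * g m ^+ 2); last by ring.
  rewrite -mulrA; apply: ler_pM; rewrite ?sqr_ge0 ?mulr_ge0//; last first.
    exact: logconc_midpoint.
  rewrite -real_normK ?num_real// ler_pXn2r// nnegrE addr_ge0// mulr_ge0//.
  exact: ltW.
have := prekopa_leindler_midpoint mF mG mH F0 G0 H0 FGH.
rewrite integral_dotv2// u1 mul1e.
have [g1 _ _] := gI.
have iYg : (0 <= \int[lam]_x (`|dotv u x| * g x)%:E)%E.
  by apply: integral_ge0 => x _; rewrite lee_fin.
have mYgE : measurable_fun setT (fun x => (`|dotv u x| * g x)%:E) by exact/measurable_EFinP.
have mgE : measurable_fun setT (fun x => (g x)%:E) by exact/measurable_EFinP.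
have iH : (\int[lam]_x H x <= (4 * A)%:E)%E.
  rewrite /H; under eq_integral do rewrite EFinD !EFinM -EFinM.
  rewrite ge0_integralD//.
  - rewrite !ge0_integralZl_EFin//.
    + rewrite g1 mule1 (_ : 4 * A = 2 * A + 2 * A); last by ring.
      by rewrite (EFinD (2 * A) (2 * A)) leeD2r// (EFinM 2 A) lee_pmul2l.
    + by move=> x _; rewrite lee_fin.
    + by rewrite mulr_ge0// ltW.
    + by move=> x _; rewrite lee_fin.
  - by move=> x _; rewrite -EFinM lee_fin mulr_ge0.
  - by apply: measurable_funeM.
  - by move=> x _; rewrite -EFinM lee_fin.
  - by apply: measurable_funeM.
have iH0 : (0 <= \int[lam]_x H x)%E by exact: integral_ge0.
have iG : (2^-1%:E <= \int[lam]_x G x)%E.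
  have : (\int[lam]_x (g x)%:E <= \int[lam]_x (G x + (3 * (`|dotv u x| * g x))%:E))%E.
    apply: ge0_le_integral_any => x; first by rewrite lee_fin.
    rewrite -EFinD lee_fin indicE; case: (boolP (x \in S)) => [_|nS].
      by rewrite mulr1 lerDl mulr_ge0.
    rewrite mulr0 add0r mulrA ler_peMl//.
    move: nS; rewrite notin_setE /S/= => /negP; rewrite -ltNge /A.
    by lra.
  rewrite g1 ge0_integralD//; last 2 first.
  - by move=> x _; rewrite lee_fin mulr_ge0.
  - by apply/measurable_EFinP; exact: measurable_funM.
  under [X in (_ + X)%E]eq_integral do rewrite EFinM.
  rewrite ge0_integralZl_EFin//; last by move=> x _; rewrite lee_fin.
  move=> H1; have : (1 <= \int[lam]_x G x + (2^-1)%:E)%E.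
    apply: le_trans H1 _; rewrite leeD2l//.
    apply: (@le_trans _ _ (3%:E * (6^-1)%:E)%E); first by rewrite lee_pmul2l.
    by rewrite -EFinM lee_fin; lra.
  rewrite -leeBlDr// -EFinB; apply: le_trans; rewrite lee_fin; lra.
move=> iG2.
have : (\int[lam]_x H x * \int[lam]_x H x <= (4 * A)%:E * (4 * A)%:E)%E.
  exact: lee_pmul.
move=> /(le_trans (le_trans iG iG2)); rewrite -EFinM lee_fin /A; lra.
Qed.

(** Contracting towards p by the factor 2 multiplies the small values of f by a
    large exponential factor, while volumes decrease only by the factor 2^n. *)
Lemma mass_of_small_values (f : V -> R) (q : R) (p : V) :
  logconc f -> isotropic f -> 0 < q -> 0 < f p ->
  (\int[lam]_x (lsc_part f x * \1_[set x | (lsc_part f x < q ^+ (2 * n) * f p)%R] x)%:E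
    <= ((2 * q) ^+ n)%:E)%E.
Proof.
move=> fL fI q0 fp; set g := lsc_part f.
have g0 x : 0 <= g x by exact: lsc_part_ge0.
have mg : measurable_fun setT g by exact: measurable_lsc_part.
apply: (@le_trans _ _ (\int[lam]_x ((q ^+ n)%:E * (g (2^-1 *: (x + p)))%:E))%E).
  apply: ge0_le_integral_any => x; first by rewrite lee_fin mulr_ge0.
  rewrite -EFinM lee_fin indicE.
  case: (boolP (x \in _)) => [/set_mem/= gx|_]; last first.
    by rewrite mulr0 mulr_ge0// exprn_ge0// ltW.
  rewrite mulr1; have := g0 x; rewrite le_eqVlt => /predU1P[<-|gx0].
    by rewrite mulr_ge0// exprn_ge0// ltW.
  have ix := (lsc_part_gt0 f x).1 gx0.
  have im : [set x | 0 < f x]° (2^-1 *: (x + p)).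
    have -> : 2^-1 *: (x + p) = (1 - 2^-1) *: p + 2^-1 *: x.
      by apply/rowP => i; rewrite !mxE; field.
    apply: convex_interior_segment => //.
    - exact: (logconc_convex_gt fL (lexx 0)).
    - exact: subset_closure.
    - by rewrite invr_gt0 ltr0n invf_le1// ler1n.
  have H := logconc_midpoint fL x p; rewrite -(lsc_partE ix) -(lsc_partE im) in H.
  rewrite -/g in H gx ix im *.
  rewrite -(ler_pXn2r (n:=2)) ?nnegrE ?mulr_ge0 ?exprn_ge0 ?(ltW q0)//.
  rewrite exprMn -exprM mulnC.
  apply: (@le_trans _ _ (q ^+ (2 * n) * (g x * f p))).
    by rewrite expr2 mulrCA ler_pM2l// ltW.
  by rewrite ler_wpM2l// exprn_ge0// ltW.
have mg2 : measurable_fun setT (fun x : V => (g (2^-1 *: (x + p)))%:E).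
  apply/measurable_EFinP; apply: (measurableT_comp mg).
  exact: (measurableT_comp (measurable_scalev 2^-1) (measurable_addv p)).
rewrite ge0_integralZl_EFin//; last 2 first.
- by move=> x _; rewrite lee_fin.
- by rewrite exprn_ge0// ltW.
have mgE : measurable_fun setT (fun x => (g x)%:E) by exact/measurable_EFinP.
have gE0 x : (0 <= (g x)%:E)%E by rewrite lee_fin.
rewrite (integral_affine p _ mgE gE0)//.
have [-> _ _] := lsc_part_isotropic fL fI.
by rewrite mule1 -EFinM lee_fin -exprMn mulrC.
Qed.

(** The heart of the matter: near its barycentre f is at least exponentially
    comparable with all its values. Otherwise a half space contains almost no
    mass although its boundary is close to the barycentre, and linear
    functionals would have too small a mean absolute value. *)
Lemma isotropic_ball (f : V -> R) (q : R) (p x : V) :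
  (0 < n)%N -> logconc f -> isotropic f -> 0 < q <= 24^-1 * 24^-1 -> 0 < f p ->
  enorm x < 48^-1 -> q ^+ (2 * n) * f p <= lsc_part f x.
Proof.
move=> n0 fL fI /andP[q0 q1] fp xr.
have gL := lsc_part_logconc fL; have gI := lsc_part_isotropic fL fI.
have mass := mass_of_small_values fL fI q0 fp.
have mg : measurable_fun setT (lsc_part f) by exact: measurable_lsc_part.
set g := lsc_part f in gL gI mass mg *.
have g0 y : 0 <= g y by exact: lsc_part_ge0.
pose c := q ^+ (2 * n) * f p; rewrite -/c in mass *.
have c0 : 0 < c by rewrite mulr_gt0// exprn_gt0.
pose D := [set y | c <= g y].
have cD : convexv D by exact: logconc_convex_ge.
set S := [set y | g y < c] in mass.
have mS : measurable S.
  have := measurable_fun_ltr mg (measurable_cst c).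
  by move=> /(_ measurableT [set true]); rewrite setTI; apply.
have {}mass : (\int[lam]_x (g x * \1_S x)%:E <= (2 * q)%:E)%E.
  apply: le_trans mass _; rewrite lee_fin -[leRHS]expr1.
  by rewrite ler_wiXn2l//; lra.
have [g1 _ _] := gI.
have D0 : D !=set0.
  apply: contrapT => D0; have : ((1 : R)%:E <= (2 * q)%:E)%E.
    rewrite -[X in (X <= _)%E]g1; apply: le_trans mass.
    apply: ge0_le_integral_any => y; first by rewrite lee_fin.
    rewrite indicE mem_set ?mulr1// /S/= ltNge; apply/negP => cy.
    by apply: D0; exists y.
  by rewrite lee_fin; lra.
suff sub : [set y : V | enorm y < 48^-1] `<=` closure D.
  suff : D x by [].
  apply: (convex_interior_closure cD).
  apply: filterS sub _; apply/nbhs_enormP; exists (48^-1 - enorm x).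
    by rewrite subr_gt0.
  move=> y yx /=; rewrite -(subrK x y); apply: le_lt_trans (enormD _ _) _.
  by rewrite -ltrBrDr.
move=> {xr}y /= yr; apply: contrapT => nDy.
have K0 : closure D !=set0 by have [z Dz] := D0; exists z; exact: subset_closure.
have [u [u1 uy uD]] := separation (@closed_closure _ D) (convexv_closure cD) K0 nDy.
have {}uD z : D z -> dotv u z <= 48^-1.
  move=> Dz; have Dz' : closure D z by exact: subset_closure.
  apply: le_trans (uD _ Dz') _; apply: ltW; apply: lt_trans uy _.
  apply: le_lt_trans (cauchy_schwarz _ _) _.
  by rewrite u1 mul1r.
have uu : dotv u u = 1 by rewrite -sqr_enorm u1 expr1n.
have := mean_abs_dotv_gt mg gL gI uu.
have iYg := integrable_dotv mg g0 gI u.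
have iaYg : lam.-integrable setT (fun x => (`|dotv u x| * g x)%:E).
  have := integrable_abse iYg; congr (_.-integrable _).
  by apply/funext => z /=; rewrite normrM (ger0_norm (g0 z)).
(* The mean of Y is 0, hence that of |Y| is the mean of |Y| + Y, twice the positive
   part of Y. The latter is at most 1 / 48 on D. *)
have -> : (\int[lam]_x (`|dotv u x| * g x)%:E =
    \int[lam]_x ((`|dotv u x| * g x)%:E + (dotv u x * g x)%:E))%E.
  by rewrite integralD// integral_dotv// adde0.
apply/negP; rewrite -leNgt.
(* On the set S of small mass, 2 |Y| <= Y ^ 2 / 24 + 24. The three terms contribute
   1 / 24 + 1 / 24 + 24 * 2 q, which is at most 1 / 6. *)
apply: (@le_trans _ _ (\int[lam]_x ((24^-1 * g x)%:E + ((24^-1 * (dotv u x ^+ 2 * g x))%:E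
    + (24 * (g x * \1_S x))%:E)))%E).
  apply: ge0_le_integral_any => z.
    rewrite -EFinD lee_fin -mulrDl mulr_ge0//.
    by have := ler_norm (- dotv u z); rewrite normrN; lra.
  rewrite -!EFinD lee_fin indicE; case: (boolP (z \in S)) => [_|].
    rewrite mulr1 mulrA -!mulrDl ler_wpM2r//.
    have := ler_norm (dotv u z); have := sqr_ge0 (`|dotv u z| / 24 - 1).
    rewrite -(real_normK (num_real (dotv u z))).
    by move: (`|dotv u z|) => w; rewrite sqrrB; lra.
  rewrite notin_setE /S/= => /negP; rewrite -leNgt => /uD uz.
  rewrite mulr0 mulr0 addr0 mulrA -!mulrDl ler_wpM2r//.
  have := sqr_ge0 (dotv u z).
  by have [z0|z0] := leP 0 (dotv u z); rewrite ?(ger0_norm z0) ?(ltr0_norm z0); lra.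
have mI : measurable_fun setT (fun x => g x * \1_S x).
  by apply: measurable_funM => //; exact: measurable_indic.
have mY2 : measurable_fun setT (fun x => dotv u x ^+ 2 * g x).
  by apply: measurable_funM => //; apply: measurable_funX; exact: measurable_dotv.
have Y20 z : 0 <= dotv u z ^+ 2 * g z by rewrite mulr_ge0// sqr_ge0.
have gI0 z : 0 <= g z * \1_S z by rewrite mulr_ge0.
have scale (h : V -> R) (a : R) : measurable_fun setT h -> (forall z, 0 <= h z) ->
    0 <= a -> (\int[lam]_x (a * h x)%:E = a%:E * \int[lam]_x (h x)%:E)%E.
  move=> mh h0 a0; under eq_integral do rewrite EFinM.
  rewrite ge0_integralZl_EFin//; first by move=> z _; rewrite lee_fin.
  exact/measurable_EFinP.
have mE (h : V -> R) (a : R) : measurable_fun setT h ->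
    measurable_fun setT (fun x => (a * h x)%:E).
  by move=> mh; apply/measurable_EFinP; exact: measurable_funM.
rewrite ge0_integralD//; last 4 first.
- by move=> z _; rewrite lee_fin mulr_ge0.
- exact: mE.
- by move=> z _; rewrite -EFinD lee_fin addr_ge0// mulr_ge0.
- by apply: emeasurable_funD; exact: mE.
rewrite ge0_integralD//; last 4 first.
- by move=> z _; rewrite lee_fin mulr_ge0.
- exact: mE.
- by move=> z _; rewrite lee_fin mulr_ge0.
- exact: mE.
rewrite !scale// g1 integral_dotv2// uu !mule1.
apply: (@le_trans _ _ ((24^-1)%:E + ((24^-1)%:E + 24%:E * (2 * q)%:E)))%E.
  by rewrite !leeD2l// lee_pmul2l.
by rewrite -EFinM -!EFinD lee_fin; lra.
Qed.

End key_ball.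

(** * Finite covers and Hausdorff measure *)

Section ereal_powers.
Context {R : realType}.
Local Open Scope ereal_scope.

Lemma expe_mono (x y : \bar R) s : 0 <= x -> x <= y -> 0 <= x ^+ s /\ x ^+ s <= y ^+ s.
Proof.
move=> x0 xy; elim: s => [|s [IH1 IH2]]; first by rewrite !expe0.
by rewrite !expeS; split; [exact: mule_ge0|exact: lee_pmul].
Qed.

Lemma expeMl (a : R) (x : \bar R) s : (a%:E * x) ^+ s = (a ^+ s)%:E * x ^+ s.
Proof.
elim: s => [|s IH]; first by rewrite !expe0 expr0 mule1.
by rewrite !expeS IH exprS EFinM muleACA.
Qed.

End ereal_powers.

Section finite_covers.
Context {R : realType}.
Local Open Scope ereal_scope.

Lemma ediam_ge0 n (U : set 'rV[R]_n) : U !=set0 -> 0 <= ediam U.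
Proof.
move=> [x Ux]; apply: ereal_sup_ubound; exists (x, x) => //=.
by rewrite subrr enorm0.
Qed.

Lemma ediam_le n (U : set 'rV[R]_n) (d : R) :
  (forall x y, U x -> U y -> (enorm (x - y) <= d)%R) -> ediam U <= d%:E.
Proof.
by move=> Ud; apply: ge_ereal_sup => _ [[x y] [/= Ux Uy] <-]; rewrite lee_fin Ud.
Qed.

Lemma ediam_image n m (g : 'rV[R]_n -> 'rV[R]_m) (L : R) (U : set 'rV[R]_n) :
  (0 < L)%R -> (forall x y, enorm (g x - g y) <= L * enorm (x - y))%R ->
  ediam (g @` U) <= L%:E * ediam U.
Proof.
move=> L0 gL; apply: ge_ereal_sup => _ [[_ _] [/= [x Ux <-] [y Uy <-]] <-].
apply: (@le_trans _ _ (L * enorm (x - y))%R%:E); first by rewrite lee_fin.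
rewrite EFinM lee_pmul2l//; apply: ereal_sup_ubound.
by exists (x, y).
Qed.

Lemma hausdorff_weight_ge0 s n (U : set 'rV[R]_n) : 0 <= hausdorff_weight s U.
Proof.
rewrite /hausdorff_weight; case: ifPn => // /set0P U0.
apply: mule_ge0 => //.
by apply: (expe_mono s _ (lexx _)).1; rewrite mule_ge0// ?lee_fin ?invr_ge0// ediam_ge0.
Qed.

Lemma hausdorff_weight_le s n m (U : set 'rV[R]_n) (W : set 'rV[R]_m) (L : R) :
  (0 <= L)%R -> (U !=set0 -> W !=set0) -> ediam W <= L%:E * ediam U ->
  (W !=set0 -> U !=set0) ->
  hausdorff_weight s W <= (L ^+ s)%:E * hausdorff_weight s U.
Proof.
move=> L0 UW dWU WU; rewrite [leLHS]/hausdorff_weight.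
case: ifPn => [_|/set0P W0].
  by rewrite mule_ge0 ?hausdorff_weight_ge0// lee_fin exprn_ge0.
have U0 := WU W0; rewrite /hausdorff_weight ifF; last exact/negbTE/set0P.
rewrite muleCA; apply: lee_pmul => //.
  by apply: (expe_mono s _ (lexx _)).1; rewrite mule_ge0// ?lee_fin ?invr_ge0// ediam_ge0.
rewrite -expeMl; apply: (expe_mono s _ _).2.
  by rewrite mule_ge0// ?lee_fin ?invr_ge0// ediam_ge0.
by rewrite muleCA lee_pmul2l// lte_fin invr_gt0.
Qed.

(** Finite covers by sets of diameter at most d, with an upper bound v for the
    sum of their weights: they are concatenated and carried along Lipschitz maps,
    and they bound the Hausdorff measure if v does not depend on d. *)
Definition fcover (s : nat) (d v : R) n (A : set 'rV[R]_n) : Prop :=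
  exists us : seq (set 'rV[R]_n),
    [/\ forall x, A x -> exists2 U, List.In U us & U x,
        forall U, List.In U us -> ediam U <= d%:E &
        \sum_(U <- us) hausdorff_weight s U <= v%:E].

Lemma fcover_delta s d v n (A : set 'rV[R]_n) : (0 < d)%R ->
  fcover s d v A -> hausdorff_delta s d A <= v%:E.
Proof.
move=> d0 [us [Aus usd usv]]; apply: le_trans usv.
apply: ereal_inf_lbound; exists (nth set0 us); first split.
- move=> x /Aus[U Uus Ux].
  elim: us Uus {Aus usd} => // W us IH /= [WU|/IH[k _ kx]].
    by exists 0%N => //=; rewrite WU.
  by exists k.+1.
- move=> k; have [kus|kus] := ltnP k (size us).
    apply: usd; elim: us k kus {Aus} => // W us IH [|k] /=; first by left.
    by rewrite ltnS => /IH; right.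
  by rewrite nth_default// ediam_le.
rewrite (nneseries_split _ (size us)); last by move=> k _; exact: hausdorff_weight_ge0.
rewrite eseries0 ?adde0 ?add0n.
  by rewrite (big_nth set0) big_mkord.
move=> k kus _; rewrite nth_default ?(leq_trans _ kus)//.
by rewrite /hausdorff_weight eqxx.
Qed.

Lemma fcover_hausdorff s v n (A : set 'rV[R]_n) :
  (forall d, (0 < d)%R -> fcover s d v A) -> hausdorff s A <= v%:E.
Proof.
by move=> H; apply: ge_ereal_sup => _ [d d0 <-]; apply: fcover_delta => //; exact: H.
Qed.

Lemma fcover_image s d v n m (A : set 'rV[R]_n) (B : set 'rV[R]_m)
    (g : 'rV[R]_n -> 'rV[R]_m) (L : R) :
  (0 < L)%R -> (forall x y, enorm (g x - g y) <= L * enorm (x - y))%R ->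
  B `<=` g @` A -> fcover s d v A -> fcover s (L * d) (L ^+ s * v) B.
Proof.
move=> L0 gL BA [us [Aus usd usv]]; exists [seq g @` U | U <- us]; split.
- move=> _ /BA[x Ax <-]; have [U Uus Ux] := Aus _ Ax.
  exists (g @` U); last by exists x.
  exact: (List.in_map (fun U => g @` U)).
- move=> U /List.in_map_iff[W [<- Wus]]; apply: le_trans (ediam_image W L0 gL) _.
  by rewrite EFinM lee_pmul2l// usd.
rewrite big_map EFinM.
apply: (@le_trans _ _ ((L ^+ s)%:E * \sum_(U <- us) hausdorff_weight s U)).
  rewrite ge0_sume_distrr; last by move=> U _; exact: hausdorff_weight_ge0.
  apply: lee_sum => U _; apply: hausdorff_weight_le.
  - exact: ltW.
  - by move=> [x Ux]; exists (g x), x.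
  - exact: ediam_image.
  - by move=> [_ [x Ux _]]; exists x.
by rewrite lee_pmul2l// lte_fin exprn_gt0.
Qed.

Lemma fcover_cat s d v w n (A B : set 'rV[R]_n) (C : set 'rV[R]_n) :
  C `<=` A `|` B -> fcover s d v A -> fcover s d w B -> fcover s d (v + w) C.
Proof.
move=> CAB [us [Aus usd usv]] [ws [Bws wsd wsw]]; exists (us ++ ws); split.
- move=> x /CAB[/Aus|/Bws][U Uus Ux]; exists U => //; apply/List.in_or_app;
  by [left|right].
- by move=> U Uw; case: (List.in_app_or _ _ _ Uw) => [/usd|/wsd].
by rewrite big_cat/= EFinD leeD.
Qed.

Lemma fcover_le s d v d' v' n (A B : set 'rV[R]_n) :
  B `<=` A -> (d <= d')%R -> (v <= v')%R -> fcover s d v A -> fcover s d' v' B.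
Proof.
move=> BA dd vv [us [Aus usd usv]]; exists us; split.
- by move=> x /BA/Aus.
- by move=> U /usd/le_trans; apply; rewrite lee_fin.
- by apply: le_trans usv _; rewrite lee_fin.
Qed.

Lemma fcover_seq s d n (I : eqType) (r : seq I) (v : I -> R) (A : I -> set 'rV[R]_n)
    (C : set 'rV[R]_n) :
  (forall x, C x -> exists2 i, i \in r & A i x) ->
  (forall i, i \in r -> fcover s d (v i) (A i)) -> fcover s d (\sum_(i <- r) v i)%R C.
Proof.
elim: r C => [|i r IH] C CA Av.
  exists [::]; split=> // [x /CA[]//|].
  by rewrite !big_nil.
rewrite big_cons.
apply: (@fcover_cat _ _ _ _ _ (A i) [set x | exists2 j, j \in r & A j x]).
- move=> x /CA[j]; rewrite inE => /orP[/eqP ->|jr]; first by left.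
  by right; exists j.
- by apply: Av; rewrite mem_head.
- by apply: IH => // j jr; apply: Av; rewrite inE jr orbT.
Qed.

Lemma fcover1 s (d r : R) n (U : set 'rV[R]_n) : (0 <= r)%R ->
  (forall x y, U x -> U y -> (enorm (x - y) <= 2 * r)%R) -> (2 * r <= d)%R ->
  fcover s d (fine (@lebesgue_rV R s [set x | (enorm x <= 1)%R]) * r ^+ s) U.
Proof.
move=> r0 Ur rd; have dU : ediam U <= (2 * r)%:E by exact: ediam_le.
exists [:: U]; split.
- by move=> x Ux; exists U => //; left.
- by move=> _ [<-|//]; apply: le_trans dU _; rewrite lee_fin.
rewrite big_seq1.
have ball_fin : @lebesgue_rV R s [set x | (enorm x <= 1)%R] \is a fin_num.
  rewrite ge0_fin_numE//; apply: (@lebesgue_bounded _ _ _ 1) => //.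
  apply: closed_measurable_rV; rewrite (_ : mkset _ = [set x | enorm (x - 0) <= 1])%R.
    exact: closed_eball.
  by apply/seteqP; split=> x /=; rewrite subr0.
rewrite EFinM fineK// /hausdorff_weight; case: ifPn => [_|/set0P U0].
  by rewrite mule_ge0// lee_fin exprn_ge0.
apply: lee_pmul => //.
  by apply: (expe_mono s _ (lexx _)).1; rewrite mule_ge0// ?lee_fin ?invr_ge0// ediam_ge0.
apply: (@le_trans _ _ (r%:E ^+ s)).
  apply: (expe_mono s _ _).2.
    by rewrite mule_ge0// ?lee_fin ?invr_ge0// ediam_ge0.
  rewrite -(mul1e r%:E) -[1](_ : (2^-1 * 2)%R%:E = 1); last by rewrite mulVf.
  by rewrite EFinM -muleA lee_pmul2l// lte_fin invr_gt0.
by rewrite -EFin_expe.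
Qed.

End finite_covers.

(** * Hausdorff measure of full dimension *)

Section finite_families.
Context d (T : measurableType d) (R : realType) (mu : {measure set T -> \bar R}).
Context (I : eqType).
Implicit Types (r : seq I) (F : I -> set T).
Local Open Scope ereal_scope.

Lemma measure_seq_cover r F (A : set T) : measurable A ->
  (forall i, measurable (F i)) -> (forall x, A x -> exists2 i, i \in r & F i x) ->
  mu A <= \sum_(i <- r) mu (F i).
Proof.
move=> mA mF; elim: r A mA => [|i r IH] A mA AF.
  rewrite big_nil (_ : A = set0) ?measure0//.
  by apply/seteqP; split=> // x /AF[].
rewrite big_cons; apply: (@le_trans _ _ (mu (F i `|` (A `\` F i)))).
  apply: le_measure; rewrite ?inE//; first by apply: measurableU => //; exact: measurableD.
  by move=> x Ax; have [?|?] := pselect (F i x); [left|right].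
apply: le_trans (measureU2 _ _ _) _ => //; first exact: measurableD.
apply: leeD2l; apply: IH; first exact: measurableD.
by move=> x [/AF[j]]; rewrite inE => /orP[/eqP -> //|jr Fj _]; exists j.
Qed.

Lemma measure_seq_disjoint r F (A : set T) : measurable A -> uniq r ->
  (forall i, i \in r -> measurable (F i)) -> (forall i, i \in r -> F i `<=` A) ->
  (forall i j x, i \in r -> j \in r -> F i x -> F j x -> i = j) ->
  \sum_(i <- r) mu (F i) <= mu A.
Proof.
move=> mA; elim: r A mA => [A mA _ _ _ _|i r IH A mA /= /andP[ir ur] mF FA Fd].
  by rewrite big_nil measure_ge0.
have FiA : F i `<=` A by apply: FA; rewrite mem_head.
have mFi : measurable (F i) by apply: mF; rewrite mem_head.
rewrite big_cons -(setDUK FiA) measureU//; [|exact: measurableD|exact: setDIK].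
apply: leeD2l; apply: IH => //; first exact: measurableD.
- by move=> j jr; apply: mF; rewrite inE jr orbT.
- move=> j jr x Fjx; split; first by apply: (FA j) => //; rewrite inE jr orbT.
  move=> Fix; move/negP: ir; apply; rewrite (Fd i j x)// ?mem_head// inE jr orbT//.
- by move=> j k x jr kr; apply: Fd; rewrite inE ?jr ?kr orbT.
Qed.

End finite_families.

Section balls.
Context {R : realType} {n : nat}.
Local Notation V := 'rV[R]_n.
Local Notation lam := (@lebesgue_rV R n).

Let unit_ball : set V := [set x | enorm x <= 1].

Definition ball_volume : R := fine (lam [set x : V | enorm x <= 1]).

Let measurable_unit_ball : measurable unit_ball.
Proof.
apply: closed_measurable_rV; rewrite /unit_ball.
rewrite (_ : mkset _ = [set x : V | enorm (x - 0) <= 1]); first exact: closed_eball.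
by apply/seteqP; split=> x /=; rewrite subr0.
Qed.

Lemma ball_volumeE : lam [set x : V | (enorm x <= 1)%R] = ball_volume%:E.
Proof.
by rewrite fineK// ge0_fin_numE//; apply: (@lebesgue_bounded _ _ _ 1).
Qed.

(** The sphere is null as the boundary of a convex set. *)
Lemma lebesgue_unit_open_ball : lam [set x : V | (enorm x < 1)%R] = ball_volume%:E.
Proof.
have mo : measurable [set x : V | (enorm x < 1)%R].
  rewrite (_ : mkset _ = [set x : V | enorm (x - 0) < 1]); first exact: measurable_eball.
  by apply/seteqP; split=> x /=; rewrite subr0.
rewrite -ball_volumeE; apply/eqP; rewrite eq_le; apply/andP; split.
  by apply: le_measure; rewrite ?inE// => x /= /ltW.
have cb : convexv unit_ball.
  move=> x y t /andP[t0 t1] x1 y1; rewrite /unit_ball/=.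
  apply: le_trans (enormD _ _) _; rewrite !enormZ !ger0_norm ?subr_ge0//.
  have : t * enorm x <= t * 1 by rewrite ler_wpM2l.
  have : (1 - t) * enorm y <= (1 - t) * 1 by rewrite ler_wpM2l// subr_ge0.
  by lra.
have i0 : unit_ball° !=set0.
  exists 0; apply/nbhs_enormP; exists 1 => // y; rewrite subr0; exact: ltW.
have N0 := convex_boundary_null cb i0.
have mi : measurable (unit_ball°) by exact: open_measurable_rV (@open_interior _ _).
have mc : measurable (closure unit_ball) by exact: closed_measurable_rV (@closed_closure _ _).
rewrite -[leRHS]adde0 -N0; apply: le_trans (measureU2 _ _ _) => //; last exact: measurableD.
apply: le_measure; rewrite ?inE//; first by apply: measurableU => //; exact: measurableD.
move=> x /= x1; have [x1'|x1'] := ltP (enorm x) 1; first by left.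
right; split; first exact: subset_closure.
move=> /nbhs_enormP[e e0 xe].
have : unit_ball ((1 + e / 2) *: x).
  have xE : enorm x = 1 by apply/le_anti; rewrite x1 x1'.
  apply: xe; rewrite scalerDl scale1r addrC addKr enormZ xE mulr1 gtr0_norm.
    by rewrite ltr_pdivrMr// ltr_pMr// ltr1n.
  by rewrite divr_gt0.
rewrite /unit_ball/= enormZ gtr0_norm ?addr_gt0 ?divr_gt0//.
have : 0 < e / 2 by rewrite divr_gt0.
by move: x1'; nra.
Qed.

Lemma lebesgue_open_ball (c : V) (r : R) : 0 < r ->
  lam [set x : V | (enorm (x - c) < r)%R] = (ball_volume * r ^+ n)%:E.
Proof.
move=> r0; rewrite mulrC EFinM -lebesgue_unit_open_ball.
have mo : measurable [set x : V | (enorm x < 1)%R].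
  rewrite (_ : mkset _ = [set x : V | enorm (x - 0) < 1]); first exact: measurable_eball.
  by apply/seteqP; split=> x /=; rewrite subr0.
rewrite -lebesgue_scale// -[RHS](lebesgue_rV_shift (- c)).
  congr (lam _); apply/seteqP; split=> x /=;
    by rewrite enormZ gtr0_norm ?invr_gt0// ltr_pdivrMl// mulr1.
exact: measurable_preim (measurable_scalev _) mo.
Qed.

Lemma ball_volume_gt0 : 0 < ball_volume.
Proof.
rewrite -lte_fin -lebesgue_unit_open_ball; have := lebesgue_ball_gt0 (0 : V) ltr01.
by congr (_ < lam _)%E; apply/seteqP; split=> x /=; rewrite subr0.
Qed.

(** Continuity from above of the measure along the neighbourhoods of A. *)
Lemma lebesgue_neighbourhood (A : set V) (M v : R) : closed A ->
  (forall x, A x -> enorm x <= M) -> (lam A < v%:E)%E ->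
  exists2 e, 0 < e & (lam [set y | exists2 x, A x & (enorm (y - x) < e)%R] < v%:E)%E.
Proof.
move=> cA AM Av.
pose O (k : nat) := [set y | exists2 x, A x & enorm (y - x) < k.+1%:R^-1].
have mO k : measurable (O k).
  apply: open_measurable_rV; rewrite (_ : O k = \bigcup_(x in A) [set y | enorm (y - x) < k.+1%:R^-1]).
    by apply: bigcup_open => x _; exact: open_eball.
  by apply/seteqP; split=> y [x Ax yx]; exists x.
apply: contrapT => nO.
have vO k : (v%:E <= lam (O k))%E.
  rewrite leNgt; apply/negP => Ok; apply: nO; exists k.+1%:R^-1 => //.
have AO : \bigcap_k O k = A.
  apply/seteqP; split=> [y Oy|y Ay k _]; last by exists y; rewrite ?subrr ?enorm0.
  apply: cA; apply/closure_enormP => e e0.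
  pose k := Num.bound e^-1.
  have [x Ax yx] := Oy k I; exists x => //; rewrite enormBC.
  apply: lt_trans yx _; rewrite invf_plt ?posrE//.
  by apply: lt_trans (archi_boundP _) _; rewrite ?invr_ge0 ?ltW// ltr_nat.
have cO : lam (O k) @[k --> \oo] --> lam A.
  rewrite -AO; apply: nonincreasing_cvg_mu => //.
  - apply: (@lebesgue_bounded _ _ _ (M + 1)) => // y [x /AM xM yx].
    rewrite -(subrK x y) (le_trans (enormD _ _))// addrC lerD//.
    by rewrite (le_trans (ltW yx))// invf_le1// ler1n.
  - by rewrite AO; exact: closed_measurable_rV.
  - move=> j k jk; apply/subsetPset => y [x Ax yx]; exists x => //.
    by apply: lt_le_trans yx _; rewrite lef_pV2 ?posrE// ler_nat.
move: Av; rewrite -(cvg_lim _ cO)// ltNge => /negP; apply.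
apply: lime_ge; last by near=> k; exact: vO.
by apply/cvg_ex; exists (lam A).
Unshelve. all: by end_near. Qed.

End balls.

Section full_dimension.
Context {R : realType} {n : nat}.
Local Notation V := 'rV[R]_n.
Local Notation lam := (@lebesgue_rV R n).

Lemma nat_part (a : R) (N : nat) : 0 <= a -> a < N%:R ->
  exists k : 'I_N, k%:R <= a < k%:R + 1.
Proof.
move=> a0; elim: N => [|N IH] aN; first by move: (le_lt_trans a0 aN); rewrite ltxx.
have [Na|/IH[k ka]] := leP N%:R a; last by exists (widen_ord (leqnSn N) k).
by exists ord_max => /=; rewrite Na -natr1 in aN *.
Qed.

Definition cell (h : R) (c : V) : set V := (fun v => v - c) @^-1` cube h.

Lemma measurable_cell h c : measurable (cell h c).
Proof. exact: measurable_preim (measurable_addv _) (measurable_cube h). Qed.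

Lemma lebesgue_cell h c : 0 <= h -> lam (cell h c) = (h ^+ n)%:E.
Proof.
by move=> h0; rewrite lebesgue_rV_shift ?lebesgue_cube//; exact: measurable_cube.
Qed.

Lemma cell_diam h c x y : 0 <= h -> cell h c x -> cell h c y ->
  enorm (x - y) <= Num.sqrt n%:R * h.
Proof.
move=> h0 cx cy; apply: enorm_le_coord => // i.
have := cx i; have := cy i; rewrite !mxE => /andP[? ?] /andP[? ?].
by rewrite ler_norml; apply/andP; split; lra.
Qed.

Lemma cell_ball h c : 0 < h ->
  [set x : V | enorm (x - (c + const_mx (h / 2))) < h / 3] `<=` cell h c.
Proof.
move=> h0 x /= xc i; have := le_lt_trans (coord_le_enorm _ i) xc.
by rewrite !mxE ltr_norml => /andP[? ?]; apply/andP; split; lra.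
Qed.

(** Half-open cells contain every point once; those that miss A are discarded, so
    that the union of the others is close to A. *)
Lemma grid_cover (A : set V) (M h : R) : 0 < h -> (forall x, A x -> enorm x <= M) ->
  exists r : seq V, [/\ uniq r,
    forall x, A x -> exists2 c, c \in r & cell h c x,
    forall c, c \in r -> exists2 x, A x & cell h c x &
    forall c c' x, c \in r -> c' \in r -> cell h c x -> cell h c' x -> c = c'].
Proof.
move=> h0 AM.
pose N := Num.bound (2 * `|M| / h).
pose corner (z : {ffun 'I_n -> 'I_N}) : V := \row_i (- `|M| + h * (z i)%:R).
pose r := [seq c <- undup [seq corner z | z <- enum {ffun 'I_n -> 'I_N}] |
  `[< exists2 x, A x & cell h c x >]].
exists r; split.
- by rewrite filter_uniq// undup_uniq.
- move=> x Ax; have xM i : `|x ord0 i| <= `|M|.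
    apply: le_trans (coord_le_enorm _ _) _.
    by apply: le_trans (AM _ Ax) _; exact: ler_norm.
  have z_ i : exists k : 'I_N, k%:R <= (x ord0 i + `|M|) / h < k%:R + 1.
    apply: nat_part.
      by apply: divr_ge0; [have := xM i; rewrite ler_norml => /andP[]; lra|exact: ltW].
    apply: le_lt_trans (archi_boundP _); last by apply: divr_ge0; [exact: mulr_ge0|exact: ltW].
    rewrite ler_pM2r ?invr_gt0//.
    by have := xM i; rewrite ler_norml => /andP[]; lra.
  pose z := [ffun i => projT1 (cid (z_ i))].
  have xz : cell h (corner z) x.
    move=> i; rewrite !mxE ffunE; case: cid => k /= /andP[].
    by rewrite ler_pdivlMr// ltr_pdivrMr// mulrDl mul1r (mulrC h); lra.
  exists (corner z) => //; rewrite mem_filter mem_undup map_f ?mem_enum// andbT.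
  by apply/asboolP; exists x.
- by move=> c; rewrite mem_filter => /andP[/asboolP].
move=> c c' x; rewrite !mem_filter !mem_undup.
move=> /andP[_ /mapP[z _ ->]] /andP[_ /mapP[z' _ ->]] xz xz'.
congr corner; apply/ffunP => i; apply/val_inj.
have le_ (u w : {ffun 'I_n -> 'I_N}) : cell h (corner u) x -> cell h (corner w) x ->
    (u i <= w i)%N.
  move=> xu xw; rewrite -ltnS -(ltr_nat R) -natr1 -(ltr_pM2l h0).
  by have := xu i; have := xw i; rewrite !mxE => /andP[? ?] /andP[? ?]; lra.
by apply/eqP; rewrite eqn_leq !le_.
Qed.

(** The bound for the measure of A, up to a factor theta: the factor is improved
    step by step until it is arbitrarily close to 1. *)
Definition covers_with (theta : R) : Prop := forall (A : set V) (M d v : R),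
  closed A -> (forall x, A x -> enorm x <= M) -> 0 < d ->
  ((theta%:E * lam A) < v%:E)%E -> fcover n d v A.

Let lam_fin (A : set V) M : closed A -> (forall x, A x -> enorm x <= M) ->
  exists2 a, 0 <= a & lam A = a%:E.
Proof.
move=> cA AM; exists (fine (lam A)); first exact: fine_ge0.
rewrite fineK// ge0_fin_numE//; apply: lebesgue_bounded AM.
exact: closed_measurable_rV.
Qed.

(** Fine grids: the total volume of the cells meeting A is close to that of A. *)
Let fine_grid (A : set V) (M d theta v : R) : closed A ->
  (forall x, A x -> enorm x <= M) -> 0 < d -> 0 < theta ->
  ((theta%:E * lam A) < v%:E)%E ->
  exists h (r : seq V), [/\ 0 < h, (Num.sqrt n%:R + 1) * h <= d,
    theta * ((size r)%:R * h ^+ n) < v &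
    [/\ uniq r, forall x, A x -> exists2 c, c \in r & cell h c x &
    forall c c' x, c \in r -> c' \in r -> cell h c x -> cell h c' x -> c = c']].
Proof.
move=> cA AM d0 t0 Av; have [a a0 aE] := lam_fin cA AM.
have Av' : (lam A < (v / theta)%:E)%E.
  by move: Av; rewrite aE -EFinM !lte_fin ltr_pdivlMr// mulrC.
have [e e0 eA] := lebesgue_neighbourhood cA AM Av'.
have s0 : 0 < Num.sqrt n%:R + 1 :> R by rewrite ltr_wpDl// sqrtr_ge0.
pose h := Num.min e d / (Num.sqrt n%:R + 1).
have m0 : 0 < Num.min e d by rewrite lt_min e0.
have h0 : 0 < h by rewrite divr_gt0.
have sh : (Num.sqrt n%:R + 1) * h = Num.min e d by rewrite mulrC divfK// gt_eqF.
have [r [ur Ar rA rd]] := grid_cover h0 AM.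
exists h, r; split=> //; first by rewrite sh ge_min lexx orbT.
rewrite mulrC -ltr_pdivlMr// -lte_fin; apply: le_lt_trans eA.
have -> : ((size r)%:R * h ^+ n)%:E = (\sum_(c <- r) lam (cell h c))%E.
  rewrite (eq_bigr (fun=> (h ^+ n)%:E)) => [|c _]; last by rewrite lebesgue_cell// ltW.
  by rewrite sumEFin big_const_seq count_predT iter_addr_0 mulr_natl.
apply: measure_seq_disjoint => //.
- apply: open_measurable_rV.
  rewrite (_ : mkset _ = \bigcup_(x in A) [set y | enorm (y - x) < e]).
    by apply: bigcup_open => x _; exact: open_eball.
  by apply/seteqP; split=> y [x Ax yx]; exists x.
- by move=> c _; exact: measurable_cell.
- move=> c /rA[x Ax xc] y yc; exists x => //.
  apply: le_lt_trans (cell_diam (ltW h0) yc xc) _.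
  apply: (@lt_le_trans _ _ ((Num.sqrt n%:R + 1) * h)); first by rewrite ltr_pM2r// ltrDl.
  by rewrite sh ge_min lexx.
Qed.

Let om : R := @ball_volume R n.
Let om0 : 0 < om. Proof. exact: ball_volume_gt0. Qed.

(** Covering by whole cells, which are contained in balls of volume proportional
    to theirs. *)
Let covers_base : exists2 theta, 1 <= theta & covers_with theta.
Proof.
have s0 : 0 < Num.sqrt n%:R + 1 :> R by rewrite ltr_wpDl// sqrtr_ge0.
pose C := 1 + om * ((Num.sqrt n%:R + 1) / 2) ^+ n.
have C1 : 1 <= C by rewrite lerDl mulr_ge0 ?exprn_ge0 ?divr_ge0 ?ltW.
have C0 : 0 < C by exact: lt_le_trans C1.
exists C => // A M d v cA AM d0 Av.
have [h [r [h0 hd rv [ur Ar _]]]] := fine_grid cA AM d0 C0 Av.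
pose rho := (Num.sqrt n%:R + 1) * h / 2.
have rho0 : 0 <= rho by rewrite divr_ge0// mulr_ge0// ltW.
have cells c : c \in r -> fcover n d (om * rho ^+ n) (cell h c).
  move=> cr; apply: fcover1 => //; last by rewrite mulrC divfK.
  move=> x y xc yc; rewrite mulrC divfK//.
  apply: le_trans (cell_diam (ltW h0) xc yc) _.
  by rewrite ler_pM2r// lerDl.
apply: fcover_le (fcover_seq Ar cells) => //.
rewrite big_const_seq count_predT iter_addr_0 -mulr_natl; apply: le_trans (ltW rv).
rewrite [leLHS](_ : _ = om * ((Num.sqrt n%:R + 1) / 2) ^+ n * ((size r)%:R * h ^+ n)).
  by apply: ler_wpM2r; [apply: mulr_ge0 => //; rewrite exprn_ge0// ltW|rewrite lerDr].
by rewrite /rho mulrAC exprMn; ring.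
Qed.

(** One round of exhaustion: the balls inscribed in the cells take away the
    proportion om / 3^n of their volume, at the exact price of their volume. *)
Let covers_step theta : 0 < theta -> covers_with theta ->
  covers_with (om / 3 ^+ n + theta * (1 - om / 3 ^+ n)).
Proof.
move=> t0 tC A M d v cA AM d0; set c0 := om / 3 ^+ n.
have c00 : 0 < c0 by rewrite divr_gt0// exprn_gt0.
have om3 h : om * (h / 3) ^+ n = c0 * h ^+ n.
  by rewrite exprMn exprVn /c0; ring.
have ball_le h c : 0 < h -> (lam [set x : V | (enorm (x - (c + const_mx (h / 2))) < h / 3)%R] <= lam (cell h c))%E.
  move=> h0; apply: le_measure; rewrite ?inE//; first exact: measurable_eball.
    exact: measurable_cell.
  exact: cell_ball.
have c01 : c0 <= 1.
  have := ball_le 1 0 ltr01; rewrite lebesgue_open_ball ?divr_gt0// lebesgue_cell//.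
  by rewrite lee_fin om3 expr1n mulr1.
set theta' := c0 + _ => Av.
have t'0 : 0 < theta' by rewrite ltr_wpDr// mulr_ge0 ?subr_ge0// ltW.
have [h [r [h0 hd rv [ur Ar rd]]]] := fine_grid cA AM d0 t'0 Av.
have h30 : 0 < h / 3 by rewrite divr_gt0.
pose B c := [set x : V | enorm (x - (c + const_mx (h / 2))) < h / 3].
pose W := (size r)%:R * h ^+ n.
pose A' := A `\` \bigcup_(c in [set` r]) B c.
have oB : open (\bigcup_(c in [set` r]) B c) by apply: bigcup_open => c _; exact: open_eball.
have cA' : closed A' by apply: closedI => //; exact: open_closedC.
have A'M x : A' x -> enorm x <= M by move=> [/AM].
have lamA' : (lam A' <= (W - c0 * W)%:E)%E.
  apply: (@le_trans _ _ (\sum_(c <- r) lam (cell h c `\` B c))%E).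
    apply: measure_seq_cover.
    - exact: closed_measurable_rV.
    - by move=> c; apply: measurableD; [exact: measurable_cell|exact: measurable_eball].
    - move=> x [/Ar[c cr xc] nB]; exists c => //; split=> // Bx; apply: nB.
      by exists c.
  rewrite (eq_bigr (fun=> (h ^+ n - c0 * h ^+ n)%:E)) => [|c _].
    rewrite sumEFin big_const_seq count_predT iter_addr_0 lee_fin -mulr_natl /W.
    by rewrite le_eqVlt; apply/orP; left; apply/eqP; ring.
  have mB : measurable (B c) by exact: measurable_eball.
  have mc : measurable (cell h c) by exact: measurable_cell.
  have H : lam (cell h c) = (lam (B c) + lam (cell h c `\` B c))%E.
    rewrite -measureU//; [|exact: measurableD|exact: setDIK].
    by rewrite setDUK//; exact: cell_ball.
  rewrite EFinB -(lebesgue_cell c (ltW h0)) -om3 -(lebesgue_open_ball (c + const_mx (h / 2)) h30).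
  rewrite H addeAC subee ?add0e// lebesgue_open_ball//.
have [a' a'0 a'E] := lam_fin cA' A'M.
have Av' : (theta%:E * lam A' < (v - c0 * W)%:E)%E.
  rewrite a'E in lamA' *; rewrite -EFinM lte_fin; rewrite lee_fin in lamA'.
  have : theta * a' <= theta * (W - c0 * W) by rewrite ler_wpM2l// ltW.
  by move: rv; rewrite /theta' -/W; lra.
have HA' := tC A' M d _ cA' A'M d0 Av'.
have HB : fcover n d (c0 * W) (\bigcup_(c in [set` r]) B c).
  have balls c : c \in r -> fcover n d (om * (h / 3) ^+ n) (B c).
    move=> cr; apply: fcover1; first exact: ltW.
      move=> x y xB yB; apply: le_trans (enorm_dist (c + const_mx (h / 2)) _ _) _.
      by rewrite (enormBC _ y) mulr_natl mulr2n lerD// ltW.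
    apply: le_trans hd; rewrite mulrCA -[leLHS]mulrC ler_pM2r//.
    have := sqrtr_ge0 (n%:R : R); lra.
  have Br x : (\bigcup_(c in [set` r]) B c) x -> exists2 c, c \in r & B c x.
    by move=> [c cr Bx]; exists c.
  apply: fcover_le (fcover_seq Br balls) => //.
  rewrite big_const_seq count_predT iter_addr_0 -[leLHS]mulr_natl om3 /W.
  by rewrite le_eqVlt; apply/orP; left; apply/eqP; ring.
rewrite (_ : v = c0 * W + (v - c0 * W)); last by ring.
apply: fcover_cat HB HA'.
by move=> x Ax; have [?|?] := pselect ((\bigcup_(c in [set` r]) B c) x); [left|right].
Qed.

(** Hausdorff measure of full dimension is at most Lebesgue measure. The
    constant 1 matters below: an exponential loss could not be afforded. *)
Lemma fcover_lebesgue (A : set V) (M d v : R) : closed A ->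
  (forall x, A x -> enorm x <= M) -> 0 < d -> (lam A < v%:E)%E -> fcover n d v A.
Proof.
move=> cA AM d0; have [a a0 aE] := lam_fin cA AM; rewrite aE lte_fin => av.
have [C C1 CC] := covers_base.
pose c0 := om / 3 ^+ n; have c00 : 0 < c0 by rewrite divr_gt0// exprn_gt0.
(* The fixed point 1 of the recursion attracts its orbits geometrically. *)
pose theta k := iter k (fun t => c0 + t * (1 - c0)) C.
have [c01|c01] := leP 1 c0.
  apply: (covers_step (lt_le_trans ltr01 C1) CC cA AM d0).
  rewrite aE -EFinM lte_fin; apply: le_lt_trans av; rewrite -/c0.
  apply: ler_piMl => //; nra.
have theta1 k : 1 <= theta k.
  elim: k => [//|k IH] /=; rewrite -/(theta k).
  have : 0 <= (theta k - 1) * (1 - c0) by rewrite mulr_ge0 ?subr_ge0// ltW.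
  by lra.
have thetaC k : covers_with (theta k).
  elim: k => [//|k IH]; exact: covers_step (lt_le_trans ltr01 (theta1 k)) IH.
have thetaE k : theta k = 1 + (C - 1) * (1 - c0) ^+ k.
  elim: k => [|k IH]; first by rewrite expr0 mulr1 addrC subrK.
  by rewrite /= -/(theta k) IH exprS; ring.
have [k Hk] : exists k, theta k * a < v.
  have cvg0 : ((C - 1) * (1 - c0) ^+ k * a) @[k --> \oo] --> ((C - 1) * 0 * a).
    apply: cvgMl; apply: cvgMr; apply: cvg_expr.
    by rewrite ger0_norm ?subr_ge0 ?ltW//; lra.
  rewrite mulr0 mul0r in cvg0.
  have va : 0 < v - a by rewrite subr_gt0.
  have /cvgrPdist_lt/(_ _ va)[k _ /(_ k (leqnn k))/=] := cvg0.
  rewrite sub0r normrN => H; exists k; rewrite thetaE mulrDl mul1r.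
  by have := le_lt_trans (ler_norm _) H; lra.
by apply: (thetaC k A M d v cA AM d0); rewrite aE -EFinM lte_fin.
Qed.

End full_dimension.

(** * Facets *)

Section reflection.
Context {R : realType} {n : nat}.
Local Notation V := 'rV[R]_n.

Definition reflect_along (w x : V) : V := x - (2 * dotv w x / dotv w w) *: w.

Variable w : V.
Local Notation T := (reflect_along w).

Lemma reflectD x y : T (x + y) = T x + T y.
Proof.
by rewrite /reflect_along dotvDr; apply/rowP => i; rewrite !mxE; ring.
Qed.

Lemma reflectZ a x : T (a *: x) = a *: T x.
Proof.
by rewrite /reflect_along dotvZr; apply/rowP => i; rewrite !mxE; ring.
Qed.

Lemma reflect_dotv x y : dotv (T x) (T y) = dotv x y.
Proof.
rewrite /reflect_along; have [->|w0] := eqVneq w 0; first by rewrite !scaler0 !subr0.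
have ww : dotv w w != 0.
  by rewrite -sqr_enorm sqrf_eq0 gt_eqF// enorm_gt0.
rewrite dotvBl !dotvBr !dotvZl !dotvZr (dotvC x w); field.
exact: ww.
Qed.

Lemma reflect_enorm x : enorm (T x) = enorm x.
Proof. by rewrite !enormE reflect_dotv. Qed.

Lemma reflectK : involutive T.
Proof.
move=> x; have [w0|w0] := eqVneq w 0.
  by rewrite /reflect_along w0 !scaler0 !subr0.
have ww : dotv w w != 0 by rewrite -sqr_enorm sqrf_eq0 gt_eqF// enorm_gt0.
rewrite /reflect_along dotvBr dotvZr; apply/rowP => i; rewrite !mxE; field.
exact: ww.
Qed.

Lemma reflectB x y : T (x - y) = T x - T y.
Proof. by rewrite -scaleN1r reflectD reflectZ scaleN1r. Qed.

Lemma measurable_reflect : measurable_fun [set: V] T.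
Proof.
apply/measurable_fun_rVP => i.
rewrite (_ : _ \o _ = fun x : V => x ord0 i - 2 * dotv w x / dotv w w * w ord0 i).
  apply: measurable_funB; first exact: measurable_coord.
  do 2 apply: measurable_funM => //; apply: measurable_funM => //.
  exact: measurable_dotv.
by apply/funext => x; rewrite /rV_coord /= !mxE.
Qed.

End reflection.

Section facet.
Context {R : realType} {m : nat}.
Local Notation V := 'rV[R]_m.+1.

Definition unit0 : V := consv 1 0.

Lemma tailvD (x y : V) : tailv (x + y) = tailv x + tailv y.
Proof. by apply/rowP => i; rewrite !mxE. Qed.

Lemma tailvZ a (x : V) : tailv (a *: x) = a *: tailv x.
Proof. by apply/rowP => i; rewrite !mxE. Qed.

Lemma dotv_unit0 (x : V) : dotv unit0 x = x ord0 ord0.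
Proof.
rewrite /dotv big_ord_recl consv0 mul1r big1 ?addr0// => i _.
by rewrite consvS mxE mul0r.
Qed.

(** Two vectors of the same length are exchanged by the reflection along their
    difference. *)
Lemma reflect_unit0 (u : V) : dotv u u = 1 -> reflect_along (u - unit0) unit0 = u.
Proof.
move=> u1; rewrite /reflect_along.
have e1 : dotv unit0 unit0 = 1 :> R by rewrite dotv_unit0 consv0.
have [->|une] := eqVneq u unit0; first by rewrite subrr scaler0 subr0.
have : dotv (u - unit0) (u - unit0) != 0.
  by rewrite -sqr_enorm sqrf_eq0 gt_eqF// enorm_gt0// subr_eq0.
rewrite !dotvBl !dotvBr (dotvC unit0 u) u1 e1 => d0.
rewrite (_ : _ / _ = -1); first by rewrite scaleN1r opprK addrC subrK.
by field; apply: contra_neq d0; lra.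
Qed.

Lemma enorm_consv (a b : R) (v w : 'rV[R]_m) :
  enorm (consv a v - consv a w) = enorm (v - w).
Proof.
rewrite -scaleN1r consvZ consvD mulN1r subrr scaleN1r.
rewrite !enormE /dotv big_ord_recl !consv0 mul0r add0r.
by congr Num.sqrt; apply: eq_bigr => i _; rewrite !consvS.
Qed.

Lemma measurable_tailv : measurable_fun [set: V] (@tailv R m).
Proof.
apply/measurable_fun_rVP => i.
rewrite (_ : _ \o _ = fun x : V => x ord0 (lift ord0 i)); first exact: measurable_coord.
by apply/funext => x; rewrite /rV_coord/= mxE.
Qed.

Definition prism (F : set V) (u : V) (rho : R) : set V :=
  [set y | exists x s, [/\ F x, 0 < s < rho & y = x + s *: u]].

(** A prism over a facet is, after a reflection, a product. *)
Lemma facet_prism (F : set V) (u : V) (h M rho : R) : closed F ->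
  (forall x, F x -> enorm x <= M) -> (forall x, F x -> dotv u x = h) ->
  dotv u u = 1 -> 0 < rho ->
  exists a : R, [/\ 0 <= a, measurable (prism F u rho),
    lebesgue_rV (prism F u rho) = (rho * a)%:E &
    forall d v, 0 < d -> a < v -> fcover m d v F].
Proof.
move=> cF FM Fh u1 rho0.
pose T := reflect_along (u - unit0).
have TK : involutive T by exact: reflectK.
have Te : T unit0 = u by exact: reflect_unit0.
have Tu : T u = unit0 by rewrite -Te TK.
have T0 x : (T x) ord0 ord0 = dotv u x.
  by rewrite -dotv_unit0 -Tu reflect_dotv.
pose F' := [set v : 'rV[R]_m | F (T (consv h v))].
have gL v w : enorm (T (consv h v) - T (consv h w)) <= 1 * enorm (v - w).
  by rewrite mul1r -reflectB reflect_enorm enorm_consv.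
have cF' : closed F'.
  have cg : continuous (fun v => T (consv h v)) by exact: elipschitz_continuous gL.
  by apply: (closed_comp _ cF) => v _; exact: cg.
have F'M v : F' v -> enorm v <= M.
  move=> /FM; rewrite reflect_enorm; apply: le_trans.
  rewrite !enormE ler_sqrt ?dotv_ge0// /dotv big_ord_recl consv0 -expr2.
  under [X in _ <= _ + X]eq_bigr do rewrite consvS.
  by rewrite lerDr sqr_ge0.
have mF' : measurable F' by exact: closed_measurable_rV.
have FE x : F x -> x = T (consv h (tailv (T x))).
  by move=> Fx; rewrite -{1}(TK x) -[T x in LHS]consvK T0 Fh.
pose Q := [set z : V | h < z ord0 ord0 < h + rho /\ F' (tailv z)].
have mQ : measurable Q.
  apply: measurableI; last exact: measurable_preim measurable_tailv mF'.
  have := measurable_preim (@measurable_coord R m.+1 ord0) (@measurable_itv R `]h, h + rho[).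
  by congr measurable; apply/seteqP; split=> x /=; rewrite in_itv.
have PQ : prism F u rho = T @^-1` Q.
  apply/seteqP; split=> [_ [x [s [Fx /andP[s0 s1] ->]]]|y [/= /andP[y0 y1] Fy]].
    rewrite /Q /= T0 dotvDr dotvZr u1 mulr1 Fh// ltrDl s0 ltrD2l s1; split=> //.
    rewrite /F'/= (_ : tailv _ = tailv (T x)); first by rewrite -FE.
    have -> : T (x + s *: u) = T x + s *: unit0 by rewrite /T reflectD reflectZ -/T Tu.
    by rewrite tailvD tailvZ tailvK scaler0 addr0.
  exists (T (consv h (tailv (T y)))), (T y ord0 ord0 - h); split=> //.
    by apply/andP; split; lra.
  rewrite -[LHS]TK -Te -{1}/T.
  have -> (a : R) (b c : V) : T b + a *: T c = T (b + a *: c).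
    by rewrite /T reflectD reflectZ.
  congr T; rewrite -[LHS]consvK consvZ consvD scaler0 addr0 mulr1.
  by congr consv; rewrite addrC subrK.
have [a a0 aE] : exists2 a, 0 <= a & @lebesgue_rV R m F' = a%:E.
  exists (fine (lebesgue_rV F')); first exact: fine_ge0.
  rewrite fineK// ge0_fin_numE//; exact: lebesgue_bounded F'M.
exists a; split=> //.
- by rewrite PQ; exact: measurable_preim (measurable_reflect _) mQ.
- rewrite PQ lebesgue_involutive_isometry//; last 3 first.
  + exact: measurable_reflect.
  + exact: reflectD.
  + exact: reflect_enorm.
  rewrite lebesgue_rVSE.
  transitivity (\int[@lebesgue_measure R]_x (cst a%:E \_ `]h, (h + rho)%R[%classic) x)%E.
    apply: eq_integral => x _; rewrite patchE; case: ifPn => [/set_mem|/negP nx].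
      rewrite /= in_itv/= => x0a; rewrite -aE; congr lebesgue_rV.
      by apply/seteqP; split=> v; rewrite /Q/= consv0 tailvK; [case|].
    rewrite (_ : [set _ | _] = set0) ?measure0//; apply/seteqP; split=> v //= [].
    by rewrite consv0 => x0 _; apply: nx; rewrite mem_set//= in_itv.
  rewrite -integral_mkcond integral_cst//= lebesgue_measure_itv/= lte_fin ltrDl rho0.
  by rewrite -EFinB -EFinM; congr EFin; ring.
move=> d v d0 av.
have := fcover_image ltr01 gL _ (fcover_lebesgue cF' F'M d0 (_ : lebesgue_rV F' < v%:E)%E).
rewrite mul1r expr1n mul1r; apply; last by rewrite aE lte_fin.
by move=> x Fx; exists (tailv (T x)); rewrite /F'/= -?FE.
Qed.

End facet.

(** * Polytopes around a convex body *)

Lemma seq_argmin (T : eqType) (R : realDomainType) (s : seq T) (f : T -> R) :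
  s != [::] -> exists2 x, x \in s & forall y, y \in s -> f x <= f y.
Proof.
elim: s => // x [_ _|z s IH _].
  by exists x => [|y]; rewrite inE// => /eqP ->.
have [//|y ys ymin] := IH; have [xy|/ltW yx] := leP (f x) (f y).
  exists x; first by rewrite mem_head.
  move=> w; rewrite inE => /orP[/eqP ->//|/ymin]; exact: le_trans.
exists y; first by rewrite inE ys orbT.
by move=> w; rewrite inE => /orP[/eqP ->//|/ymin].
Qed.

Section perimeter.
Context {R : realType} {m : nat}.
Local Notation V := 'rV[R]_m.+1.
Local Notation lam := (@lebesgue_rV R m.+1).
Variables (K : set V) (M rho : R).
Hypotheses (cK : closed K) (vK : convexv K) (K0 : K !=set0)
  (KM : forall x, K x -> enorm x <= M) (rho0 : 0 < rho).

Local Notation pi := (projv cK vK K0).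

Let polytope (L : seq (V * R)) : set V :=
  [set y | forall p, p \in L -> dotv p.1 y <= p.2].

(** Compactness of the parallel surface at distance rho yields finitely many
    half spaces that contain K and together avoid that surface. *)
Let polytope_exists : exists L : seq (V * R), [/\ uniq L,
  forall p, p \in L -> dotv p.1 p.1 = 1,
  K `<=` polytope L & forall y, polytope L y -> enorm (y - pi y) <= rho].
Proof.
have pi_cont : continuous pi.
  by apply: (@elipschitz_continuous _ _ _ _ 1) => x y; rewrite mul1r projv_lipschitz.
have dist_cont : continuous (fun x : V => enorm (x - pi x)).
  apply: (@elipschitz_continuousR _ _ _ 2) => x y.
  have H1 := projv_lipschitz cK vK K0 x y; have H0 := enormBC x y.
  have H2 : enorm (x - pi x) <= enorm (x - y) + (enorm (y - pi y) + enorm (pi y - pi x)).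
    by apply: le_trans (enorm_dist y _ _) _; rewrite lerD2l; exact: enorm_dist.
  have H3 : enorm (y - pi y) <= enorm (y - x) + (enorm (x - pi x) + enorm (pi x - pi y)).
    by apply: le_trans (enorm_dist x _ _) _; rewrite lerD2l; exact: enorm_dist.
  rewrite (enormBC (pi y)) in H2.
  by rewrite ler_norml; apply/andP; split; lra.
pose S := [set x : V | enorm (x - pi x) = rho].
have cS : closed S.
  have -> : S = (fun x : V => enorm (x - pi x)) @^-1` [set rho] by [].
  by apply: closed_comp => [x _|]; [exact: dist_cont|exact: closed_eq].
have kS : compact S.
  apply: (@compact_enorm _ _ _ (rho + M)) => // x xr.
  rewrite -(subrK (pi x) x) (le_trans (enormD _ _))// xr lerD2l.
  by apply: KM; exact: projv_mem.
pose f (x : V) := (rho^-1 *: (x - pi x), dotv (rho^-1 *: (x - pi x)) (pi x)).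
pose H x := [set y : V | (f x).2 < dotv (f x).1 y].
have oH x : open (H x).
  rewrite /H; move: (f x) => [u h] /=.
  have e1 : 0 < enorm u + 1 by rewrite ltr_wpDl// enorm_ge0.
  apply/open_enormP => y /= yH; exists ((dotv u y - h) / (enorm u + 1)).
    by rewrite divr_gt0 ?subr_gt0.
  move=> z zy; rewrite -(subrK y z) dotvDr.
  have := cauchy_schwarz_norm u (z - y); rewrite ler_norml => /andP[H1 _].
  move: zy; rewrite ltr_pdivlMr// mulrDr mulr1 => H2.
  by have H3 := enorm_ge0 (z - y); lra.
have SH : S `<=` cover S H.
  move=> x xS; exists x => //; rewrite /H/= -subr_gt0 -dotvBr dotvZl -sqr_enorm xS.
  by rewrite mulr_gt0 ?invr_gt0// exprn_gt0.
have := kS; rewrite compact_cover => /(_ _ S H (fun x _ => oH x) SH)[D DS SD].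
pose L := undup [seq f x | x <- finmap.enum_fset D].
have LS p : p \in L -> exists2 x, S x & p = f x.
  rewrite mem_undup => /mapP[x xD ->]; exists x => //.
  by have := DS x xD; rewrite inE.
have unitL p : p \in L -> dotv p.1 p.1 = 1.
  move=> /LS[x xS ->] /=; rewrite dotvZl dotvZr -sqr_enorm xS; field.
  by rewrite gt_eqF.
have KP : K `<=` polytope L.
  move=> k Kk p /LS[x xS ->] /=; rewrite !dotvZl ler_pM2l ?invr_gt0//.
  by rewrite -subr_le0 -dotvBr; exact: projv_obtuse.
exists L; split=> //; first exact: undup_uniq.
move=> y Py; rewrite leNgt; apply/negP => yr.
have y0 : 0 < enorm (y - pi y) by exact: lt_trans yr.
pose t := rho / enorm (y - pi y).
have t0 : 0 < t by rewrite divr_gt0.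
have t1 : t <= 1 by rewrite ler_pdivrMr// mul1r ltW.
pose z := pi y + t *: (y - pi y).
have piz : pi z = pi y.
  apply: projv_unique; first exact: projv_mem.
  move=> k Kk; rewrite /z addrC addKr dotvZl pmulr_rle0//; exact: projv_obtuse.
have zS : S z.
  rewrite /S/= piz /z addrC addKr enormZ gtr0_norm// divfK// gt_eqF//.
have [x xD xz] := SD z zS.
have /Py Pf : f x \in L by rewrite mem_undup map_f.
have /KP/(_ (f x)) Pk := projv_mem cK vK K0 y.
have {}Pk : dotv (f x).1 (pi y) <= (f x).2 by apply: Pk; rewrite mem_undup map_f.
move: xz; rewrite /H/= ltNge => /negP; apply.
rewrite /z dotvDr dotvZr dotvBr.
have H1 : t * dotv (f x).1 y <= t * (f x).2 by rewrite ler_wpM2l// ltW.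
have H2 : (1 - t) * dotv (f x).1 (pi y) <= (1 - t) * (f x).2 by rewrite ler_wpM2l// subr_ge0.
by rewrite /= in H1 H2 *; lra.
Qed.

Let facet (L : seq (V * R)) (p : V * R) : set V :=
  polytope L `&` [set y | dotv p.1 y = p.2].

Let continuous_dotv (u : V) : continuous (dotv u).
Proof.
apply: (@elipschitz_continuousR _ _ _ (enorm u)) => x y.
by rewrite -dotvBr; exact: cauchy_schwarz_norm.
Qed.

Let closed_facet L p : closed (facet L p).
Proof.
apply: closedI.
  rewrite (_ : polytope L = \bigcap_(q in [set` L]) [set y | dotv q.1 y <= q.2]).
    apply: closed_bigI => q _.
    rewrite (_ : mkset _ = dotv q.1 @^-1` [set r | r <= q.2])//.
    by apply: closed_comp => [x _|]; [exact: continuous_dotv|exact: closed_le].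
  by apply/seteqP; split=> y.
rewrite (_ : mkset _ = dotv p.1 @^-1` [set p.2])//.
by apply: closed_comp => [x _|]; [exact: continuous_dotv|exact: closed_eq].
Qed.

(** The projection maps the ray from K through an outer point to one point, and
    the ray leaves the polytope through a facet. *)
Let ray_meets_facet L y : K `<=` polytope L ->
  (forall y, polytope L y -> enorm (y - pi y) <= rho) -> ~ K y ->
  exists2 p, p \in L & exists2 z, facet L p z & pi z = pi y.
Proof.
move=> KP Prho nKy; pose d := y - pi y.
have d0 : 0 < enorm d.
  apply: enorm_gt0; rewrite subr_eq0; apply: contra_notN nKy => /eqP ->.
  exact: projv_mem.
have piz s : 0 <= s -> pi (pi y + s *: d) = pi y.
  move=> s0; apply: projv_unique; first exact: projv_mem.
  by move=> k Kk; rewrite addrC addKr dotvZl mulr_ge0_le0//; exact: projv_obtuse.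
have Ppi : polytope L (pi y) by apply: KP; exact: projv_mem.
pose L' := [seq q <- L | 0 < dotv q.1 d].
have L'0 : L' != [::].
  apply/eqP => L'0; pose s := 2 * rho / enorm d.
  have s0 : 0 <= s by rewrite divr_ge0 ?mulr_ge0 ?ltW.
  have : polytope L (pi y + s *: d).
    move=> q qL; rewrite dotvDr dotvZr -[leRHS]addr0 lerD//; first exact: Ppi.
    rewrite mulr_ge0_le0// leNgt; apply/negP => qd.
    have : q \in L' by rewrite mem_filter qd.
    by rewrite L'0.
  move/Prho; rewrite piz// addrC addKr enormZ ger0_norm// divfK ?gt_eqF//.
  by move: rho0; lra.
have [q qL' qmin] := seq_argmin (fun q => (q.2 - dotv q.1 (pi y)) / dotv q.1 d) L'0.
move: qL'; rewrite mem_filter => /andP[qd qL].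
pose t := (q.2 - dotv q.1 (pi y)) / dotv q.1 d.
have t0 : 0 <= t by rewrite divr_ge0 ?subr_ge0 ?(ltW qd)//; exact: Ppi.
exists q => //; exists (pi y + t *: d); last exact: piz.
split; last by rewrite /= dotvDr dotvZr divfK ?gt_eqF// addrC subrK.
move=> r rL; rewrite dotvDr dotvZr; have [rd|rd] := leP (dotv r.1 d) 0.
  by rewrite -[leRHS]addr0 lerD ?mulr_ge0_le0//; exact: Ppi.
have /qmin : r \in L' by rewrite mem_filter rd.
by rewrite -/t ler_pdivlMr// lerBrDl.
Qed.

Let boundary_projection L : K `<=` polytope L ->
  (forall y, polytope L y -> enorm (y - pi y) <= rho) ->
  boundary K `<=` pi @` [set z | exists2 p, p \in L & facet L p z].
Proof.
move=> KP Prho x [clx nix].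
have Kx : K x by exact: cK.
have pix : pi x = x.
  by apply: projv_unique => // k _; rewrite subrr dotv0l.
set F := [set z | _].
have FM z : F z -> enorm z <= M + rho.
  move=> [p pL [Pz _]]; rewrite -(subrK (pi z) z) addrC (le_trans (enormD _ _))//.
  by rewrite lerD ?Prho//; apply: KM; exact: projv_mem.
have cF : closed F.
  rewrite (_ : F = \bigcup_(p in [set` L]) facet L p); last first.
    by apply/seteqP; split=> z [p pL Fz]; exists p.
  by apply: closed_bigcup => [|p _]; [exact: finite_seq|exact: closed_facet].
have pi_cont : continuous pi.
  by apply: (@elipschitz_continuous _ _ _ _ 1) => a b; rewrite mul1r projv_lipschitz.
have : compact (pi @` F).
  apply: continuous_compact; first by apply: continuous_subspaceT.
  exact: compact_enorm cF FM.
move/(compact_closed (@norm_hausdorff _ _)); apply.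
apply/closure_enormP => e e0.
have [y nKy yx] : exists2 y, ~ K y & enorm (y - x) < e.
  apply: contrapT => noy; apply: nix; apply/nbhs_enormP; exists e => // y yx.
  by apply: contrapT => nKy; apply: noy; exists y.
have [p pL [z Fz zy]] := ray_meets_facet KP Prho nKy.
exists (pi z); first by exists z => //; exists p.
rewrite zy -[in X in enorm (_ - X)]pix; apply: le_lt_trans yx.
exact: projv_lipschitz.
Qed.

(** The outward prisms of height rho over the facets are disjoint, since a point
    of a prism determines its base point, its nearest point in the polytope,
    hence the normal. *)
Lemma fcover_boundary (E : set V) (d w : R) : measurable E ->
  (forall k y, K k -> enorm (y - k) <= 2 * rho -> E y) ->
  (lam E < (rho * w)%:E)%E -> 0 < d -> fcover m d w (boundary K).
Proof.
move=> mE KE Ew d0.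
have [L [uL unitL KP Prho]] := polytope_exists.
have FM p z : facet L p z -> enorm z <= M + rho.
  move=> [Pz _]; rewrite -(subrK (pi z) z) addrC (le_trans (enormD _ _))//.
  by rewrite lerD ?Prho//; apply: KM; exact: projv_mem.
have a_ p : exists a : R, p \in L -> [/\ 0 <= a, measurable (prism (facet L p) p.1 rho),
    lam (prism (facet L p) p.1 rho) = (rho * a)%:E &
    forall d v, 0 < d -> a < v -> fcover m d v (facet L p)].
  have [pL|pL] := boolP (p \in L); last by exists 0.
  have [a H] := facet_prism (@closed_facet L p) (@FM p) (fun x Fx => proj2 Fx)
    (unitL p pL) rho0.
  by exists a.
pose a p := projT1 (cid (a_ p)).
have aP p : p \in L -> [/\ 0 <= a p, measurable (prism (facet L p) p.1 rho),
    lam (prism (facet L p) p.1 rho) = (rho * a p)%:E &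
    forall d v, 0 < d -> a p < v -> fcover m d v (facet L p)].
  by rewrite /a; case: cid.
have suma : rho * (\sum_(p <- L) a p) < rho * w.
  rewrite -lte_fin; apply: le_lt_trans Ew.
  have -> : (rho * \sum_(p <- L) a p)%:E = (\sum_(p <- L) lam (prism (facet L p) p.1 rho))%E.
    rewrite big_distrr/= -sumEFin big_seq_cond [RHS]big_seq_cond.
    by apply: eq_bigr => p; rewrite andbT => /aP[_ _ H _]; exact/esym/H.
  apply: measure_seq_disjoint => //.
  - by move=> p /aP[].
  - move=> p pL _ [x [s [[Px _] /andP[s0 s1] ->]]]; apply: (KE (pi x)).
      exact: projv_mem.
    rewrite addrAC (le_trans (enormD _ _))// mulr_natl mulr2n lerD ?Prho//.
    by rewrite enormZ gtr0_norm// enormE unitL// sqrtr1 mulr1 ltW.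
  - move=> p q y pL qL [x [s [[Px xp] /andP[s0 _] ->]]] [x' [s' [[Px' xq] /andP[s'0 _] E']]].
    have xx' : x - x' = s' *: q.1 - s *: p.1.
      have -> : x = x' + s' *: q.1 - s *: p.1 by rewrite -E' addrK.
      by apply/rowP => i; rewrite !mxE; ring.
    have H1 : 0 <= dotv p.1 (x - x') by rewrite dotvBr subr_ge0 xp; exact: Px'.
    have H2 : dotv q.1 (x - x') <= 0 by rewrite dotvBr subr_le0 xq; exact: Px.
    have H3 : dotv (x - x') (x - x') <= 0.
      rewrite {1}xx' dotvBl !dotvZl.
      have : 0 <= s * dotv p.1 (x - x') by rewrite mulr_ge0// ltW.
      have : s' * dotv q.1 (x - x') <= 0 by rewrite mulr_ge0_le0// ltW.
      by lra.
    have x0 := dotv_eq0 H3.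
    have sp : s *: p.1 = s' *: q.1.
      by apply/eqP; rewrite eq_sym -subr_eq0 -xx' x0.
    have ss : s = s'.
      have : enorm (s *: p.1) = enorm (s' *: q.1) by rewrite sp.
      by rewrite !enormZ !gtr0_norm// !enormE !unitL// sqrtr1 !mulr1.
    have pq1 : p.1 = q.1.
      by apply: (@scalerI _ _ s); rewrite ?gt_eqF// sp ss.
    rewrite [p]surjective_pairing [q]surjective_pairing pq1; congr pair.
    by rewrite -xp -xq pq1; congr dotv; apply/eqP; rewrite -subr_eq0 x0.
rewrite ltr_pM2l// in suma.
pose eta := (w - \sum_(p <- L) a p) / (size L).+1%:R.
have eta0 : 0 < eta by rewrite divr_gt0// subr_gt0.
have cov : fcover m d (\sum_(p <- L) (a p + eta)) [set z | exists2 p, p \in L & facet L p z].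
  apply: (fcover_seq (A := facet L)) => [x [p pL Fx]|p pL]; first by exists p.
  have [_ _ _ H] := aP p pL.
  by apply: H => //; rewrite ltrDl.
have pL1 x y : enorm (pi x - pi y) <= 1 * enorm (x - y).
  by rewrite mul1r projv_lipschitz.
have := fcover_image ltr01 pL1 (boundary_projection KP Prho) cov.
rewrite mul1r expr1n mul1r; apply: fcover_le => //.
rewrite big_split/= big_const_seq count_predT iter_addr_0.
have : eta * (size L).+1%:R = w - \sum_(p <- L) a p by rewrite divfK.
by rewrite -natr1 -mulr_natr; move: eta0; lra.
Qed.

End perimeter.

(** * Level sets *)

Section hausdorff_nonneg.
Context {R : realType} {n : nat}.
Local Open Scope ereal_scope.

Lemma hausdorff_ge0 s (A : set 'rV[R]_n) : 0 <= hausdorff s A.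
Proof.
apply: (@le_trans _ _ (hausdorff_delta s 1 A)).
  apply: le_ereal_inf_tmp => _ [U _ <-]; apply: nneseries_ge0 => k _ _.
  exact: hausdorff_weight_ge0.
by apply: ereal_sup_ubound; exists 1%R => //=.
Qed.

End hausdorff_nonneg.

Section level_sets.
Context {R : realType} {m : nat}.
Local Notation V := 'rV[R]_m.+1.
Local Notation lam := (@lebesgue_rV R m.+1).
Variable f : V -> R.
Hypotheses (fL : logconc f) (fI : isotropic f).
Local Notation g := (lsc_part f).
Variables q r : R.
Hypotheses (q0 : 0 < q) (r0 : 0 < r)
  (fball : forall p x, 0 < f p -> enorm x < r -> q ^+ (2 * m.+1) * f p <= g x).

Let l : R := (2 * m.+1%:R)^-1.

Let l0 : 0 < l. Proof. by rewrite invr_gt0 mulr_gt0. Qed.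
Let l2 : l <= 2^-1.
Proof. by rewrite lef_pV2 ?posrE ?mulr_gt0// ler_peMr// ler1n. Qed.

(** With the weight 1 / (2n) on the ball, the exponential factor of
    [isotropic_ball] only costs a constant. *)
Lemma level_set_shrunk (t : R) (x b : V) : 0 < t -> t <= f x ->
  enorm b < r -> t < 2 / q * g ((1 - l) *: x + l *: b).
Proof.
move=> t0 tx br; have fx : 0 < f x by exact: lt_le_trans tx.
have gb := fball fx br.
have qn0 : 0 < q ^+ (2 * m.+1) by rewrite exprn_gt0.
have gb0 : 0 < g b by apply: lt_le_trans gb; rewrite mulr_gt0.
have ib := (lsc_part_gt0 f b).1 gb0.
have iz : [set x | 0 < f x]° ((1 - l) *: x + l *: b).
  apply: convex_interior_segment => //.
  - exact: (logconc_convex_gt fL (lexx 0)).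
  - exact: subset_closure.
  - by rewrite l0 (le_trans l2)// invf_le1// ler1n.
rewrite lsc_partE//; rewrite lsc_partE// in gb gb0.
have l01 : 0 <= 1 - l <= 1 by move: l0 l2; lra.
have [_ /(_ x b _ l01 fx gb0)] := fL.
rewrite (_ : 1 - (1 - l) = l); last by ring.
move=> [fz H].
have lnb : (2 * m.+1)%:R * ln q + ln (f x) <= ln (f b).
  by rewrite mulr_natl -lnXn// -lnM ?posrE// ler_ln ?posrE// mulr_gt0.
have : ln q + ln (f x) <= ln (f ((1 - l) *: x + l *: b)).
  apply: le_trans H.
  have H1 : l * ((2 * m.+1)%:R * ln q + ln (f x)) <= l * ln (f b) by rewrite ler_pM2l.
  have H2 : l * (2 * m.+1)%:R = 1 by rewrite natrM mulVf// mulf_neq0.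
  have : l * ((2 * m.+1)%:R * ln q) = ln q by rewrite mulrA H2 mul1r.
  by move: H1; rewrite mulrDr; lra.
rewrite -lnM ?posrE// ler_ln ?posrE ?mulr_gt0// => H3.
rewrite mulrAC ltr_pdivlMr//.
have : q * t <= q * f x by rewrite ler_pM2l.
have : 0 < q * t by rewrite mulr_gt0.
by lra.
Qed.

Let E t : set V := [set x | t < 2 / q * g x].

Let mE t : measurable (E t).
Proof.
apply: measurable_gt_fun; apply: measurable_funM => //.
exact: measurable_lsc_part.
Qed.

(* Of the radius l * r available about the shrunk level set, two quarters are the
   neighbourhood of K used by [fcover_boundary], and one is spent on replacing
   points of the closure by points of the level set. *)
Let rho : R := l * r / 4.
Let rho0 : 0 < rho. Proof. by rewrite divr_gt0// mulr_gt0. Qed.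

Let ball_in_E t x y : 0 < t -> t <= f x -> enorm (y - (1 - l) *: x) < 4 * rho ->
  E t y.
Proof.
move=> t0 tx yx.
have -> : y = (1 - l) *: x + l *: (l^-1 *: (y - (1 - l) *: x)).
  by rewrite scalerA divff ?gt_eqF// scale1r addrC subrK.
apply: level_set_shrunk => //.
rewrite enormZ gtr0_norm ?invr_gt0// ltr_pdivrMl//.
by apply: lt_le_trans yx _; rewrite /rho; lra.
Qed.

(** The second moments bound the distance of a ball on which the density is
    bounded below. *)
Let level_set_bounded t : 0 < t -> exists M, forall x, t <= f x -> enorm x <= M.
Proof.
move=> t0.
have gI := lsc_part_isotropic fL fI.
have tq0 : 0 < t * q / 2 by rewrite divr_gt0// mulr_gt0.
pose kappa := t * q / 2 * (@ball_volume R m.+1 * (4 * rho) ^+ m.+1).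
have r40 : 0 < 4 * rho by rewrite mulr_gt0.
have k0 : 0 < kappa.
  by rewrite mulr_gt0// mulr_gt0 ?ball_volume_gt0 ?exprn_gt0.
exists (Num.sqrt m.+1%:R * (2 * (1 + kappa^-1 + 4 * rho))) => x tx.
have ki0 : 0 < kappa^-1 by rewrite invr_gt0.
apply: enorm_le_coord => [|i]; first by rewrite mulr_ge0// ltW// !addr_gt0.
pose a := (1 - l) * `|x ord0 i| - 4 * rho.
have [a1|a1] := leP a 1.
  have : 2^-1 * `|x ord0 i| <= (1 - l) * `|x ord0 i|.
    by rewrite ler_wpM2r//; move: l2; lra.
  by move: a1; rewrite /a; lra.
have a0 : 0 < a by exact: lt_trans a1.
pose B := [set y : V | enorm (y - (1 - l) *: x) < 4 * rho].
have mB : measurable B by exact: measurable_eball.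
have Bi y : B y -> a <= `|y ord0 i|.
  move=> /(le_lt_trans (coord_le_enorm _ i)); rewrite !mxE => yx.
  have l1 : 0 <= 1 - l by move: l2; lra.
  have := ler_normD (y ord0 i) ((1 - l) * x ord0 i - y ord0 i).
  rewrite addrCA subrr addr0 normrM (ger0_norm l1) (distrC ((1 - l) * _)).
  by move: yx; rewrite /a; lra.
have : ((a ^+ 2 * kappa)%:E <= \int[lam]_y (y ord0 i * y ord0 i * g y)%:E)%E.
  have -> : ((a ^+ 2 * kappa)%:E = \int[lam]_y ((a ^+ 2 * (t * q / 2))%:E * (\1_B y)%:E))%E.
    have B0 y : [set: V] y -> (0 <= (\1_B y : R)%:E)%E by rewrite lee_fin.
    have mB1 : measurable_fun [set: V] (fun y => (\1_B y : R)%:E).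
      by apply/measurable_EFinP; exact: measurable_indic.
    have ak0 : 0 <= a ^+ 2 * (t * q / 2) by rewrite mulr_ge0 ?sqr_ge0// ltW.
    rewrite ge0_integralZl_EFin//.
    have -> : (\int[lam]_y (\1_B y)%:E = (@ball_volume R m.+1 * (4 * rho) ^+ m.+1)%:E)%E.
      by rewrite integral_indic// setIT; exact: lebesgue_open_ball.
    rewrite -EFinM; congr EFin.
    by rewrite /kappa; ring.
  apply: ge0_le_integral_any => y.
    by rewrite -EFinM lee_fin mulr_ge0// mulr_ge0 ?sqr_ge0// ltW.
  rewrite -EFinM lee_fin indicE; case: (boolP (y \in B)) => [/set_mem By|_]; last first.
    by rewrite mulr0 mulr_ge0 ?lsc_part_ge0// -expr2 sqr_ge0.
  rewrite mulr1; apply: ler_pM; rewrite ?sqr_ge0 ?(ltW tq0)//.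
    rewrite -expr2 -[leRHS]real_normK ?num_real// ler_pXn2r ?nnegrE ?(ltW a0)//.
    exact: Bi.
  by have := ball_in_E t0 tx By; rewrite /E/= mulrAC ltr_pdivlMr// => ?; lra.
have [_ _ ->] := gI; rewrite mxE eqxx lee_fin => ak.
have ak' : a * kappa <= 1.
  apply: le_trans ak; rewrite ler_wpM2r ?(ltW k0)// expr2 ler_peMr// ltW//.
have : a <= kappa^-1 by rewrite -[kappa^-1]mul1r ler_pdivlMr.
have : 2^-1 * `|x ord0 i| <= (1 - l) * `|x ord0 i|.
  by rewrite ler_wpM2r//; move: l2; lra.
by rewrite /a; lra.
Qed.

Let bernoulli k : 1 - k%:R * l <= (1 - l) ^+ k.
Proof.
elim: k => [|k IH]; first by rewrite mul0r subr0 expr0.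
rewrite exprS -natr1.
have H : (1 - l) * (1 - k%:R * l) <= (1 - l) * (1 - l) ^+ k.
  by rewrite ler_wpM2l//; move: l2; lra.
apply: le_trans H; have : 0 <= k%:R * (l * l) by rewrite mulr_ge0// mulr_ge0 ?ltW.
by lra.
Qed.

(** The factor lost by undoing the shrinking, in dimension m. *)
Let scaling_cost : ((1 - l)^-1) ^+ m <= 2.
Proof.
rewrite exprVn -[leRHS]invrK lef_pV2 ?posrE ?invr_gt0//; last first.
  by rewrite exprn_gt0//; move: l2; lra.
apply: le_trans (bernoulli m).
suff : m%:R * l <= 2^-1 by lra.
by rewrite /l invfM mulrCA ler_piMr// ler_pdivrMr// mul1r ler_nat.
Qed.

(** The boundary of the level set, shrunk about the origin by 1 - 1 / (2n), is
    the boundary of a convex body K; a neighbourhood of K of radius of order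
    1 / n stays in a level set for a comparable level. *)
Lemma hausdorff_level_boundary (t : R) : 0 < t ->
  (hausdorff m (boundary [set x : V | (t <= f x)%R]) <=
   (16 / r * m.+1%:R)%:E * lam [set x : V | (t < 2 / q * g x)%R])%E.
Proof.
move=> t0; rewrite -/(E t); pose A := [set x : V | t <= f x].
have k0 : 0 < 16 / r * m.+1%:R by rewrite mulr_gt0// divr_gt0.
have cA : convexv A by exact: logconc_convex_ge.
have [M AM] := level_set_bounded t0.
have [Eoo|Efin] := eqVneq (lam (E t)) +oo%E.
  by rewrite Eoo gt0_muley ?lte_fin// leey.
have [e e0 eE] : exists2 e, 0 <= e & lam (E t) = e%:E.
  exists (fine (lam (E t))); first exact: fine_ge0.
  by rewrite fineK// ge0_fin_numE// ltey.
rewrite eE -EFinM; apply/lee_addgt0Pr => eta eta0.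
pose L := (1 - l)^-1.
have l1 : 0 < 1 - l by move: l2; lra.
have L0 : 0 < L by rewrite invr_gt0.
have Ll : L * (1 - l) = 1 by rewrite mulVf// gt_eqF.
pose w := e / rho + eta / 2.
have w2 : 2 * w = 16 / r * m.+1%:R * e + eta.
  by rewrite /w /rho /l; field; rewrite !gt_eqF.
have Ew : (lam (E t) < (rho * w)%:E)%E.
  rewrite eE lte_fin /w mulrDr mulrCA divff ?gt_eqF// mulr1 ltrDl.
  by rewrite mulr_gt0// divr_gt0.
have w0 : 0 < w by rewrite ltr_wpDl ?divr_gt0// divr_ge0// ltW.
rewrite -EFinD -w2; apply: fcover_hausdorff => d d0.
pose K := [set k : V | closure A (L *: k)].
have LK (x : V) : L *: ((1 - l) *: x) = x by rewrite scalerA Ll scale1r.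
have scaleL (x y : V) : enorm (L *: x - L *: y) <= L * enorm (x - y).
  by rewrite -scalerBr enormZ gtr0_norm.
have cK : closed K.
  have cs : continuous (fun k : V => L *: k) by exact: elipschitz_continuous scaleL.
  by apply: (closed_comp _ (@closed_closure _ A)) => k _; exact: cs.
have vK : convexv K.
  move=> x y s s01 Kx Ky; rewrite /K/= scalerDr !(scalerA L) !(mulrC L) -!scalerA.
  exact: convexv_closure.
have clM y : closure A y -> enorm y <= M + 1.
  move=> /closure_enormP/(_ _ ltr01)[x Ax xy].
  rewrite -(subrK x y) addrC (le_trans (enormD _ _))// lerD ?AM//.
  by rewrite enormBC ltW.
have KM k : K k -> enorm k <= M + 1.
  move=> /clM; rewrite enormZ gtr0_norm//; apply: le_trans.
  by rewrite ler_peMl ?enorm_ge0// /L invf_ge1//; move: l0; lra.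
have KE k y : K k -> enorm (y - k) <= 2 * rho -> E t y.
  move=> /closure_enormP/(_ _ rho0)[x Ax xk] yk.
  apply: (@ball_in_E t x) => //; apply: le_lt_trans (enorm_dist k _ _) _.
  have -> : k - (1 - l) *: x = (1 - l) *: (L *: k - x).
    by rewrite scalerBr scalerA mulrC Ll scale1r.
  rewrite enormZ gtr0_norm// (enormBC _ x).
  have : (1 - l) * enorm (x - L *: k) <= enorm (x - L *: k).
    by rewrite ler_piMl ?enorm_ge0//; move: l0; lra.
  by move: rho0; lra.
have bA : boundary A `<=` (fun k => L *: k) @` boundary K.
  move=> x /(convex_boundary_closure cA)[clx nix].
  have clAx : closure A x by exact: (@closed_closure _ A).
  exists ((1 - l) *: x); last exact: LK.
  have Kx : K ((1 - l) *: x) by rewrite /K/= LK.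
  split; first exact: subset_closure.
  apply: contra_not nix => /nbhs_enormP[s s0 sK]; apply/nbhs_enormP.
  exists s => // y yx; rewrite -(LK y); apply: sK.
  rewrite -scalerBr enormZ gtr0_norm//; apply: le_lt_trans yx.
  by rewrite ler_piMl ?enorm_ge0//; move: l0; lra.
have [bA0|bAn0] := eqVneq (boundary A) set0.
  exists [::]; split=> //; first by rewrite -/A bA0.
  by rewrite big_nil lee_fin mulr_ge0// ltW.
have K0 : K !=set0.
  have /set0P[x /bA[k [Kk _] _]] := bAn0; exists k; exact: cK.
have dL : 0 < d / L by rewrite divr_gt0.
have := fcover_boundary cK vK K0 KM rho0 (mE t) KE Ew dL.
move=> /(fcover_image L0 scaleL bA); apply: fcover_le => //.
- by rewrite mulrC divfK// gt_eqF.
- by rewrite ler_wpM2r ?(ltW w0)//; exact: scaling_cost.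
Qed.

End level_sets.

Unset Implicit Arguments.

Theorem corollary6p4 (R : realType) :
  exists C : R, 0 < C /\
    forall n : nat, (1 <= n)%N ->
    forall f : 'rV[R]_n -> R, log_concave f -> isotropic f ->
      (\int[@lebesgue_measure R]_(t in `]0%R, +oo[)
         hausdorff n.-1 (boundary [set x : 'rV[R]_n | (t <= f x)%R])
       <= (C * n%:R)%R%:E)%E.
Proof.
pose q : R := 24^-1 * 24^-1; pose r : R := 48^-1.
have q0 : 0 < q by rewrite mulr_gt0.
have r0 : 0 < r by rewrite invr_gt0.
exists (16 / r * (2 / q)); split; first by rewrite mulr_gt0// divr_gt0.
move=> [//|m] _ f /log_concave_logconc fL fI /=.
have fball p x : 0 < f p -> enorm x < r -> q ^+ (2 * m.+1) * f p <= lsc_part f x.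
  by move=> fp xr; apply: isotropic_ball => //; rewrite q0 lexx.
have level := hausdorff_level_boundary fL fI q0 r0 fball.
have k0 : 0 <= 16 / r * m.+1%:R by rewrite mulr_ge0// divr_ge0// ltW.
have mg : measurable_fun setT (lsc_part f) by exact: measurable_lsc_part.
have mh : measurable_fun setT (fun x => 2 / q * lsc_part f x) by exact: measurable_funM.
have h0 x : 0 <= 2 / q * lsc_part f x.
  by rewrite mulr_ge0 ?lsc_part_ge0// divr_ge0// ltW.
pose tail t := @lebesgue_rV R m.+1 [set x | t < 2 / q * lsc_part f x].
apply: (@le_trans _ _ (\int[@lebesgue_measure R]_(t in `]0%R, +oo[)
    ((16 / r * m.+1%:R)%:E * tail t))%E).
  rewrite integral_mkcond [leRHS]integral_mkcond.
  apply: ge0_le_integral_any => t; rewrite !patchE; case: ifPn => //.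
    by move=> _; exact: hausdorff_ge0.
  by move=> /set_mem/=; rewrite in_itv/= andbT => /level.
have mtail : measurable_fun (`]0%R, +oo[%classic : set R) tail.
  by apply: measurable_funTS; exact: measurable_tail.
rewrite ge0_integralZl_EFin// -layer_cake//.
have [g1 _ _] := lsc_part_isotropic fL fI.
have gE0 x : [set: 'rV[R]_m.+1] x -> (0 <= (lsc_part f x)%:E)%E.
  by rewrite lee_fin lsc_part_ge0.
have mgE : measurable_fun setT (fun x => (lsc_part f x)%:E) by exact/measurable_EFinP.
have q20 : 0 <= 2 / q by rewrite divr_ge0// ltW.
under eq_integral do rewrite EFinM.
rewrite ge0_integralZl_EFin// g1 mule1 -EFinM lee_fin.
by rewrite le_eqVlt; apply/orP; left; apply/eqP; ring.
Qed.
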